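(* Let $\lambda\in(-\pi/2,\pi/2)$ be a real constant. For a function $p\in\mathcal{A}_0$ the following conditions are equivalent: (i) $p\in\mathcal{P}_\lambda$; (ii) $\dfrac{e^{i\lambda}p-i\sin\lambda}{\cos\lambda}\in\mathcal{P}_0$; (iii) there exists a Borel probability measure $\mu$ on $\partial\mathbb{D}$ such that $p(z)=\displaystyle\int_{\partial\mathbb{D}}\frac{1+e^{-2i\lambda}xz}{1-xz}\,d\mu(x)$ for $z\in\mathbb{D}$; (iv) $p\prec p_\lambda$ in $\mathbb{D}$; (v) $p\in V_\lambda^{*}$, where $$V_\lambda=\left\{\frac{1+\frac{1-e^{-2i\lambda}x}{(1+e^{-2i\lambda})x}z}{1-z}:\ |x|=1\right\};$$ (vi) $p\in W_\lambda^{**}$, where $$W_\lambda=\left\{t\,\frac{1+xe^{-2i\lambda}z}{1-xz}+(1-t)\,\frac{1+ye^{-2i\lambda}z}{1-yz}:\ |x|=|y|=1,\ 0\le t\le 1\right\}.$$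
   Context: $\mathbb{D}=\{z\in\mathbb{C}:|z|<1\}$. $\mathcal{A}$ is the set of analytic functions on $\mathbb{D}$ and $\mathcal{A}_0=\{f\in\mathcal{A}: f(0)=1\}$. For $-\pi/2<\lambda<\pi/2$, $\mathcal{P}_\lambda=\{p\in\mathcal{A}_0:\ \operatorname{Re}(e^{i\lambda}p(z))>0 \text{ for all } z\in\mathbb{D}\}$ (so $\mathcal{P}_0$ is the Carathéodory class), and $p_\lambda(z)=\dfrac{1+e^{-2i\lambda}z}{1-z}$. Subordination: for $f,F\in\mathcal{A}$, $f\prec F$ means there is an analytic function $\omega$ on $\mathbb{D}$ with $\omega(0)=0$, $|\omega(z)|<1$ and $f(z)=F(\omega(z))$ on $\mathbb{D}$. Convolution: for $f(z)=\sum_{n\ge0}a_nz^n$ and $g(z)=\sum_{n\ge0}b_nz^n$ in $\mathcal{A}$, $(f*g)(z)=\sum_{n\ge 0}a_nb_nz^n$. Dual sets: for $V\subset\mathcal{A}_0$, $V^{*}=\{g\in\mathcal{A}_0:\ (f*g)(z)\ne0 \text{ for all } z\in\mathbb{D} \text{ and all } f\in V\}$, and $V^{**}=(V^{*})^{*}$. *)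

(* Defs.v *)
From HB Require Import structures.
From mathcomp Require Import all_boot all_order all_algebra.
From mathcomp Require Import complex.
From mathcomp Require Import all_classical all_reals all_analysis.

Set Implicit Arguments.
Unset Strict Implicit.
Unset Printing Implicit Defensive.

Import Order.TTheory GRing.Theory Num.Theory.
Import numFieldNormedType.Exports.

Local Open Scope classical_set_scope.
Local Open Scope ring_scope.
Local Open Scope complex_scope.

(* The complex numbers are R[i] for R : realType.  R[i]^o is R[i] seen as a
   normed space over itself: it carries the topology and makes
   [derivable f z 1] complex differentiability. *)

Definition disc (R : realType) : set R[i] := [set z | `|z| < 1].

(* Analytic functions on the disc are total functions R[i] -> R[i] whose values
   off the disc are never used. *)
Definition analytic (R : realType) : set (R[i] -> R[i]) :=
  [set f | forall z : R[i], disc z -> derivable (f : R[i]^o -> R[i]^o) z 1].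

Definition analytic0 (R : realType) : set (R[i] -> R[i]) :=
  [set f | analytic f /\ f 0 = 1].

(* e^{it} *)
Definition expi (R : realType) (t : R) : R[i] := cos t +i* sin t.

Definition tilted_caratheodory (R : realType) (lam : R) : set (R[i] -> R[i]) :=
  [set p | analytic0 p /\
    forall z : R[i], disc z -> 0 < complex.Re (expi lam * p z)].

Definition p_lambda (R : realType) (lam : R) (z : R[i]) : R[i] :=
  (1 + expi (- 2 * lam) * z) / (1 - z).

Definition subordinate (R : realType) (f F : R[i] -> R[i]) : Prop :=
  exists omega : R[i] -> R[i],
    [/\ analytic omega, omega 0 = 0,
        forall z, disc z -> `|omega z| < 1 &
        forall z, disc z -> f z = F (omega z)].

Definition has_power_series (R : realType) (f : R[i] -> R[i]) (a : nat -> R[i])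
    : Prop :=
  forall z : R[i], disc z ->
    (series (fun n => a n * z ^+ n) : nat -> R[i]^o) @ \oo --> (f z : R[i]^o).

(* The default value 0 is only taken when f has no power series converging to it
   on the disc. *)
Definition coefs (R : realType) (f : R[i] -> R[i]) : nat -> R[i] :=
  xget (fun=> 0) [set a | has_power_series f a].

Definition convolution (R : realType) (f g : R[i] -> R[i]) (z : R[i]) : R[i] :=
  limn (series (fun n => coefs f n * coefs g n * z ^+ n) : nat -> R[i]^o).

Definition dual (R : realType) (V : set (R[i] -> R[i])) : set (R[i] -> R[i]) :=
  [set g | analytic0 g /\
    forall f, V f -> forall z, disc z -> convolution f g z != 0].

Definition V_ (R : realType) (lam : R) : set (R[i] -> R[i]) :=
  [set f | exists x : R[i], `|x| = 1 /\
    f = fun z => (1 + (1 - expi (- 2 * lam) * x)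
                      / ((1 + expi (- 2 * lam)) * x) * z) / (1 - z)].

Definition W_ (R : realType) (lam : R) : set (R[i] -> R[i]) :=
  [set f | exists x y : R[i], exists t : R,
    [/\ `|x| = 1, `|y| = 1, 0 <= t <= 1 &
      f = fun z =>
        t%:C * ((1 + x * expi (- 2 * lam) * z) / (1 - x * z))
        + (1 - t)%:C * ((1 + y * expi (- 2 * lam) * z) / (1 - y * z))]].

(* The unit circle as a type; set_type provides the subspace topology. *)
Definition circle (R : realType) : Type :=
  set_type [set x : R[i]^o | `|x| = 1].

HB.instance Definition _ (R : realType) := Choice.on (circle R).

Lemma circle1_subproof (R : realType) :
  (1 : R[i]^o) \in [set x : R[i]^o | `|x| = 1].
Proof. by rewrite inE /= normr1. Qed.

(* g_sigma_algebraType requires a pointed type. *)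
HB.instance Definition _ (R : realType) :=
  isPointed.Build (circle R) (exist _ 1 (circle1_subproof R)).

Definition borel_circle (R : realType) :=
  g_sigma_algebraType (open : set (set (circle R))).

Definition circle_val (R : realType) (x : borel_circle R) : R[i] :=
  set_val (x : circle R).

Definition complex_integral (R : realType) (mu : probability (borel_circle R) R)
    (f : borel_circle R -> R[i]) : R[i] :=
  Rintegral mu setT (fun x => complex.Re (f x))
  +i* Rintegral mu setT (fun x => complex.Im (f x)).

(* Main.v *)
Require Import Defs.
From HB Require Import structures.
From mathcomp Require Import all_boot all_order all_algebra.
From mathcomp Require Import ring lra.
From mathcomp Require Import complex.
From mathcomp Require Import all_classical all_reals all_analysis.
From mathcomp Require Import measurable_realfun.
Set Implicit Arguments.
Unset Strict Implicit.
Unset Printing Implicit Defensive.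
Import Order.TTheory GRing.Theory Num.Theory.
Import numFieldNormedType.Exports.
Local Open Scope classical_set_scope.
Local Open Scope ring_scope.
Local Open Scope complex_scope.

(** Write E = exp(i lam), e = exp(-2 i lam) and h(w) = (1 + w) / (1 - w). All
    six conditions say that E p maps the disc into the right half-plane, and
    they are linked through the identity E p_lam(w) = cos(lam) h(w) + i sin(lam)
    ([expi_p_lambda]).

    (i) gives (ii) by division by cos(lam) > 0. (ii) gives (iii) by Herglotz'
    theorem ([herglotz]), and the integral formula gives back (i) because Re h >
    0 on the disc ([representation_tilted]). (i) and (iv) are equivalent because
    the inverse of p_lam is w |-> (w - 1) / (w + e), and |w + e|^2 - |w - 1|^2 =
    4 cos(lam) Re(E w) ([norm_tilt]).

    For (v), convolution of p with the member of V_lam of parameter x is 1 + k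
    (p - 1) with k = (x + 1) / ((1 + e) x), and this vanishes exactly when x (p
    + e) = 1 - p; some x on the unit circle does this if and only if |p + e| =
    |p - 1|, that is Re(E p) = 0. So (v) says that E p omits the imaginary axis,
    and since E p(0) = E has positive real part this is (i) by connectedness.

    For (vi), every member of W_lam satisfies (i), hence is in the dual of
    V_lam; convolution being commutative, V_lam is contained in the dual of
    W_lam and (vi) implies (v). Conversely let g be in the dual of W_lam and put
    G = 1 + (1 + e) (g - 1). Convolving g with W_lam shows that no segment
    between two values of G on a circle |w| = |z| meets 0. As that circle is
    connected and compact, its image lies in an open half-plane bounded by a
    line through 0 ([half_plane]). By (iii), the convolution of g with p is the
    mean of G(x z) over a probability measure in x, so it lies in the same
    half-plane and is not 0.

    Herglotz' theorem is proved from the definition of complex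
    differentiability. Goursat's bisection ([goursat]), applied to f(exp w) on
    rectangles of height 2 pi, shows that circle means of a function holomorphic
    on an annulus do not depend on the radius ([cmean_annulus]). By continuity
    in the radius this survives one puncture, which yields Cauchy's formula in
    the form [cmean_diff_quotient] and then the Schwarz formula [schwarz]. The
    latter represents q(r z) by the density Re q(r exp(i t)) / (2 pi). As r
    tends to 1, the quantile functions of these densities have a pointwise limit
    Q along an ultrafilter, and the image of Lebesgue measure on [0, 1] under s
    |-> exp(-i Q(s)) is the required measure ([helly_quantile]).

    Convolutions are computed from coefficients, so power series are needed only
    for members of the families, which are explicit; for p, where (iii) provides
    one by integrating the geometric series; and for functions in a dual set,
    which have one because the convolution with a function without power series
    is 0. *)

(** * The complex plane as a normed space over itself *)

Local Notation normc := (@ComplexField.Normc.normc _).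
Local Notation Re := (@complex.Re _).
Local Notation Im := (@complex.Im _).

Section ComplexTopology.
Context {R : realType}.
Implicit Types (z w c : R[i]) (x : R).

Lemma normr_normc z : `|z| = (normc z)%:C. Proof. by []. Qed.
Lemma normc_ge0 z : 0 <= normc z.
Proof. by rewrite -ler0c -normr_normc. Qed.
Lemma normc_real x : normc x%:C = `|x|.
Proof. by rewrite /= expr0n /= addr0 sqrtr_sqr. Qed.
Lemma normc_sqrt (a b : R) : normc (a +i* b) = Num.sqrt (a ^+ 2 + b ^+ 2).
Proof. by []. Qed.
Lemma normci : normc 'i%C = 1 :> R.
Proof. by rewrite normc_sqrt expr0n expr1n add0r sqrtr1. Qed.
Lemma normcM z w : normc (z * w) = normc z * normc w.
Proof. by exact: ComplexField.Normc.normcM. Qed.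
Lemma normcV z : normc z^-1 = (normc z)^-1.
Proof. by exact: ComplexField.Normc.normcV. Qed.
Lemma normcX z n : normc (z ^+ n) = normc z ^+ n.
Proof. by apply: complexI; rewrite -normr_normc normrX normr_normc rmorphXn. Qed.
Lemma ler_normcD z w : normc (z + w) <= normc z + normc w.
Proof. by rewrite -lecR -normr_normc rmorphD /= -!normr_normc ler_normD. Qed.
Lemma normcN z : normc (- z) = normc z.
Proof. by apply: complexI; rewrite -!normr_normc normrN. Qed.
Lemma normcB z w : normc (z - w) = normc (w - z).
Proof. by rewrite -normcN opprB. Qed.
Lemma normc0 : normc 0 = 0 :> R. Proof. by apply: complexI; rewrite -normr_normc normr0. Qed.
Lemma normc1 : normc 1 = 1 :> R. Proof. by apply: complexI; rewrite -normr_normc normr1. Qed.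
Lemma normc_eq0 z : (normc z == 0) = (z == 0).
Proof. by rewrite -(inj_eq (@complexI R)) -normr_normc normr_eq0. Qed.
Lemma normc_gt0 z : (0 < normc z) = (z != 0).
Proof. by rewrite lt_def normc_eq0 normc_ge0 andbT. Qed.
Lemma discE z : disc z = (normc z < 1) :> Prop.
Proof. by rewrite /disc /= normr_normc ltcR. Qed.
Lemma Re_le_normc z : `|Re z| <= normc z.
Proof. by rewrite -lecR; exact: normc_ge_Re. Qed.
Lemma Im_le_normc z : `|Im z| <= normc z.
Proof.
by case: z => a b /=; rewrite -sqrtr_sqr ler_wsqrtr// lerDr sqr_ge0.
Qed.
Lemma normc_le_ReIm z : normc z <= `|Re z| + `|Im z|.
Proof.
case: z => a b; rewrite [a +i* b]complexE.
apply: le_trans (ler_normcD _ _) _; rewrite normcM !normc_real.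
by rewrite /= expr0n expr1n add0r sqrtr1 !mul1r !mul0r subr0 addr0 !add0r.
Qed.

(** Convergence of complex values is tested with real epsilons, so that all
    estimates can be made in R. *)
Lemma cvgcP {T : Type} (F : set_system T) {FF : Filter F} (f : T -> R[i]^o) (l : R[i]) :
  f @ F --> (l : R[i]^o) <->
  (forall e : R, 0 < e -> \forall t \near F, normc (l - f t) < e).
Proof.
split.
  move=> /cvgrPdist_lt h e e0; have := h e%:C; rewrite ltcR => /(_ e0).
  by apply: filterS => t; rewrite normr_normc ltcR.
move=> h; apply/cvgrPdist_lt => -[e e'] /=; rewrite ltcE /= => /andP[/eqP-> e0].
by apply: filterS (h e e0) => t; rewrite normr_normc (ltcR _ e).
Qed.

Lemma cvgc_ReIm {T : Type} (F : set_system T) {FF : Filter F} (f : T -> R[i]^o) (l : R[i]) :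
  f @ F --> (l : R[i]^o) <->
  (Re \o f @ F --> Re l) /\ (Im \o f @ F --> Im l).
Proof.
split=> [/cvgcP h|[/cvgrPdist_lt h1 /cvgrPdist_lt h2]].
  split; apply/cvgrPdist_lt => e e0; apply: filterS (h e e0) => t /=; apply: le_lt_trans.
    by rewrite -raddfB Re_le_normc.
  by rewrite -raddfB Im_le_normc.
apply/cvgcP => e e0; have e2 : 0 < e / 2 by rewrite divr_gt0.
apply: filterS2 (h1 _ e2) (h2 _ e2) => t /= h3 h4.
apply: le_lt_trans (normc_le_ReIm _) _.
by rewrite [ltRHS]splitr !raddfB ltrD.
Qed.

Lemma Re_continuous : continuous (Re : R[i]^o -> R).
Proof. by move=> z; have /cvgc_ReIm[] := @cvg_id _ (nbhs (z : R[i]^o)). Qed.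
Lemma Im_continuous : continuous (Im : R[i]^o -> R).
Proof. by move=> z; have /cvgc_ReIm[] := @cvg_id _ (nbhs (z : R[i]^o)). Qed.
Lemma cvg_normc {T : Type} (F : set_system T) {FF : Filter F} (f : T -> R[i]^o) (l : R[i]) :
  f @ F --> (l : R[i]^o) -> (fun t => normc (f t)) @ F --> normc l.
Proof.
move=> /cvgcP h; apply/cvgrPdist_lt => e e0; apply: filterS (h e e0) => w.
apply: le_lt_trans.
have := ler_dist_dist l (f w); rewrite !normr_normc -rmorphB normc_real lecR.
by [].
Qed.
Lemma real_complex_continuous : continuous ((fun x => x%:C) : R -> R[i]^o).
Proof. by move=> x; apply/cvgc_ReIm; split; [exact: cvg_id|exact: cvg_cst]. Qed.

Lemma nbhscP (z : R[i]^o) (A : set R[i]^o) :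
  nbhs z A <-> exists2 d : R, 0 < d & forall w, normc (w - z) < d -> A w.
Proof.
split.
  move=> /nbhs_ballP[[d d'] /=]; rewrite ltcE /= => /andP[/eqP-> d0] h.
  by exists d => // w wd; apply: h; rewrite /ball /= normr_normc normcB (ltcR _ d).
move=> [d d0 h]; apply/nbhs_ballP; exists d%:C; first by rewrite /= ltcR.
by move=> w; rewrite /ball /= normr_normc normcB ltcR => /h.
Qed.

Lemma ccontinuousP (f : R[i]^o -> R[i]^o) (z : R[i]^o) :
  {for z, continuous f} <->
  (forall e : R, 0 < e -> exists2 d : R, 0 < d &
     forall w : R[i], normc (w - z) < d -> normc (f w - f z) < e).
Proof.
split=> [h e e0|h].
  have /nbhscP[d d0 hd] := (@cvgcP _ (nbhs z) (nbhs_filter _) f (f z)).1 h e e0.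
  by exists d => // w /hd; rewrite normcB.
apply: (@cvgcP _ (nbhs z) (nbhs_filter _) f (f z)).2 => e /h[d d0 hd].
by apply/nbhscP; exists d => // w /hd; rewrite normcB.
Qed.
End ComplexTopology.
#[local] Arguments ComplexField.Normc.normc : simpl never.

(** * Complex derivatives and the exponential *)

(** The first-order expansion, stated over any field so that it serves both for
    real functions and for functions of a complex variable. *)
Lemma derivable_expand (K : numFieldType) (f : K^o -> K^o) (x : K) :
  derivable f x 1 -> forall e : K, 0 < e -> exists2 d : K, 0 < d &
  forall h, `|h| < d -> `|f (x + h) - f x - 'D_1 f x * h| <= e * `|h|.
Proof.
move=> /cvgrPdist_le /= h e e0; have := h e e0.
move=> /nbhs_ballP[d /= d0 hd]; exists d => // t td.
have [->|t0] := eqVneq t 0; first by rewrite addr0 subrr mulr0 subr0 normr0 mulr0.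
have := hd t; rewrite /ball /= sub0r normrN => /(_ td t0).
rewrite [_%:A]mulr1 [X in `|_ - X|](_ : _ = t^-1 * (f (x + t) - f x)); last first.
  by rewrite (addrC x).
rewrite -[lim _]/('D_1 f x) => le_e.
have -> : f (x + t) - f x - 'D_1 f x * t = - (('D_1 f x - t^-1 * (f (x + t) - f x)) * t).
  by field.
by rewrite normrN normrM ler_wpM2r.
Qed.

Section ComplexDerivative.
Context {R : realType}.
Implicit Types (f g : R[i] -> R[i]) (z w c : R[i]).

(** Complex differentiability in the first-order form used by the bisection
    argument; real epsilons and deltas make composition elementary. *)
Definition cderiv_at f z c := forall e : R, 0 < e -> exists2 d : R, 0 < d &
  forall h, normc h < d -> normc (f (z + h) - f z - c * h) <= e * normc h.

Lemma derivable_cderiv_at f z : derivable (f : R[i]^o -> R[i]^o) z 1 ->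
  cderiv_at f z ('D_1 (f : R[i]^o -> R[i]^o) z).
Proof.
move=> /derivable_expand fz e e0.
have e0' : 0 < e%:C by rewrite ltcR.
have [[d d'] /=] := fz _ e0'; rewrite ltcE /= => /andP[/eqP-> d0 hd].
exists d => // h hlt; rewrite -lecR rmorphM /= -!normr_normc.
by apply: hd; rewrite normr_normc (ltcR _ d).
Qed.

Lemma derivable_continuous_at f z : derivable (f : R[i]^o -> R[i]^o) z 1 ->
  {for z, continuous (f : R[i]^o -> R[i]^o)}.
Proof. by move=> /derivable1_diffP /differentiable_continuous. Qed.

Lemma cderiv_at_comp f g z c c' :
  cderiv_at g z c -> cderiv_at f (g z) c' -> cderiv_at (f \o g) z (c' * c).
Proof.
move=> hg hf e e0.
pose K := normc c + 1; pose L := normc c' + 1.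
have K0 : 0 < K by rewrite ltr_wpDl ?normc_ge0.
have L0 : 0 < L by rewrite ltr_wpDl ?normc_ge0.
have [d d0 hd] := hf (e / (2 * K)) (divr_gt0 e0 (mulr_gt0 (ltr0Sn _ 1) K0)).
have m0 : 0 < Num.min 1 (e / (2 * L)) by rewrite lt_min ltr01 divr_gt0// mulr_gt0.
have [d1 d10 hd1] := hg _ m0.
exists (Num.min d1 (d / K)); first by rewrite lt_min d10 divr_gt0.
move=> h; rewrite lt_min => /andP[hd1' hdK].
have /= := hd1 h hd1'; set u := g (z + h) - g z - c * h => hu.
have hu1 : normc u <= normc h.
  by apply: (le_trans hu); rewrite ler_piMl ?normc_ge0// ge_min lexx.
have hu2 : normc u <= e / (2 * L) * normc h.
  by apply: (le_trans hu); rewrite ler_wpM2r ?normc_ge0// ge_min lexx orbT.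
pose k := g (z + h) - g z.
have kE : k = u + c * h by rewrite /u /k subrK.
have hk : normc k <= K * normc h.
  rewrite kE; apply: (le_trans (ler_normcD _ _)).
  by rewrite normcM /K mulrDl mul1r addrC lerD2l.
have kd : normc k < d.
  by apply: (le_lt_trans hk); rewrite mulrC -ltr_pdivlMr.
have /= := hd k kd; rewrite /= {1}/k subrKC => hv.
have -> : f (g (z + h)) - f (g z) - c' * c * h =
  (f (g (z + h)) - f (g z) - c' * k) + c' * u by rewrite kE; ring.
apply: (le_trans (ler_normcD _ _)); rewrite normcM.
have -> : e * normc h = e / (2 * K) * (K * normc h) + L * (e / (2 * L) * normc h).
  by field; rewrite !gt_eqF.
apply: lerD.
  by apply: (le_trans hv); rewrite ler_pM2l// divr_gt0// mulr_gt0.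
apply: ler_pM => //; rewrite ?normc_ge0// /L lerDl; lra.
Qed.

Lemma cderiv_at_continuous f z c : cderiv_at f z c ->
  {for z, continuous (f : R[i]^o -> R[i]^o)}.
Proof.
move=> /(_ 1 ltr01)[d d0 hd]; pose K := 1 + normc c.
have K0 : 0 < K by rewrite ltr_pwDl ?normc_ge0.
apply/ccontinuousP => e e0.
exists (Num.min d (e / K)); first by rewrite lt_min d0 divr_gt0.
move=> w; rewrite lt_min ltr_pdivlMr// => /andP[wd we].
apply: le_lt_trans we.
have := hd _ wd; rewrite subrKC mul1r => hw.
have -> : f w - f z = (f w - f z - c * (w - z)) + c * (w - z) by rewrite subrK.
apply: (le_trans (ler_normcD _ _)); rewrite normcM /K [leRHS]mulrC [leRHS]mulrDl mul1r lerD2r; exact: hw.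
Qed.

Definition cexp w := (expR (Re w))%:C * expi (Im w).

Lemma expiD (s t : R) : expi (s + t) = expi s * expi t.
Proof. by rewrite /expi cosD sinD; simpc; rewrite [X in _ +i* X]addrC. Qed.
Lemma normc_expi (t : R) : normc (expi t) = 1.
Proof. by rewrite normc_sqrt cos2Dsin2 sqrtr1. Qed.
Lemma expi_neq0 (t : R) : expi t != 0.
Proof. by rewrite -normc_gt0 normc_expi. Qed.
Lemma expi0 : expi 0 = 1 :> R[i].
Proof. by rewrite /expi cos0 sin0. Qed.
Lemma expiN (t : R) : expi (- t) = (expi t)^*%C.
Proof. by rewrite /expi cosN sinN. Qed.
Lemma expi2pi (t : R) : expi (t + 2 * pi) = expi t.
Proof. by rewrite /expi mulr_natl cosD2pi sinD2pi. Qed.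

Lemma cexpD w w' : cexp (w + w') = cexp w * cexp w'.
Proof. by rewrite /cexp !raddfD /= expRD expiD rmorphM /=; ring. Qed.

Lemma expR_expand0 (e : R) : 0 < e -> exists2 d : R, 0 < d &
  forall a, `|a| < d -> `|expR a - 1 - a| <= e * `|a|.
Proof.
move=> e0; have [d d0 hd] := derivable_expand (@derivable_expR R 0) e0.
exists d => // a /hd; rewrite add0r expR0.
by have [_ ->] := is_derive_expR (0 : R); rewrite expR0 mul1r.
Qed.
Lemma cos_expand0 (e : R) : 0 < e -> exists2 d : R, 0 < d &
  forall a, `|a| < d -> `|cos a - 1| <= e * `|a|.
Proof.
move=> e0; have [d d0 hd] := derivable_expand (@derivable_cos R 0) e0.
exists d => // a /hd; rewrite add0r cos0.
by have [_ ->] := is_derive_cos (0 : R); rewrite sin0 oppr0 mul0r subr0.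
Qed.
Lemma sin_expand0 (e : R) : 0 < e -> exists2 d : R, 0 < d &
  forall a, `|a| < d -> `|sin a - a| <= e * `|a|.
Proof.
move=> e0; have [d d0 hd] := derivable_expand (@derivable_sin R 0) e0.
exists d => // a /hd; rewrite add0r sin0.
by have [_ ->] := is_derive_sin (0 : R); rewrite cos0 mul1r subr0.
Qed.

(** The functional equation reduces the expansion to the one at 0, where it is
    assembled from those of the real exponential, sine and cosine. *)
Lemma cexp_cderiv w : cderiv_at cexp w (cexp w).
Proof.
move=> e e0; pose M := normc (cexp w) + 1.
have M0 : 0 < M by rewrite ltr_wpDl ?normc_ge0.
pose e' := Num.min 1 (e / (8 * M)).
have e'0 : 0 < e' by rewrite lt_min ltr01 divr_gt0// mulr_gt0.
have [d1 d10 h1] := expR_expand0 e'0.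
have [d2 d20 h2] := cos_expand0 e'0.
have [d3 d30 h3] := sin_expand0 e'0.
exists (Num.min (Num.min d1 d2) (Num.min d3 (Num.min 1 (e' / 2)))).
  by rewrite !lt_min d10 d20 d30 ltr01 divr_gt0.
move=> h; rewrite !lt_min => /andP[/andP[hd1 hd2] /andP[hd3 /andP[hlt1 hlte]]].
pose a := Re h; pose b := Im h.
have ha : `|a| <= normc h by exact: Re_le_normc.
have hb : `|b| <= normc h by exact: Im_le_normc.
have := h1 a (le_lt_trans ha hd1); have := h2 b (le_lt_trans hb hd2).
have := h3 b (le_lt_trans hb hd3) => k3 k2 k1.
have e'1 : e' <= 1 by rewrite ge_min lexx.
have e'e : e' <= e / (8 * M) by rewrite ge_min lexx orbT.
have hE : `|expR a - 1| <= 2 * normc h.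
  have -> : expR a - 1 = (expR a - 1 - a) + a by ring.
  apply: (le_trans (ler_normD _ _)).
  have := ler_pM (ltW e'0) (normr_ge0 a) e'1 ha; lra.
have hE3 : `|expR a| <= 3.
  have -> : expR a = (expR a - 1) + 1 by ring.
  apply: (le_trans (ler_normD _ _)); rewrite normr1; lra.
have nh := normc_ge0 h.
have ea : e' * `|a| <= e' * normc h by rewrite ler_pM2l.
have eb : e' * `|b| <= e' * normc h by rewrite ler_pM2l.
pose D : R[i] := (expR a - 1 - a)%:C + (expR a)%:C * ((cos b - 1) +i* (sin b - b))
  + (expR a - 1)%:C * (0 +i* b).
have -> : cexp (w + h) - cexp w - cexp w * h = cexp w * D.
  have -> : D = cexp h - 1 - h.
    have hab : h = a +i* b by rewrite /a /b; case: (h).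
    rewrite /cexp /expi -/a -/b /D [h in RHS]hab.
    apply/eqP; rewrite eq_complex /=; apply/andP; split; apply/eqP; ring.
  by rewrite cexpD; ring.
have nD : normc D <= 8 * e' * normc h.
  apply: (le_trans (ler_normcD _ _)).
  apply: (le_trans (lerD (ler_normcD _ _) (lexx _))).
  rewrite !normcM !normc_real.
  have n1 := normc_le_ReIm ((cos b - 1) +i* (sin b - b)).
  have n2 := normc_le_ReIm (0 +i* b); rewrite /= normr0 add0r in n2.
  have t1 : `|expR a - 1 - a| <= e' * normc h by exact: le_trans k1 ea.
  have n1' : normc ((cos b - 1) +i* (sin b - b)) <= 2 * (e' * normc h).
    apply: (le_trans n1) => /=; lra.
  have t2 := ler_pM (normr_ge0 (expR a)) (normc_ge0 _) hE3 n1'.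
  have t3 := ler_pM (normr_ge0 (expR a - 1)) (normc_ge0 (0 +i* b)) hE (le_trans n2 hb).
  have t4 : 2 * normc h * normc h <= e' * normc h.
    by rewrite ler_wpM2r// -ler_pdivlMl// mulrC ltW.
  lra.
rewrite normcM; apply: (@le_trans _ _ (M * (8 * (e / (8 * M)) * normc h))).
  apply: ler_pM => //; rewrite ?normc_ge0 // ?/M ?lerDl //.
  by apply: (le_trans nD); rewrite ler_wpM2r// ler_pM2l.
by rewrite le_eqVlt; apply/orP; left; apply/eqP; field; rewrite gt_eqF.
Qed.
End ComplexDerivative.

(** * Integrals of complex-valued functions *)

Section ComplexIntegral.
Context d {T : measurableType d} {R : realType} (mu : {measure set T -> \bar R}).
Implicit Types (D : set T) (f g : T -> R[i]) (c : R[i]).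

Definition cintegral D f : R[i] :=
  (\int[mu]_(x in D) Re (f x)) +i* (\int[mu]_(x in D) Im (f x)).

Definition cintegrable D f :=
  mu.-integrable D (EFin \o (fun x => Re (f x))) /\
  mu.-integrable D (EFin \o (fun x => Im (f x))).

Lemma eq_cintegral D f g : (forall x, D x -> f x = g x) ->
  cintegral D f = cintegral D g.
Proof.
by move=> fg; congr (_ +i* _); apply: eq_Rintegral => x /set_mem /fg ->.
Qed.

Lemma eq_integrable_EFin D (u v : T -> R) : measurable D ->
  (forall x, D x -> u x = v x) ->
  mu.-integrable D (EFin \o u) -> mu.-integrable D (EFin \o v).
Proof. by move=> mD uv; apply: eq_integrable => // x /set_mem /uv /= ->. Qed.

Lemma integrableZ_EFin D (r : R) (u : T -> R) : measurable D ->
  mu.-integrable D (EFin \o u) -> mu.-integrable D (EFin \o (fun x => r * u x)).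
Proof. by move=> mD iu; apply: eq_integrable (integrableZl mD r iu). Qed.

Lemma integrableD_EFin D (u v : T -> R) : measurable D ->
  mu.-integrable D (EFin \o u) -> mu.-integrable D (EFin \o v) ->
  mu.-integrable D (EFin \o (fun x => u x + v x)).
Proof. by move=> mD iu iv; apply: eq_integrable (integrableD mD iu iv). Qed.

Lemma integrable_comb D (r s : R) (u v : T -> R) : measurable D ->
  mu.-integrable D (EFin \o u) -> mu.-integrable D (EFin \o v) ->
  mu.-integrable D (EFin \o (fun x => r * u x + s * v x)).
Proof. by move=> mD iu iv; apply: integrableD_EFin => //; exact: integrableZ_EFin. Qed.

Lemma Rintegral_comb D (r s : R) (u v : T -> R) : measurable D ->
  mu.-integrable D (EFin \o u) -> mu.-integrable D (EFin \o v) ->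
  \int[mu]_(x in D) (r * u x + s * v x) =
  r * \int[mu]_(x in D) u x + s * \int[mu]_(x in D) v x.
Proof.
by move=> mD iu iv; rewrite RintegralD//; [rewrite !RintegralZl|exact: integrableZ_EFin..].
Qed.

Lemma cintegrableD D f g : measurable D -> cintegrable D f -> cintegrable D g ->
  cintegrable D (fun x => f x + g x).
Proof.
move=> mD [f1 f2] [g1 g2]; split.
  by apply: eq_integrable_EFin (integrableD_EFin mD f1 g1) => // x _; rewrite raddfD.
by apply: eq_integrable_EFin (integrableD_EFin mD f2 g2) => // x _; rewrite raddfD.
Qed.

Lemma cintegralD D f g : measurable D -> cintegrable D f -> cintegrable D g ->
  cintegral D (fun x => f x + g x) = cintegral D f + cintegral D g.
Proof.
move=> mD [f1 f2] [g1 g2]; rewrite /cintegral; simpc.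
rewrite -!RintegralD//; congr (_ +i* _); apply: eq_Rintegral => x _;
by rewrite raddfD.
Qed.

Lemma ReM c z : Re (c * z) = Re c * Re z + (- Im c) * Im z.
Proof. by case: c z => [a b] [x y] /=; rewrite mulNr. Qed.
Lemma ImM c z : Im (c * z) = Im c * Re z + Re c * Im z.
Proof. by case: c z => [a b] [x y] /=; rewrite addrC. Qed.

Lemma cintegrableZ D c f : measurable D -> cintegrable D f ->
  cintegrable D (fun x => c * f x).
Proof.
move=> mD [f1 f2]; split.
  by apply: eq_integrable_EFin (integrable_comb (Re c) (- Im c) mD f1 f2) => // x _;
    rewrite /= ReM.
by apply: eq_integrable_EFin (integrable_comb (Im c) (Re c) mD f1 f2) => // x _;
    rewrite /= ImM.
Qed.

Lemma cintegralZ D c f : measurable D -> cintegrable D f ->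
  cintegral D (fun x => c * f x) = c * cintegral D f.
Proof.
move=> mD [f1 f2]; apply/eqP; rewrite eq_complex ReM ImM /=.
rewrite -!Rintegral_comb//; apply/andP; split; apply/eqP;
by apply: eq_Rintegral => x _; rewrite ?ReM ?ImM.
Qed.

Lemma cintegrableB D f g : measurable D -> cintegrable D f -> cintegrable D g ->
  cintegrable D (fun x => f x - g x).
Proof.
move=> mD hf hg; have := cintegrableD mD hf (cintegrableZ (-1) mD hg).
by under eq_fun do rewrite mulN1r.
Qed.

Lemma cintegralB D f g : measurable D -> cintegrable D f -> cintegrable D g ->
  cintegral D (fun x => f x - g x) = cintegral D f - cintegral D g.
Proof.
move=> mD hf hg; rewrite -mulN1r -cintegralZ// -cintegralD//; last exact: cintegrableZ.
by apply: eq_cintegral => x _; rewrite mulN1r.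
Qed.

Lemma cintegral_cst D c : measurable D ->
  cintegral D (fun=> c) = c * (fine (mu D))%:C.
Proof.
by move=> mD; rewrite /cintegral !Rintegral_cst//; case: c => a b; simpc.
Qed.

Lemma cintegrable_cst D c : measurable D -> (mu D < +oo)%E ->
  cintegrable D (fun=> c).
Proof.
move=> mD Doo; split; apply: measurable_bounded_integrable => //=.
- exact: bounded_cst.
- exact: bounded_cst.
Qed.

Lemma Rintegral_le_bound D (u : T -> R) (M : R) : measurable D -> (mu D < +oo)%E ->
  mu.-integrable D (EFin \o u) -> (forall x, D x -> `|u x| <= M) ->
  `|\int[mu]_(x in D) u x| <= M * fine (mu D).
Proof.
move=> mD Doo iu uM; apply: (le_trans (le_normr_Rintegral mD iu)).
rewrite -Rintegral_cst//; apply: le_Rintegral => //.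
  exact: (integrable_norm iu).
by have [] := cintegrable_cst (M%:C) mD Doo.
Qed.

(** The factor 2 comes from estimating real and imaginary parts separately. *)
Lemma normc_cintegral_le D f (M : R) : measurable D -> (mu D < +oo)%E ->
  cintegrable D f -> (forall x, D x -> normc (f x) <= M) ->
  normc (cintegral D f) <= 2 * (M * fine (mu D)).
Proof.
move=> mD Doo [f1 f2] fM; apply: (le_trans (normc_le_ReIm _)) => /=.
rewrite mulrDl mul1r lerD//; apply: Rintegral_le_bound => // x /fM; apply: le_trans.
  exact: Re_le_normc.
exact: Im_le_normc.
Qed.
End ComplexIntegral.

Section LebesgueInterval.
Context {R : realType}.
Notation mu := (@lebesgue_measure R).
Implicit Types (a b c : R) (f g : R -> R[i]).

Definition cint a b f := cintegral mu `[a, b] f.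
Definition ccontinuous_on a b f := {in `[a, b], continuous (f : R -> R[i]^o)}.

Lemma lebesgue_itv_fin a b : (mu `[a, b] < +oo)%E.
Proof.
rewrite lebesgue_measure_itv /=; case: ifP => _; last exact: ltry.
by rewrite -EFinB ltry.
Qed.

Lemma fine_lebesgue_itv a b : a <= b -> fine (mu `[a, b]) = b - a.
Proof.
move=> ab; rewrite lebesgue_measure_itv /= lte_fin.
by case: ltgtP ab => //= -> _; rewrite subrr.
Qed.

Lemma continuous_integrable a b (u : R -> R) : {in `[a, b], continuous u} ->
  mu.-integrable `[a, b] (EFin \o u).
Proof.
move=> cu; apply: continuous_compact_integrable; first exact: segment_compact.
by apply: continuous_in_subspaceT => x xab; apply: cu; rewrite inE in xab.
Qed.

Lemma ccontinuous_on_Re a b f : ccontinuous_on a b f -> {in `[a, b], continuous (fun x => Re (f x))}.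
Proof. by move=> h x /h /cvgc_ReIm[]. Qed.
Lemma ccontinuous_on_Im a b f : ccontinuous_on a b f -> {in `[a, b], continuous (fun x => Im (f x))}.
Proof. by move=> h x /h /cvgc_ReIm[]. Qed.

Lemma ccontinuous_on_integrable a b f : ccontinuous_on a b f -> cintegrable mu `[a, b] f.
Proof.
by move=> h; split; apply: continuous_integrable; [exact: ccontinuous_on_Re|exact: ccontinuous_on_Im].
Qed.

Lemma Rintegral_split a b c (u : R -> R) : a <= b -> b <= c ->
  mu.-integrable `[a, c] (EFin \o u) ->
  \int[mu]_(x in `[a, c]) u x = \int[mu]_(x in `[a, b]) u x + \int[mu]_(x in `[b, c]) u x.
Proof.
move=> ab bc iu.
have /(_ _ _)/eqP := @Rintegral_itvB R u (BLeft a) (BRight c) b iu.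
rewrite bnd_simp => /(_ ab); rewrite bnd_simp => /(_ bc).
rewrite subr_eq addrC => /eqP ->; congr (_ + _).
rewrite Rintegral_itv_obnd_cbnd//; apply: integrableS iu => //.
by apply: subset_itvr; rewrite bnd_simp.
Qed.

Lemma cint_split a b c f : a <= b -> b <= c -> ccontinuous_on a c f ->
  cint a c f = cint a b f + cint b c f.
Proof.
move=> ab bc /ccontinuous_on_integrable[f1 f2].
by rewrite /cint /cintegral (Rintegral_split ab bc f1) (Rintegral_split ab bc f2).
Qed.

(** In this form, the integral of a nearly constant function, the affine part of
    a function contributes only constants to a boundary integral. *)
Lemma cint_near_cst a b f (k : R[i]) (N : R) : a <= b -> ccontinuous_on a b f ->
  (forall x, a <= x <= b -> normc (f x - k) <= N) ->
  normc (cint a b f - k * (b - a)%:C) <= 2 * (N * (b - a)).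
Proof.
move=> ab cf fN; have icst := cintegrable_cst (mu := mu) k (measurable_itv _) (lebesgue_itv_fin a b).
rewrite -(fine_lebesgue_itv ab) -(cintegral_cst mu)// -cintegralB//; last first.
  exact: ccontinuous_on_integrable.
apply: normc_cintegral_le => //; first exact: lebesgue_itv_fin.
  by apply: cintegrableB => //; exact: ccontinuous_on_integrable.
Qed.

End LebesgueInterval.

(** * Goursat's theorem for rectangles *)

Section Goursat.
Context {R : realType}.
Implicit Types (a b s t : R) (g : R[i] -> R[i]).

(** The integral of g dz along the boundary of the rectangle, with opposite
    sides paired: an affine g makes both integrands constant, and a function of
    period i (t1 - t0) kills the first one. *)
Definition rect_int g s0 s1 t0 t1 : R[i] :=
  cint s0 s1 (fun x => g (x +i* t0) - g (x +i* t1)) +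
  'i * cint t0 t1 (fun y => g (s1 +i* y) - g (s0 +i* y)).

Definition cdiff_on g s0 s1 t0 t1 := forall s t, s0 <= s <= s1 -> t0 <= t <= t1 ->
  exists c, cderiv_at g (s +i* t) c.

Lemma horizontal_continuous g s t : {for s +i* t, continuous (g : R[i]^o -> R[i]^o)} ->
  {for s, continuous ((fun x => g (x +i* t)) : R -> R[i]^o)}.
Proof.
move=> cg.
apply: (@continuous_comp _ _ _ (fun x => x +i* t : R[i]^o) (g : R[i]^o -> R[i]^o)); last exact: cg.
by apply/(@cvgc_ReIm R _ _ _ (fun x => x +i* t)); split; [exact: cvg_id|exact: cvg_cst].
Qed.
Lemma vertical_continuous g s t : {for s +i* t, continuous (g : R[i]^o -> R[i]^o)} ->
  {for t, continuous ((fun y => g (s +i* y)) : R -> R[i]^o)}.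
Proof.
move=> cg.
apply: (@continuous_comp _ _ _ (fun y => s +i* y : R[i]^o) (g : R[i]^o -> R[i]^o)); last exact: cg.
by apply/(@cvgc_ReIm R _ _ _ (fun y => s +i* y)); split; [exact: cvg_cst|exact: cvg_id].
Qed.

Lemma ccontinuous_onB a b (u v : R -> R[i]) : ccontinuous_on a b u -> ccontinuous_on a b v ->
  ccontinuous_on a b (fun x => u x - v x).
Proof. by move=> hu hv x xab; apply: (@cvgB _ R[i]^o); [exact: hu|exact: hv]. Qed.

Lemma ccontinuous_on_horizontal g s0 s1 t0 t1 t : cdiff_on g s0 s1 t0 t1 -> t0 <= t <= t1 ->
  ccontinuous_on s0 s1 (fun x => g (x +i* t)).
Proof.
move=> hg ht x; rewrite in_itv => hx; have [c hc] := hg x t hx ht.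
exact: horizontal_continuous (cderiv_at_continuous hc).
Qed.
Lemma ccontinuous_on_vertical g s0 s1 t0 t1 s : cdiff_on g s0 s1 t0 t1 -> s0 <= s <= s1 ->
  ccontinuous_on t0 t1 (fun y => g (s +i* y)).
Proof.
move=> hg hs x; rewrite in_itv => hx; have [c hc] := hg s x hs hx.
exact: vertical_continuous (cderiv_at_continuous hc).
Qed.

Lemma cdiff_onS g s0 s1 t0 t1 s0' s1' t0' t1' : s0 <= s0' -> s1' <= s1 ->
  t0 <= t0' -> t1' <= t1 -> cdiff_on g s0 s1 t0 t1 -> cdiff_on g s0' s1' t0' t1'.
Proof.
move=> h1 h2 h3 h4 hg s t /andP[s1h s2h] /andP[t1h t2h].
by apply: hg; apply/andP; split; (apply: le_trans; last eassumption) ||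
  (apply: le_trans; first eassumption); assumption.
Qed.

Lemma rect_int_splits g s0 s1 s2 t0 t1 : s0 <= s1 -> s1 <= s2 -> t0 <= t1 ->
  cdiff_on g s0 s2 t0 t1 ->
  rect_int g s0 s2 t0 t1 = rect_int g s0 s1 t0 t1 + rect_int g s1 s2 t0 t1.
Proof.
move=> h01 h12 ht hg.
have ch t : t0 <= t <= t1 -> ccontinuous_on s0 s2 (fun x => g (x +i* t)) := ccontinuous_on_horizontal hg.
have cv s : s0 <= s <= s2 -> ccontinuous_on t0 t1 (fun x => g (s +i* x)) := ccontinuous_on_vertical hg.
rewrite /rect_int (cint_split h01 h12); last by apply: ccontinuous_onB; apply: ch; rewrite lexx ht.
rewrite addrACA -mulrDr; congr (_ + _ * _).
rewrite /cint -cintegralD//.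
- by apply: eq_cintegral => y _; ring.
- by apply/ccontinuous_on_integrable/ccontinuous_onB; apply: cv; rewrite ?lexx ?h01 ?h12 ?(le_trans h01).
- by apply/ccontinuous_on_integrable/ccontinuous_onB; apply: cv; rewrite ?lexx ?h01 ?h12 ?(le_trans h01).
Qed.

Lemma rect_int_splitt g s0 s1 t0 t1 t2 : s0 <= s1 -> t0 <= t1 -> t1 <= t2 ->
  cdiff_on g s0 s1 t0 t2 ->
  rect_int g s0 s1 t0 t2 = rect_int g s0 s1 t0 t1 + rect_int g s0 s1 t1 t2.
Proof.
move=> hs h01 h12 hg.
have ch t : t0 <= t <= t2 -> ccontinuous_on s0 s1 (fun x => g (x +i* t)) := ccontinuous_on_horizontal hg.
have cv s : s0 <= s <= s1 -> ccontinuous_on t0 t2 (fun x => g (s +i* x)) := ccontinuous_on_vertical hg.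
rewrite /rect_int (cint_split h01 h12); last by apply: ccontinuous_onB; apply: cv; rewrite lexx hs.
rewrite addrACA -mulrDr; congr (_ + _).
rewrite /cint -cintegralD//.
- by apply: eq_cintegral => y _; ring.
- by apply/ccontinuous_on_integrable/ccontinuous_onB; apply: ch; rewrite ?lexx ?h01 ?h12 ?(le_trans h01).
- by apply/ccontinuous_on_integrable/ccontinuous_onB; apply: ch; rewrite ?lexx ?h01 ?h12 ?(le_trans h01).
Qed.

(** The boundary integral of the affine approximation is 0: with slope be, the
    two pairs of sides contribute opposite multiples of be times the area. Only
    the error, times half the perimeter, remains. *)
Lemma rect_int_affine g s0 s1 t0 t1 (al be w0 : R[i]) (M : R) : s0 <= s1 -> t0 <= t1 ->
  cdiff_on g s0 s1 t0 t1 ->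
  (forall s t, s0 <= s <= s1 -> t0 <= t <= t1 ->
     normc (g (s +i* t) - al - be * ((s +i* t) - w0)) <= M) ->
  normc (rect_int g s0 s1 t0 t1) <= 4 * M * ((s1 - s0) + (t1 - t0)).
Proof.
move=> hs ht hg hM.
have ch t : t0 <= t <= t1 -> ccontinuous_on s0 s1 (fun x => g (x +i* t)) := ccontinuous_on_horizontal hg.
have cv s : s0 <= s <= s1 -> ccontinuous_on t0 t1 (fun x => g (s +i* x)) := ccontinuous_on_vertical hg.
have key (w w' : R[i]) : normc (g w - al - be * (w - w0)) <= M ->
    normc (g w' - al - be * (w' - w0)) <= M ->
    normc (g w - g w' - be * (w - w')) <= 2 * M.
  move=> k1 k2; have -> : g w - g w' - be * (w - w') =
    (g w - al - be * (w - w0)) + - (g w' - al - be * (w' - w0)) by ring.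
  by apply: (le_trans (ler_normcD _ _)); rewrite normcN mulrDl mul1r lerD.
have E1 := @cint_near_cst R s0 s1 _ (- be * 'i * (t1 - t0)%:C) (2 * M) hs
  (ccontinuous_onB (ch t0 _) (ch t1 _)).
have E2 := @cint_near_cst R t0 t1 _ (be * (s1 - s0)%:C) (2 * M) ht
  (ccontinuous_onB (cv s1 _) (cv s0 _)).
have {}E1 : normc (cint s0 s1 (fun x => g (x +i* t0) - g (x +i* t1)) -
   (- be * 'i * (t1 - t0)%:C) * (s1 - s0)%:C) <= 2 * (2 * M * (s1 - s0)).
  apply: E1; rewrite ?lexx ?ht// => x hx.
  have := key (x +i* t0) (x +i* t1) (hM _ _ hx _) (hM _ _ hx _).
  rewrite !lexx ht => /(_ isT isT); congr (normc _ <= _); congr (_ - _).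
  rewrite -mulrA mulNr -mulrN; congr (_ * _).
  by apply/eqP; rewrite eq_complex /=; apply/andP; split; apply/eqP; ring.
have {}E2 : normc (cint t0 t1 (fun y => g (s1 +i* y) - g (s0 +i* y)) -
   (be * (s1 - s0)%:C) * (t1 - t0)%:C) <= 2 * (2 * M * (t1 - t0)).
  apply: E2; rewrite ?lexx ?hs// => x hx.
  have := key (s1 +i* x) (s0 +i* x) (hM _ _ _ hx) (hM _ _ _ hx).
  rewrite !lexx hs => /(_ isT isT); congr (normc _ <= _); congr (_ - _ * _).
  by apply/eqP; rewrite eq_complex /=; apply/andP; split; apply/eqP; ring.
rewrite /rect_int; set A := cint s0 s1 _ in E1 *; set B := cint t0 t1 _ in E2 *.
have -> : A + 'i * B = (A - (- be * 'i * (t1 - t0)%:C) * (s1 - s0)%:C) +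
  'i * (B - (be * (s1 - s0)%:C) * (t1 - t0)%:C) by ring.
apply: (le_trans (ler_normcD _ _)); rewrite normcM.
rewrite normci mul1r; apply: (le_trans (lerD E1 E2)); lra.
Qed.
End Goursat.

Section GoursatThm.
Context {R : realType}.
Implicit Types (a b s t : R) (g : R[i] -> R[i]).

(** The four boundary integrals add up to the whole one, so one of them has at
    least a quarter of its modulus. *)
Lemma rect_int_quarter g s t a b (K : R) : 0 <= a -> 0 <= b ->
  cdiff_on g s (s + a) t (t + b) -> K <= normc (rect_int g s (s + a) t (t + b)) ->
  exists s' t', [/\ s <= s' <= s + a / 2, t <= t' <= t + b / 2 &
    K / 4 <= normc (rect_int g s' (s' + a / 2) t' (t' + b / 2))].
Proof.
move=> a0 b0 hg hK.
have ea : s + a / 2 + a / 2 = s + a by field.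
have eb : t + b / 2 + b / 2 = t + b by field.
apply: contrapT => hn.
have lt4 s' t' : s <= s' <= s + a / 2 -> t <= t' <= t + b / 2 ->
    normc (rect_int g s' (s' + a / 2) t' (t' + b / 2)) < K / 4.
  by move=> h1 h2; rewrite ltNge; apply/negP => h3; apply: hn; exists s', t'.
have ls : s <= s + a / 2 by lra.
have lt : t <= t + b / 2 by lra.
have ls2 : s + a / 2 <= s + a by lra.
have lt2 : t + b / 2 <= t + b by lra.
have k1 := lt4 s t; have k2 := lt4 (s + a / 2) t.
have k3 := lt4 s (t + b / 2); have k4 := lt4 (s + a / 2) (t + b / 2).
rewrite ea eb !lexx ls lt /= in k1 k2 k3 k4.
have {}k1 := k1 isT isT; have {}k2 := k2 isT isT.
have {}k3 := k3 isT isT; have {}k4 := k4 isT isT.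
move: hK; rewrite (rect_int_splits ls ls2 (le_trans lt lt2) hg).
rewrite (rect_int_splitt ls lt lt2); last exact: cdiff_onS hg.
rewrite (rect_int_splitt ls2 lt lt2); last exact: cdiff_onS hg.
move=> hK; have n1 := ler_normcD (rect_int g s (s + a / 2) t (t + b / 2))
 (rect_int g s (s + a / 2) (t + b / 2) (t + b)).
have n2 := ler_normcD (rect_int g (s + a / 2) (s + a) t (t + b / 2))
 (rect_int g (s + a / 2) (s + a) (t + b / 2) (t + b)).
have := le_trans hK (ler_normcD _ _); lra.
Qed.

(** Bisection: nested rectangles shrink to a point where g is differentiable,
    and there the boundary integral is of smaller order than the area, whereas
    it was kept above a fixed multiple of it. *)
Theorem goursat g s0 s1 t0 t1 : s0 <= s1 -> t0 <= t1 -> cdiff_on g s0 s1 t0 t1 ->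
  rect_int g s0 s1 t0 t1 = 0.
Proof.
pose a := s1 - s0; pose b := t1 - t0 => hs ht hg.
have a0 : 0 <= a by rewrite subr_ge0.
have b0 : 0 <= b by rewrite subr_ge0.
have ea : s1 = s0 + a by rewrite /a; ring.
have eb : t1 = t0 + b by rewrite /b; ring.
apply/eqP; rewrite -normc_eq0 -[_ == 0]negbK; apply/negP => hJ.
pose K := normc (rect_int g s0 s1 t0 t1).
have K0 : 0 < K by rewrite lt_def hJ normc_ge0.
pose A n := a / 2 ^+ n; pose B n := b / 2 ^+ n.
have A0 n : 0 <= A n by rewrite divr_ge0 ?exprn_ge0.
have B0 n : 0 <= B n by rewrite divr_ge0 ?exprn_ge0.
have AS n : A n.+1 = A n / 2 by rewrite /A exprSr; field; rewrite expf_neq0.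
have BS n : B n.+1 = B n / 2 by rewrite /B exprSr; field; rewrite expf_neq0.
(* p is the lower left corner of the n-th rectangle, of size A n by B n *)
pose Inv n (p : R * R) := [/\ s0 <= p.1, p.1 + A n <= s1, t0 <= p.2, p.2 + B n <= t1 &
  K / 4 ^+ n <= normc (rect_int g p.1 (p.1 + A n) p.2 (p.2 + B n))].
pose rel (q : nat * (R * R)) p' := Inv q.1 q.2 ->
  [/\ Inv q.1.+1 p', q.2.1 <= p'.1 <= q.2.1 + A q.1 / 2 & q.2.2 <= p'.2 <= q.2.2 + B q.1 / 2].
have /choice[f hf] : forall q, exists p', rel q p'.
  move=> [n [s t]]; rewrite /rel /=.
  have [[/= i1 i2 i3 i4 i5]|ni] := pselect (Inv n (s, t)); last by exists (s, t).
  have [s' [t' [hs' ht' hK]]] := rect_int_quarter (A0 n) (B0 n) (cdiff_onS i1 i2 i3 i4 hg) i5.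
  exists (s', t') => _; split=> //=; split=> /=; rewrite ?AS ?BS //.
  - by apply: le_trans i1 _; case/andP: hs'.
  - by case/andP: hs' => _ ?; apply: le_trans i2; lra.
  - by apply: le_trans i3 _; case/andP: ht'.
  - by case/andP: ht' => _ ?; apply: le_trans i4; lra.
  - by rewrite exprSr invfM mulrA.
pose fix p n := if n is m.+1 then f (m, p m) else (s0, t0).
have Ip n : Inv n (p n).
  elim: n => [|n IH]; last by case: (hf (n, p n) IH).
  by split=> /=; rewrite ?lexx // /A /B expr0 !divr1 -?ea -?eb.
have step n : (p n).1 <= (p n.+1).1 /\ (p n.+1).1 + A n.+1 <= (p n).1 + A n.
  by have [_ /= /andP[h1 h2] _] := hf (n, p n) (Ip n); rewrite AS; split=> //=; lra.
have stept n : (p n).2 <= (p n.+1).2 /\ (p n.+1).2 + B n.+1 <= (p n).2 + B n.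
  by have [_ /= _ /andP[h1 h2]] := hf (n, p n) (Ip n); rewrite BS; split=> //=; lra.
(* nested intervals have a common point *)
have nested (u v : nat -> R) : (forall n, 0 <= v n) ->
    (forall n, u n <= u n.+1 /\ u n.+1 + v n.+1 <= u n + v n) ->
    exists x, forall n, u n <= x <= u n + v n.
  move=> v0 huv.
  have um : {homo u : m n / (m <= n)%N >-> m <= n}.
    by apply: homo_leq => // [x y z|n]; [exact: le_trans|case: (huv n)].
  have uvm : {homo (fun n => u n + v n) : m n / (m <= n)%N >-> n <= m}.
    by apply: homo_leq => // [x y z h1 h2|n]; [exact: le_trans h2 h1|case: (huv n)].
  have ub n : ubound (range u) (u n + v n).
    move=> _ [m _ <-]; have [mn|/ltnW nm] := leqP m n.
      by apply: (le_trans (um _ _ mn)); rewrite lerDl.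
    by apply: le_trans (uvm _ _ nm); rewrite lerDl.
  exists (sup (range u)) => n; apply/andP; split.
    by apply: ub_le_sup; [exists (u 0%N + v 0%N); exact: ub|exists n].
  by apply: ge_sup; [exists (u n); exists n|exact: ub].
have [s hsn] := nested (fun n => (p n).1) A A0 step.
have [t htn] := nested (fun n => (p n).2) B B0 stept.
have [c hc] : exists c, cderiv_at g (s +i* t) c.
  have := hsn 0%N; have := htn 0%N; rewrite /A /B expr0 !divr1 -ea -eb => h1 h2.
  exact: hg.
(* the estimate below gives K <= 4 e (a + b)^2; adding 1 covers degenerate rectangles *)
pose e := K / (8 * ((a + b) ^+ 2 + 1)).
have ab1 : 0 < (a + b) ^+ 2 + 1 by rewrite ltr_wpDl ?sqr_ge0.
have e0 : 0 < e by rewrite divr_gt0// mulr_gt0.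
have [d d0 hd] := hc e e0.
have [n hn] : exists n, (a + b) / 2 ^+ n < d.
  have := archi_boundP (divr_ge0 (addr_ge0 a0 b0) (ltW d0)).
  set n := Num.bound _ => hn; exists n.
  rewrite ltr_pdivrMr ?exprn_gt0// mulrC -ltr_pdivrMr//.
  by apply: (lt_trans hn); rewrite -natrX ltr_nat ltn_expl.
have [/= i1 i2 i3 i4 i5] := Ip n.
have Q0 : (0 : R) < 4 ^+ n by rewrite exprn_gt0.
have := @rect_int_affine R g (p n).1 ((p n).1 + A n) (p n).2 ((p n).2 + B n)
  (g (s +i* t)) c (s +i* t) (e * (A n + B n)).
rewrite !lerDl A0 B0 => /(_ isT isT (cdiff_onS i1 i2 i3 i4 hg) _) h.
have {}h : normc (rect_int g (p n).1 ((p n).1 + A n) (p n).2 ((p n).2 + B n)) <=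
    4 * (e * (A n + B n)) * (A n + B n).
  rewrite [X in _ <= _ * (X + _)](_ : A n = (p n).1 + A n - (p n).1); last by ring.
  rewrite [X in _ <= _ * (_ + X)](_ : B n = (p n).2 + B n - (p n).2); last by ring.
  apply: h => x y hx hy.
  have hxy : normc ((x +i* y) - (s +i* t)) <= A n + B n.
    apply: (le_trans (normc_le_ReIm _)); apply: lerD => /=.
      have := hsn n; rewrite ler_norml; move: hx => /andP[? ?] /andP[? ?]; lra.
    have := htn n; rewrite ler_norml; move: hy => /andP[? ?] /andP[? ?]; lra.
  have := hd ((x +i* y) - (s +i* t)); rewrite subrKC => /(_ _) /le_trans; apply.
    by apply: (le_lt_trans hxy); rewrite /A /B -mulrDl.
  by rewrite ler_pM2l.
have := le_trans i5 h.
have -> : 4 * (e * (A n + B n)) * (A n + B n) = 4 * e * (a + b) ^+ 2 / 4 ^+ n.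
  have -> : (4 : R) ^+ n = 2 ^+ n * 2 ^+ n by rewrite -exprMn; congr (_ ^+ _); ring.
  by rewrite /A /B; field; rewrite expf_neq0.
rewrite ler_pM2r ?invr_gt0// leNgt => /negP; apply.
rewrite /e; have -> : 4 * (K / (8 * ((a + b) ^+ 2 + 1))) * (a + b) ^+ 2 =
  K * ((a + b) ^+ 2 / (2 * ((a + b) ^+ 2 + 1))) by field; rewrite gt_eqF.
rewrite gtr_pMr// ltr_pdivrMr ?mulr_gt0// mul1r.
by have := sqr_ge0 (a + b); lra.
Qed.
End GoursatThm.

(** * Circle means of holomorphic functions *)

Section ComplexDerivatives.
Context {R : realType}.
Implicit Types (f g : R[i] -> R[i]) (z c : R[i]).
Definition cderivable f z := derivable (f : R[i]^o -> R[i]^o) z 1.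
Lemma cderivable_cst c z : cderivable (fun=> c) z.
Proof. exact: derivable_cst. Qed.
Lemma cderivable_id z : cderivable (fun w => w) z.
Proof. exact: derivable_id. Qed.
Lemma cderivableD f g z : cderivable f z -> cderivable g z -> cderivable (fun w => f w + g w) z.
Proof. exact: (@derivableD R[i] R[i]^o R[i]^o f g z 1). Qed.
Lemma cderivableN f z : cderivable f z -> cderivable (fun w => - f w) z.
Proof. exact: (@derivableN R[i] R[i]^o R[i]^o f z 1). Qed.
Lemma cderivableB f g z : cderivable f z -> cderivable g z -> cderivable (fun w => f w - g w) z.
Proof. by move=> hf hg; exact: (cderivableD hf (cderivableN hg)). Qed.
Lemma cderivableM f g z : cderivable f z -> cderivable g z -> cderivable (fun w => f w * g w) z.
Proof. exact: (@derivableM R[i] R[i]^o f g z 1). Qed.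
Lemma cderivableV f z : f z != 0 -> cderivable f z -> cderivable (fun w => (f w)^-1) z.
Proof. exact: (@derivableV R[i] R[i]^o f z 1). Qed.
Lemma cderivable_div f g z : g z != 0 -> cderivable f z -> cderivable g z -> cderivable (fun w => f w / g w) z.
Proof. by move=> g0 hf hg; exact: (cderivableM hf (cderivableV g0 hg)). Qed.
Lemma cderiv_at_near f g z c (d : R) : 0 < d ->
  (forall w, normc (w - z) < d -> f w = g w) -> cderiv_at f z c -> cderiv_at g z c.
Proof.
move=> d0 fg hf e e0; have [d1 d10 hd] := hf e e0.
exists (Num.min d d1); first by rewrite lt_min d0.
move=> h; rewrite lt_min => /andP[h1 h2].
have := hd h h2; rewrite !fg ?subrr ?normc0//.
by rewrite (_ : z + h - z = h)//; ring.
Qed.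
Lemma cderivable_cderiv_at f z : cderivable f z -> exists c, cderiv_at f z c.
Proof. by move=> /derivable_cderiv_at h; eexists; exact: h. Qed.
End ComplexDerivatives.
Arguments cderivable_cst {R} c z.
Arguments cderivable_id {R} z.

Section CircleMeans.
Context {R : realType}.
Implicit Types (f g : R[i] -> R[i]) (z c : R[i]) (r s t : R).

(** The circle mean without its factor 1 / (2 pi). *)
Definition cmean f r : R[i] := cint 0 (2 * pi) (fun t => f (r%:C * expi t)).

Lemma twopi_ge0 : 0 <= 2 * pi :> R.
Proof. by rewrite mulr_ge0// pi_ge0. Qed.

Lemma normc_polar r t : normc (r%:C * expi t) = `|r|.
Proof. by rewrite normcM normc_real normc_expi mulr1. Qed.

Lemma expi_continuous : continuous (@expi R : R -> R[i]^o).
Proof.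
by move=> t; apply/(@cvgc_ReIm R _ _ _ (@expi R)); split;
  [exact: continuous_cos|exact: continuous_sin].
Qed.

Lemma polar_continuous r t :
  {for t, continuous ((fun t => r%:C * expi t) : R -> R[i]^o)}.
Proof.
by apply: (@cvgM _ _ _ _ (fun=> r%:C : R[i]^o)); [exact: cvg_cst|exact: expi_continuous].
Qed.

Lemma ccontinuous_on_circle f r (a b : R) :
  (forall z, normc z = `|r| -> {for z, continuous (f : R[i]^o -> R[i]^o)}) ->
  ccontinuous_on a b (fun t => f (r%:C * expi t)).
Proof.
move=> cf t _; apply: (@continuous_comp _ _ _ (fun t => r%:C * expi t : R[i]^o)).
  exact: polar_continuous.
by apply: cf; exact: normc_polar.
Qed.

(** In the coordinate w = log z the circles become vertical segments of length 2
    pi. The horizontal sides of the rectangle between two of them cancel by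
    periodicity of exp, so that Goursat equates the integrals over the vertical
    ones. *)
Lemma cmean_annulus f (r0 r1 : R) : 0 <= r0 ->
  (forall z, r0 < normc z < r1 -> exists c, cderiv_at f z c) ->
  forall r s, r0 < r -> r <= s -> s < r1 -> cmean f r = cmean f s.
Proof.
move=> r00 hf r s r0r rs sr1; pose g w := f (cexp w).
have r_gt0 : 0 < r by exact: le_lt_trans r0r.
have s_gt0 : 0 < s by exact: lt_le_trans rs.
have gE x (u : R) : 0 < x -> g (ln x +i* u) = f (x%:C * expi u).
  by move=> x0; rewrite /g /cexp /= lnK.
have hg : cdiff_on g (ln r) (ln s) 0 (2 * pi).
  move=> x u /andP[x1 x2] _.
  have [c hc] : exists c, cderiv_at f (cexp (x +i* u)) c.
    apply: hf; rewrite /cexp normcM normc_real normc_expi mulr1 /= ger0_norm ?expR_ge0//.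
    apply/andP; split; first by apply: (lt_le_trans r0r); rewrite -(lnK r_gt0) ler_expR.
    by apply: le_lt_trans sr1; rewrite -(lnK s_gt0) ler_expR.
  by exists (c * cexp (x +i* u)); apply: cderiv_at_comp hc; exact: cexp_cderiv.
have lrs : ln r <= ln s by rewrite ler_ln.
have := goursat lrs twopi_ge0 hg; rewrite /rect_int.
rewrite (_ : cint _ _ (fun x => _ - g (_ +i* (2 * pi))) = 0); last first.
  rewrite /cint (@eq_cintegral _ _ _ _ _ _ (fun=> 0)) ?cintegral_cst ?mul0r//.
  by move=> x _; rewrite /g /cexp /= -(expi2pi 0) add0r subrr.
move/eqP; rewrite add0r mulf_eq0 -normc_eq0 normci oner_eq0 /=.
rewrite /cint cintegralB//.
- rewrite subr_eq0 => /eqP h.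
  have gm x : 0 < x -> cintegral lebesgue_measure `[0, 2 * pi] (fun t => g (ln x +i* t)) =
      cmean f x by move=> x0; apply: eq_cintegral => t _; exact: gE.
  exact: etrans (esym (gm _ r_gt0)) (etrans (esym h) (gm _ s_gt0)).
- by apply: ccontinuous_on_integrable; apply: ccontinuous_on_vertical hg _; rewrite lrs lexx.
- by apply: ccontinuous_on_integrable; apply: ccontinuous_on_vertical hg _; rewrite lrs lexx.
Qed.

End CircleMeans.

Section CircleMeans2.
Context {R : realType}.
Implicit Types (f g : R[i] -> R[i]) (z c : R[i]) (r s t : R).
Notation mu := (@lebesgue_measure R).

(** Provides the dominating constant for continuity under the integral sign. *)
Lemma polar_bounded f (rho : R) :
  (forall z, normc z <= rho -> {for z, continuous (f : R[i]^o -> R[i]^o)}) ->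
  exists M, forall r t, `|r| <= rho -> 0 <= t <= 2 * pi -> normc (f (r%:C * expi t)) <= M.
Proof.
move=> cf; have [rho0|rho0] := leP 0 rho; last first.
  exists 0 => r t h; have := normr_ge0 r; lra.
pose F (p : R * R) : R := normc (f (p.1%:C * expi p.2)).
have cA : compact (`[-rho, rho]%classic `*` `[0, 2 * pi]%classic : set (R * R)).
  by apply: compact_setX; exact: segment_compact.
have cF : {within `[-rho, rho]%classic `*` `[0, 2 * pi]%classic, continuous F}.
  apply: continuous_in_subspaceT => p; rewrite inE => -[/= + _].
  rewrite in_itv /= -ler_norml => hp.
  apply: cvg_normc; apply: (@continuous_comp _ _ _ (fun q : R * R => q.1%:C * expi q.2 : R[i]^o)).
    apply: (@cvgM R[i]^o); apply: (@continuous_comp _ _ _ _ _ p).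
    - exact: cvg_fst.
    - exact: real_complex_continuous.
    - exact: cvg_snd.
    - exact: expi_continuous.
  by apply: cf; rewrite normc_polar.
have [|m _ hm] := @compact_EVT_max _ _ F _ _ cA cF.
  by exists (0, 0); split; rewrite /= in_itv /=; rewrite ?twopi_ge0 ?lexx // oppr_le0 rho0.
exists (F m) => r t hr ht; apply: (hm (r, t)); rewrite inE; split; rewrite /= in_itv //=.
by rewrite -ler_norml.
Qed.

(** Negative radii are harmless and make 0 an interior point. *)
Lemma cmean_continuous f (rho : R) r :
  (forall z, normc z < rho -> {for z, continuous (f : R[i]^o -> R[i]^o)}) -> `|r| < rho ->
  {for r, continuous (cmean f : R -> R[i]^o)}.
Proof.
move=> cf rrho; pose rho' := (`|r| + rho) / 2.
have h1 : `|r| < rho' by rewrite /rho'; lra.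
have h2 : rho' < rho by rewrite /rho'; lra.
have [M hM] : exists M, forall s t, `|s| <= rho' -> 0 <= t <= 2 * pi -> normc (f (s%:C * expi t)) <= M.
  by apply: polar_bounded => z hz; apply: cf; apply: le_lt_trans h2.
(* rho' leaves room for a bound that is uniform on the closed disc *)
have rin : r \in `]-rho', rho'[%classic by rewrite inE /= in_itv /= -ltr_norml.
have cc s : `|s| < rho' -> ccontinuous_on 0 (2 * pi) (fun t => f (s%:C * expi t)).
  by move=> hs; apply: ccontinuous_on_circle => z hz; apply: cf; rewrite hz; lra.
have iM : mu.-integrable `[0, 2 * pi] (EFin \o (fun=> M)).
  by apply: continuous_integrable => x _; exact: cvg_cst.
have key (P : R[i] -> R) : (forall z, `|P z| <= normc z) -> continuous (P : R[i]^o -> R) ->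
    {for r, continuous (fun l : R => \int[mu]_(t in `[0, 2 * pi]) P (f (l%:C * expi t)))}.
  move=> hP cP.
  apply: (@continuity_under_integral R _ _ mu (fun l t => P (f (l%:C * expi t)))
    `[0, 2 * pi]%classic (measurable_itv _) (- rho') rho' _ _ _ iM _ r rin).
  - move=> s; rewrite /= in_itv /= -ltr_norml => hs.
    apply: continuous_integrable => t ht.
    apply: (@continuous_comp _ _ _ (fun t => f (s%:C * expi t) : R[i]^o)); last exact: cP.
    exact: (cc _ hs).
  - apply: aeW => t _ s; rewrite inE /= in_itv /= -ltr_norml => hs.
    apply: (@continuous_comp _ _ _ (fun s => f (s%:C * expi t) : R[i]^o)); last exact: cP.
    apply: (@continuous_comp _ _ _ (fun s => s%:C * expi t : R[i]^o)).
      apply: (@cvgM R[i]^o _ _ _ _ (fun=> expi t)); last exact: cvg_cst.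
      exact: real_complex_continuous.
    by apply: cf; rewrite normc_polar; lra.
  - move=> s; rewrite /= in_itv /= -ltr_norml => hs; apply: aeW => t; rewrite /= in_itv /= => ht.
    by apply: (le_trans (hP _)); apply: hM => //; exact: ltW.
apply/(@cvgc_ReIm R _ _ _ (cmean f)); split.
  by apply: key; [exact: Re_le_normc|exact: Re_continuous].
by apply: key; [exact: Im_le_normc|exact: Im_continuous].
Qed.

Lemma cmean0 f : cmean f 0 = f 0 * (2 * pi)%:C.
Proof.
rewrite /cmean /cint (@eq_cintegral _ _ _ _ _ _ (fun=> f 0)); last first.
  by move=> t _; rewrite mul0r.
rewrite cintegral_cst; last exact: measurable_itv.
by rewrite fine_lebesgue_itv ?subr0// twopi_ge0.
Qed.

Lemma continuous_const_right (h : R -> R[i]) (k : R[i]) r0 r1 : r0 < r1 ->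
  {for r0, continuous (h : R -> R[i]^o)} -> (forall r, r0 < r < r1 -> h r = k) -> h r0 = k.
Proof.
move=> r01 ch hk; apply/eqP; rewrite -subr_eq0 -normc_eq0 -[_ == 0]negbK; apply/negP => n0.
have e0 : 0 < normc (h r0 - k) by rewrite lt_def n0 normc_ge0.
have [d /= d0 hd] := (nbhs_ballP r0 _).1 ((@cvgcP _ _ (nbhs r0) _ h (h r0)).1 ch _ e0).
pose r := r0 + Num.min (d / 2) ((r1 - r0) / 2).
have m0 : 0 < Num.min (d / 2) ((r1 - r0) / 2).
  by rewrite lt_min !divr_gt0// subr_gt0.
have m1 : Num.min (d / 2) ((r1 - r0) / 2) <= d / 2 by rewrite ge_min lexx.
have m2 : Num.min (d / 2) ((r1 - r0) / 2) <= (r1 - r0) / 2 by rewrite ge_min lexx orbT.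
have hb : ball r0 d r.
  rewrite /ball /= /r opprD addrA subrr sub0r normrN gtr0_norm//.
  by apply: (le_lt_trans m1); lra.
by have := hd r hb; rewrite /= (hk r) ?ltxx// /r; apply/andP; split; lra.
Qed.

Lemma continuous_const_left (h : R -> R[i]) (k : R[i]) r0 r1 : r1 < r0 ->
  {for r0, continuous (h : R -> R[i]^o)} -> (forall r, r1 < r < r0 -> h r = k) -> h r0 = k.
Proof.
move=> r01 ch hk.
have := @continuous_const_right (fun x => h (- x)) k (- r0) (- r1).
rewrite opprK; apply; first by rewrite ltrN2.
  apply: (@continuous_comp _ _ _ (fun x : R => - x)); first exact: opp_continuous.
  by rewrite opprK.
by move=> r /andP[? ?]; apply: hk; apply/andP; split; lra.
Qed.

(** The means are constant for positive radius and continuous at radius 0. *)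
Lemma cmean_center f (rho : R) r :
  (forall z, normc z < rho -> exists c, cderiv_at f z c) -> 0 <= r < rho ->
  cmean f r = f 0 * (2 * pi)%:C.
Proof.
move=> hf /andP[]; rewrite le_eqVlt => /predU1P[<-|r0] rrho; first by rewrite cmean0.
rewrite -cmean0; symmetry; apply: (@continuous_const_right (cmean f) _ 0 r r0).
  apply: (@cmean_continuous _ rho); last by rewrite normr0; lra.
  by move=> z /hf[c /cderiv_at_continuous].
move=> s /andP[s0 sr]; apply: (@cmean_annulus _ f 0 rho) => //.
  by move=> z /andP[_ /hf].
exact: ltW.
Qed.

(** The means are constant on either side of |a|, and continuity of h makes the
    two constants agree; at radius 0 the mean is the value. *)
Lemma cmean_punctured h a r :
  (forall z, normc z < 1 -> {for z, continuous (h : R[i]^o -> R[i]^o)}) ->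
  (forall z, normc z < 1 -> z != a -> exists c, cderiv_at h z c) ->
  normc a < r < 1 -> cmean h r = h 0 * (2 * pi)%:C.
Proof.
move=> ch hh /andP[ar r1]; have a0 := normc_ge0 a.
have cm s : `|s| < 1 -> {for s, continuous (cmean h : R -> R[i]^o)} := cmean_continuous ch.
have out : cmean h (normc a) = cmean h r.
  apply: (continuous_const_right ar); first by apply: cm; rewrite ger0_norm//; lra.
  move=> s /andP[s1 s2]; apply: (@cmean_annulus _ h (normc a) 1) => //; last exact: ltW.
  move=> z /andP[za z1]; apply: hh => //; apply/eqP => zE; move: za; rewrite zE ltxx //.
rewrite -out; have [->|an0] := eqVneq a 0; first by rewrite normc0 cmean0.
have {}a0 : 0 < normc a by rewrite normc_gt0.
have inn s : 0 < s < normc a -> cmean h s = cmean h (normc a).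
  move=> /andP[s0 sa]; symmetry; apply: (continuous_const_left sa).
    by apply: cm; rewrite ger0_norm//; lra.
  move=> u /andP[us ua]; symmetry; apply: (@cmean_annulus _ h 0 (normc a)) => //; last exact: ltW.
  move=> z /andP[z0 za]; apply: hh; first by lra.
  by apply/eqP => zE; move: za; rewrite zE ltxx.
rewrite -cmean0; symmetry; apply: (continuous_const_right a0) => //.
by apply: cm; rewrite normr0.
Qed.
End CircleMeans2.

(** * The Schwarz formula *)

Section Schwarz.
Context {R : realType}.
Implicit Types (f q : R[i] -> R[i]) (a z c : R[i]) (r s t : R).

(** This is the Cauchy integral formula: the difference quotient extends
    continuously over a, and its product with z vanishes at 0. *)
Lemma cmean_diff_quotient f a r : (forall z, normc z < 1 -> cderivable f z) ->
  normc a < r < 1 -> cmean (fun z => (f z - f a) / (z - a) * z) r = 0.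
Proof.
move=> hf /andP[ar r1]; have r0 : 0 <= r by have := normc_ge0 a; lra.
have [c hc] := cderivable_cderiv_at (hf a (lt_trans ar r1)).
pose d z := if z == a then c else (f z - f a) / (z - a).
pose h z := d z * z.
have hderiv z : normc z < 1 -> z != a -> exists c, cderiv_at h z c.
  move=> z1 za; have za0 : 0 < normc (z - a) by rewrite normc_gt0 subr_eq0.
  have [k hk] : exists k, cderiv_at (fun w => (f w - f a) / (w - a) * w) z k.
    apply: cderivable_cderiv_at; apply: (@cderivableM _ (fun w => (f w - f a) / (w - a)) (fun w => w)); last exact: cderivable_id.
    apply: (@cderivable_div _ (fun w => f w - f a) (fun w => w - a)).
    - by rewrite subr_eq0.
    - exact: (cderivableB (hf z z1) (cderivable_cst (f a) z)).
    - exact: (cderivableB (cderivable_id z) (cderivable_cst a z)).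
  exists k; apply: (cderiv_at_near za0) hk => w hw; rewrite /h /d.
  by case: eqP => // wa; move: hw; rewrite wa normcB ltxx.
have hcont z : normc z < 1 -> {for z, continuous (h : R[i]^o -> R[i]^o)}.
  move=> z1; have [->|za] := eqVneq z a; last first.
    by have [k /cderiv_at_continuous] := hderiv z z1 za.
  suff cd : {for a, continuous (d : R[i]^o -> R[i]^o)}.
    exact: (@cvgM R[i] _ (nbhs (a : R[i]^o)) _ d id (d a) a cd cvg_id).
  apply/ccontinuousP => e e0; have e2 : 0 < e / 2 by rewrite divr_gt0.
  have [dl dl0 hdl] := hc _ e2; exists dl => // w wa.
  rewrite /d eqxx; case: eqP => [_|/eqP wna]; first by rewrite subrr normc0.
  have wa0 : 0 < normc (w - a) by rewrite normc_gt0 subr_eq0.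
  have := hdl _ wa; rewrite subrKC => hw.
  have -> : (f w - f a) / (w - a) - c = (f w - f a - c * (w - a)) / (w - a).
    by field; rewrite subr_eq0.
  rewrite normcM normcV ltr_pdivrMr//; apply: (le_lt_trans hw).
  by rewrite ltr_pM2r//; lra.
have <- : cmean h r = cmean (fun z => (f z - f a) / (z - a) * z) r.
  apply: eq_cintegral => t _; rewrite /h /d; case: eqP => // ta.
  by move: ar; rewrite -ta normc_polar ger0_norm// ltxx.
by rewrite (cmean_punctured hcont hderiv) ?ar// /h mulr0 mul0r.
Qed.

Lemma normcJ z : normc z^*%C = normc z.
Proof. by case: z => x y; rewrite !normc_sqrt sqrrN. Qed.

Lemma conjcD z c : (z + c)^*%C = z^*%C + c^*%C. Proof. exact: rmorphD. Qed.
Lemma conjcB z c : (z - c)^*%C = z^*%C - c^*%C. Proof. exact: rmorphB. Qed.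
Lemma conjcM z c : (z * c)^*%C = z^*%C * c^*%C. Proof. exact: rmorphM. Qed.
Lemma cintegral_conj d (T : measurableType d) (mu : {measure set T -> \bar R}) D
  (f : T -> R[i]) : measurable D -> cintegrable mu D f ->
  cintegral mu D (fun x => (f x)^*%C) = (cintegral mu D f)^*%C.
Proof.
move=> mD [_ f2]; rewrite /cintegral /=; congr (_ +i* _).
  by apply: eq_Rintegral => x _; case: (f x).
rewrite -mulN1r -RintegralZl//; apply: eq_Rintegral => x _.
by case: (f x) => u v /=; rewrite mulN1r.
Qed.

Lemma cintegrable_conj d (T : measurableType d) (mu : {measure set T -> \bar R}) D
  (f : T -> R[i]) : measurable D -> cintegrable mu D f ->
  cintegrable mu D (fun x => (f x)^*%C).
Proof.
move=> mD [f1 f2]; split.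
  by apply: eq_integrable_EFin f1 => // x _; case: (f x).
apply: eq_integrable_EFin (integrableZ_EFin (-1) mD f2) => // x _.
by case: (f x) => u v /=; rewrite mulN1r.
Qed.

(** On the circle |z| = r this is the conjugate of (z + a) / (z - a); unlike the
    latter it is holomorphic on a disc of radius larger than r. *)
Definition reflected_kernel a r z : R[i] := ((r ^+ 2)%:C + a^*%C * z) / ((r ^+ 2)%:C - a^*%C * z).

Lemma reflected_denom_neq0 a r z : normc a * normc z < r ^+ 2 -> (r ^+ 2)%:C - a^*%C * z != 0.
Proof.
move=> h; rewrite subr_eq0; apply/eqP => /(congr1 normc).
rewrite normcM normcJ normc_real ger0_norm ?sqr_ge0// => e.
by move: h; rewrite e ltxx.
Qed.

Lemma cderivable_reflected q a r z : cderivable q z -> normc a * normc z < r ^+ 2 ->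
  cderivable (fun z => q z * reflected_kernel a r z) z.
Proof.
move=> hq hz; apply: (@cderivableM _ q (reflected_kernel a r) z hq).
apply: (@cderivable_div _ (fun z => (r ^+ 2)%:C + a^*%C * z) (fun z => (r ^+ 2)%:C - a^*%C * z)).
- exact: reflected_denom_neq0.
- exact: (cderivableD (cderivable_cst (r ^+ 2)%:C z) (cderivableM (cderivable_cst a^*%C z) (cderivable_id z))).
- exact: (cderivableB (cderivable_cst (r ^+ 2)%:C z) (cderivableM (cderivable_cst a^*%C z) (cderivable_id z))).
Qed.

(** The mean value property: the kernel is holomorphic for |a| |z| < r^2. The
    number m lies between |a| and r, so that r^2 / m exceeds r and makes sense
    also when a = 0. *)
Lemma cmean_reflected q a r : (forall z, normc z < 1 -> cderivable q z) ->
  normc a < r < 1 -> cmean (fun z => q z * reflected_kernel a r z) r = q 0 * (2 * pi)%:C.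
Proof.
move=> hq /andP[ar r1]; have a0 := normc_ge0 a.
have r0 : 0 < r by lra.
pose m := (normc a + r) / 2; have am : normc a < m by rewrite /m; lra.
have mr : m < r by rewrite /m; lra.
have m0 : 0 < m by lra.
rewrite (@cmean_center _ _ (Num.min 1 (r ^+ 2 / m))).
- by rewrite /reflected_kernel mulr0 addr0 subr0 divff ?mulr1// eq_complex /= eqxx andbT expf_neq0// gt_eqF.
- move=> z; rewrite lt_min => /andP[z1]; rewrite ltr_pdivlMr// => zm.
  apply/cderivable_cderiv_at/cderivable_reflected; first exact: hq.
  by apply: le_lt_trans zm; rewrite mulrC; apply: ler_wpM2l; [exact: normc_ge0|exact: ltW].
- by rewrite ltW//= lt_min r1 ltr_pdivlMr// expr2 ltr_pM2l.
Qed.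

Lemma ccontinuous_on_circle_cderivable f r : (forall z, normc z = `|r| -> cderivable f z) ->
  ccontinuous_on 0 (2 * pi) (fun t => f (r%:C * expi t)).
Proof.
by move=> hf; apply: ccontinuous_on_circle => z hz; apply: derivable_continuous_at; exact: hf.
Qed.

(** Replace Re q by half of q plus its conjugate. The part with q is evaluated
    by the Cauchy formula, the conjugate part by the mean value property after
    conjugating the kernel; q(0) = 1 makes the constants cancel. *)
Lemma schwarz q z r : (forall z, normc z < 1 -> cderivable q z) -> q 0 = 1 ->
  0 < r < 1 -> normc z < 1 ->
  cint 0 (2 * pi) (fun t => (Re (q (r%:C * expi t)))%:C *
    ((1 + expi (- t) * z) / (1 - expi (- t) * z))) = q (r%:C * z) * (2 * pi)%:C.
Proof.
move=> hq q0 /andP[r0 r1] z1; pose a := r%:C * z.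
have na : normc a = r * normc z by rewrite normcM normc_real gtr0_norm.
have ar : normc a < r by rewrite na gtr_pMr.
have a1 : normc a < 1 by lra.
have rn : `|r| = r by rewrite gtr0_norm.
have dz t : 1 - expi (- t) * z != 0.
  rewrite subr_eq0; apply/eqP => /(congr1 normc); rewrite normc1 normcM normc_expi mul1r => h.
  by move: z1; rewrite -h ltxx.
pose X t := let w := r%:C * expi t in (q w - q a) / (w - a) * w.
pose Q t := q (r%:C * expi t).
pose K t := 1 * reflected_kernel a r (r%:C * expi t).
pose QK t := q (r%:C * expi t) * reflected_kernel a r (r%:C * expi t).
have kE t : (reflected_kernel a r (r%:C * expi t))^*%C =
    (1 + expi (- t) * z) / (1 - expi (- t) * z).
  have d1 := reflected_denom_neq0 (a := a) (r := r) (z := r%:C * expi t).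
  rewrite normc_polar rn expr2 ltr_pM2r// ar -expr2 in d1.
  have r0c : r%:C != 0 by rewrite eq_complex /= eqxx andbT gt_eqF.
  rewrite /reflected_kernel conjcM conjc_inv conjcD conjcB !conjcM !conjc_real conjcK.
  rewrite -expiN /a rmorphXn /=.
  have dz' := dz t.
  have d3 : r%:C ^+ 2 - r%:C * z * (r%:C * expi (- t)) != 0.
    have -> : r%:C ^+ 2 - r%:C * z * (r%:C * expi (- t)) = r%:C ^+ 2 * (1 - expi (- t) * z) by ring.
    by rewrite mulf_neq0// expf_neq0.
  by field; rewrite ?d3 ?dz'.
have har : normc a < r < 1 by rewrite ar r1.
have mI : measurable (`[0, 2 * pi] : set (measurableTypeR R)) by exact: measurable_itv.
have iQ : cintegrable lebesgue_measure `[0, 2 * pi] Q.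
  by apply/ccontinuous_on_integrable/ccontinuous_on_circle_cderivable => w; rewrite rn => wr; apply: hq; lra.
have iX : cintegrable lebesgue_measure `[0, 2 * pi] X.
  apply/ccontinuous_on_integrable/(@ccontinuous_on_circle_cderivable (fun w => (q w - q a) / (w - a) * w)) => w; rewrite rn => wr.
  have wa : w - a != 0.
    by rewrite subr_eq0; apply/eqP => wE; move: ar; rewrite -wE wr ltxx.
  apply: (@cderivableM _ (fun w => (q w - q a) / (w - a)) (fun w => w)); last exact: cderivable_id.
  apply: (@cderivable_div _ (fun w => q w - q a) (fun w => w - a)) => //.
  - by apply: (cderivableB _ (cderivable_cst (q a) w)); apply: hq; lra.
  - exact: (cderivableB (cderivable_id w) (cderivable_cst a w)).
have ireg (f : R[i] -> R[i]) : (forall w, normc w < 1 -> cderivable f w) ->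
    cintegrable lebesgue_measure `[0, 2 * pi]
      (fun t => f (r%:C * expi t) * reflected_kernel a r (r%:C * expi t)).
  move=> hf; apply/ccontinuous_on_integrable/(@ccontinuous_on_circle_cderivable (fun w => f w * reflected_kernel a r w)) => w.
  rewrite rn => wr; apply: cderivable_reflected; first by apply: hf; lra.
  by rewrite wr expr2 ltr_pM2r.
have iQK := ireg q hq.
have iK := ireg (fun=> 1) (fun w _ => cderivable_cst 1 w).
have meanX : cint 0 (2 * pi) X = 0.
  by rewrite -(cmean_diff_quotient hq (a := a) (r := r)) ?ar.
have meanQ : cint 0 (2 * pi) Q = (2 * pi)%:C.
  rewrite -[RHS]mul1r -q0; apply: (@cmean_center _ _ 1); last by rewrite ltW.
  by move=> w /hq/cderivable_cderiv_at.
have meanQK : cint 0 (2 * pi) QK = (2 * pi)%:C.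
  by rewrite -[RHS]mul1r -q0; apply: cmean_reflected; rewrite ?ar.
have meanK : cint 0 (2 * pi) K = (2 * pi)%:C.
  rewrite -[RHS]mul1r.
  exact: (@cmean_reflected (fun=> 1) a r (fun w _ => cderivable_cst 1 w) har).
have mean1 : cint 0 (2 * pi) (fun _ : R => 1 : R[i]) = (2 * pi)%:C.
  have := cintegral_cst lebesgue_measure (1 : R[i]) mI.
  by rewrite mul1r fine_lebesgue_itv ?twopi_ge0// subr0.
have iKb := cintegrable_conj mI iK; have iQKb := cintegrable_conj mI iQK.
have i1 := cintegrable_cst (1 : R[i]) mI (lebesgue_itv_fin 0 (2 * pi)).
pose h : R[i] := 2^-1.
have ptw t : (Re (Q t))%:C * ((1 + expi (- t) * z) / (1 - expi (- t) * z)) =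
    (X t + (q a * h) * (K t)^*%C) + ((q a * h) * 1 + (- h * Q t + h * (QK t)^*%C)).
  rewrite ReJ_add /X /K /QK mul1r conjcM kE -/(Q t) /h /a.
  have -> : r%:C * expi t - r%:C * z = r%:C * expi t * (1 - expi (- t) * z).
    by rewrite mulrBr mulr1 mulrA -(mulrA r%:C) -expiD subrr expi0 mulr1.
  have r0c : r%:C != 0 by rewrite eq_complex /= eqxx andbT gt_eqF.
  by field; rewrite r0c expi_neq0 dz.
transitivity (cint 0 (2 * pi) (fun t => (X t + (q a * h) * (K t)^*%C) +
    ((q a * h) * 1 + (- h * Q t + h * (QK t)^*%C)))).
  by apply: eq_cintegral => t _; exact: ptw.
rewrite /cint.
have i1' := cintegrableZ (q a * h) mI i1.
have iK' := cintegrableZ (q a * h) mI iKb.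
have iQ' := cintegrableZ (- h) mI iQ.
have iQK' := cintegrableZ h mI iQKb.
have E0 := cintegrableD mI iX iK'.
have E1 := cintegrableD mI iQ' iQK'.
have E2 := cintegrableD mI i1' E1.
rewrite (cintegralD mI E0 E2) (cintegralD mI iX iK') (cintegralD mI i1' E1) (cintegralD mI iQ' iQK').
rewrite !cintegralZ// !cintegral_conj//.
move: meanX meanQ meanQK meanK mean1; rewrite /cint => -> -> -> -> ->.
by rewrite conjc_real /h -/a; field.
Qed.
End Schwarz.

(** * Quantile functions and weak limits of densities *)

Section Quantiles.
Context {R : realType}.
Notation mu := (@lebesgue_measure R).
Implicit Types (u f phi : R -> R) (a b s t T L : R).

(** Each cell carries the mass 1 / N, so the error on it is the oscillation of f
    divided by N. Only monotonicity of the partition enters, not its mesh. *)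
Lemma quantile_riemann u f (t D : nat -> R) (N : nat) : t 0%N = 0 ->
  {homo t : i j / (i <= j)%N >-> i <= j} ->
  (forall x, 0 <= x <= t N -> 0 <= u x) ->
  mu.-integrable `[0, t N] (EFin \o u) ->
  mu.-integrable `[0, t N] (EFin \o (fun x => f x * u x)) ->
  (forall i, (i < N)%N -> \int[mu]_(x in `[t i, t i.+1]) u x = N%:R^-1) ->
  (forall i x, (i < N)%N -> t i <= x <= t i.+1 -> `|f x - f (t i)| <= D i) ->
  `|\int[mu]_(x in `[0, t N]) (f x * u x) - N%:R^-1 * \sum_(i < N) f (t i)| <=
    N%:R^-1 * \sum_(i < N) D i.
Proof.
move=> t0 tm u0 iu ifu hu hD.
suff: forall k, (k <= N)%N ->
    `|\int[mu]_(x in `[0, t k]) (f x * u x) - N%:R^-1 * \sum_(i < k) f (t i)| <=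
    N%:R^-1 * \sum_(i < k) D i by apply.
elim=> [_|k IH kN].
  by rewrite !big_ord0 t0 set_itv1 Rintegral_set1 !mulr0 subrr normr0.
have tk0 : 0 <= t k by rewrite -t0 tm.
have tkk : t k <= t k.+1 by exact: tm.
have tkN : t k.+1 <= t N by exact: tm.
have sub0 : `[0, t k.+1]%classic `<=` `[0, t N]%classic.
  by apply: subset_itvl; rewrite bnd_simp.
have subk : `[t k, t k.+1]%classic `<=` `[0, t N]%classic.
  by apply: subset_itv; rewrite bnd_simp.
have ik : mu.-integrable `[t k, t k.+1] (EFin \o u) by apply: integrableS iu.
have ifk : mu.-integrable `[t k, t k.+1] (EFin \o (fun x => f x * u x)) by apply: integrableS ifu.
rewrite (Rintegral_split tk0 tkk); last by apply: integrableS ifu.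
rewrite !big_ord_recr /= !mulrDr.
set I := \int[mu]_(x in `[0, t k]) _; set J := \int[mu]_(x in `[t k, t k.+1]) _.
have -> : I + J - (N%:R^-1 * \sum_(i < k) f (t i) + N%:R^-1 * f (t k)) =
  (I - N%:R^-1 * \sum_(i < k) f (t i)) + (J - N%:R^-1 * f (t k)) by ring.
apply: (le_trans (ler_normD _ _)); apply: lerD; first by apply: IH; exact: ltnW.
rewrite -(hu k kN) mulrC -RintegralZl// -RintegralB//; last exact: integrableZ_EFin.
rewrite [leRHS]mulrC -RintegralZl//.
have ifm : mu.-integrable `[t k, t k.+1] (EFin \o (fun x => f x * u x - f (t k) * u x)).
  apply: (eq_integrable_EFin _ _ (integrable_comb 1 (- f (t k)) _ ifk ik)) => // x _.
  by rewrite mul1r mulNr.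
apply: (le_trans (le_normr_Rintegral _ ifm)) => //.
apply: le_Rintegral => //.
- exact: (integrable_norm ifm).
- exact: integrableZ_EFin.
move=> x xk; have := subk x xk; rewrite /= in_itv /= => /u0 ux0.
rewrite -mulrBl normrM [X in _ * X]ger0_norm// ler_wpM2r// hD//.
Qed.

(** Q s is a point where the distribution function of u takes the value s. The
    end values are imposed because u may vanish near the ends of the interval.
    *)
Definition quantile u T (Q : R -> R) :=
  [/\ Q 0 = 0, Q 1 = T, forall s, 0 <= s <= 1 -> 0 <= Q s <= T &
      forall s, 0 <= s <= 1 -> \int[mu]_(x in `[0, Q s]) u x = s].

Lemma quantile_exists u T : 0 <= T -> mu.-integrable `[0, T] (EFin \o u) ->
  \int[mu]_(x in `[0, T]) u x = 1 -> exists Q, quantile u T Q.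
Proof.
move=> T0 iu u1; pose F s := \int[mu]_(x in `[0, s]) u x.
have F0 : F 0 = 0 by rewrite /F set_itv1 Rintegral_set1.
have cF : {within `[0, T], continuous F} := parameterized_integral_continuous T0 iu.
have /choice[Q hQ] : forall s, exists q, 0 <= s <= 1 -> [/\ 0 <= q <= T, F q = s,
    s = 0 -> q = 0 & s = 1 -> q = T].
  move=> s; have [s01|ns] := boolP (0 <= s <= 1); last by exists 0.
  have [->|s0] := eqVneq s 0.
    by exists 0 => _; split=> //; rewrite ?lexx// => /eqP; rewrite eq_sym oner_eq0.
  have [->|s1] := eqVneq s 1.
    by exists T => _; split=> //; rewrite ?lexx ?T0// => /eqP; rewrite oner_eq0.
  have [|c] := @IVT R F 0 T s T0 cF.
    rewrite F0; have -> : F T = 1 := u1.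
    by rewrite /Num.min /Num.max ltr01.
  rewrite in_itv /= => cT Fc; exists c => _; split=> //.
  - by move=> e; rewrite e eqxx in s0.
  - by move=> e; rewrite e eqxx in s1.
exists Q; split.
- by have [] := hQ 0; rewrite ?lexx ?ler01// => _ _ ->.
- by have [] := hQ 1; rewrite ?lexx ?ler01// => _ _ _ ->.
- by move=> s /hQ[].
- by move=> s /hQ[].
Qed.

Lemma quantile_homo u T Q : mu.-integrable `[0, T] (EFin \o u) ->
  (forall x, 0 <= x <= T -> 0 <= u x) -> quantile u T Q ->
  forall s s', 0 <= s -> s <= s' -> s' <= 1 -> Q s <= Q s'.
Proof.
move=> iu u0 [_ _ QT FQ] s s' s0; rewrite le_eqVlt => /predU1P[<-//|ss'] s1.
have hs : 0 <= s <= 1 by rewrite s0 ltW// (lt_le_trans ss').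
have hs' : 0 <= s' <= 1 by rewrite s1 ltW// (le_lt_trans s0).
have /andP[q1 q2] := QT _ hs; have /andP[q1' q2'] := QT _ hs'.
rewrite leNgt; apply/negP => hQ; have := FQ s hs.
have sub : `[0, Q s]%classic `<=` `[0, T]%classic by apply: subset_itvl; rewrite bnd_simp.
rewrite (Rintegral_split q1' (ltW hQ)); last exact: integrableS iu.
rewrite FQ// => e.
have : 0 <= \int[mu]_(x in `[Q s', Q s]) u x.
  apply: Rintegral_ge0 => x; rewrite /= in_itv /= => /andP[x1 x2].
  by apply: u0; rewrite (le_trans q1' x1) (le_trans x2 q2).
by lra.
Qed.

Lemma lipschitz_continuous phi L : (forall x y, `|phi x - phi y| <= L * `|x - y|) ->
  continuous phi.
Proof.
move=> hL x; pose K := `|L| + 1.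
have K0 : 0 < K by rewrite ltr_wpDl.
apply/cvgrPdist_lt => e e0; apply/nbhs_ballP; exists (e / K) => /=; first by rewrite divr_gt0.
move=> y; rewrite /ball /= ltr_pdivlMr// => xy; apply: (le_lt_trans (hL _ _)).
apply: le_lt_trans xy; rewrite mulrC ler_wpM2l//.
by apply: (le_trans (ler_norm _)); rewrite /K lerDl.
Qed.

(** The oscillations over the cells telescope to L T, which is what makes the
    bound independent of the density. *)
Lemma quantile_riemann_lipschitz u T Q phi L (N : nat) : 0 <= T -> (0 < N)%N ->
  {in `[0, T], continuous u} -> (forall x, 0 <= x <= T -> 0 <= u x) ->
  (forall x y, `|phi x - phi y| <= L * `|x - y|) -> quantile u T Q ->
  `|\int[mu]_(x in `[0, T]) (phi x * u x) - N%:R^-1 * \sum_(i < N) phi (Q (i%:R / N%:R))| <=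
    N%:R^-1 * (L * T).
Proof.
move=> T0 N0 cu u0 hL hq; have [Q0 Q1 QT FQ] := hq.
have iu := continuous_integrable cu.
have NR : 0 < N%:R :> R by rewrite ltr0n.
(* the partition has to be monotone beyond the index N as well *)
pose c (i : nat) : R := Num.min 1 (i%:R / N%:R).
have c0 i : 0 <= c i by rewrite le_min ler01 divr_ge0.
have c1 i : c i <= 1 by rewrite ge_min lexx.
have cE i : (i <= N)%N -> c i = i%:R / N%:R.
  by move=> iN; rewrite /c; apply/min_idPr; rewrite ler_pdivrMr// mul1r ler_nat.
have cm : {homo c : i j / (i <= j)%N >-> i <= j}.
  move=> i j ij; rewrite /c le_min !ge_min lexx /=.
  by apply/orP; right; rewrite ler_pM2r ?invr_gt0// ler_nat.
pose t i := Q (c i).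
have tN : t N = T by rewrite /t cE// divff ?gt_eqF.
have t0 : t 0%N = 0 by rewrite /t cE// mul0r.
have tm : {homo t : i j / (i <= j)%N >-> i <= j}.
  by move=> i j ij; apply: (quantile_homo iu u0 hq) => //; exact: cm.
have cphi := lipschitz_continuous hL.
have ifu : mu.-integrable `[0, T] (EFin \o (fun x => phi x * u x)).
  by apply: continuous_integrable => x xT; apply: cvgM; [exact: cphi|exact: cu].
have L0 : 0 <= L.
  have := le_trans (normr_ge0 _) (hL 1 0); by rewrite subr0 normr1 mulr1.
have hu i : (i < N)%N -> \int[mu]_(x in `[t i, t i.+1]) u x = N%:R^-1.
  move=> iN; have ti0 : 0 <= t i by rewrite -t0 tm.
  have tii : t i <= t i.+1 by exact: tm.
  have := FQ (c i.+1) _; rewrite c0 c1 => /(_ isT).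
  have sub : `[0, t i.+1]%classic `<=` `[0, T]%classic.
    by apply: subset_itvl; rewrite bnd_simp -tN tm.
  rewrite (Rintegral_split ti0 tii); last exact: integrableS iu.
  rewrite FQ ?c0 ?c1// !cE//; last exact: ltnW.
  move=> h; have -> : N%:R^-1 = i.+1%:R / N%:R - i%:R / N%:R :> R.
    by rewrite -mulrBl -addn1 natrD addrC addKr mul1r.
  by rewrite -h; ring.
have hD i x : (i < N)%N -> t i <= x <= t i.+1 -> `|phi x - phi (t i)| <= L * (t i.+1 - t i).
  move=> iN /andP[x1 x2]; apply: (le_trans (hL _ _)); rewrite ler_wpM2l// ger0_norm ?subr_ge0//.
  by rewrite lerD2r.
have := @quantile_riemann u phi t (fun i => L * (t i.+1 - t i)) N t0 tm.
rewrite tN => /(_ u0 iu ifu hu hD).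
rewrite -mulr_sumr -(big_mkord xpredT (fun i => t i.+1 - t i)) telescope_sumr// tN t0 subr0.
by under eq_bigr => i _ do rewrite /t cE ?(ltnW (ltn_ord i))//.
Qed.
End Quantiles.

Section Helly.
Context {R : realType}.
Notation mu := (@lebesgue_measure R).
Implicit Types (f phi : R -> R) (a b s t T L : R).

(** Of the preimages of a set and of its complement, one belongs to the
    ultrafilter. *)
Lemma ultra_fmap (T1 T2 : Type) (f : T1 -> T2) (U : set_system T1) :
  UltraFilter U -> UltraFilter (f @ U).
Proof.
move=> UU; split; first exact: fmap_proper_filter.
move=> G PG sub; apply/seteqP; split=> // A GA.
have [//|nA] := in_ultra_setVsetC (f @^-1` A) UU.
have /= : G (A `&` ~` A) by apply: filterI => //; apply: sub.
by rewrite setICr => /filter_not_empty.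
Qed.

Lemma ultra_segment (T1 : Type) (U : set_system T1) (x : T1 -> R) a b :
  UltraFilter U -> (forall i, a <= x i <= b) -> exists l, a <= l <= b /\ x @ U --> l.
Proof.
move=> UU hx; have := @segment_compact R a b; rewrite compact_ultra.
move=> /(_ (x @ U) (ultra_fmap x UU)) [|l [/=]].
  by apply: (@filterE _ U) => i; rewrite /= in_itv /=; exact: hx.
by rewrite in_itv /= => lab xl; exists l.
Qed.

Lemma cvg_sum_ord (T1 : Type) (U : set_system T1) (FU : Filter U) (N : nat)
    (f : nat -> T1 -> R) (a : nat -> R) :
  (forall i, (i < N)%N -> f i @ U --> a i) ->
  (fun m => \sum_(i < N) f i m) @ U --> \sum_(i < N) a i.
Proof.
elim: N => [_|N IH fa].
  rewrite big_ord0; under eq_cvg do rewrite big_ord0.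
  exact: cvg_cst.
rewrite big_ord_recr /=; under eq_cvg do rewrite big_ord_recr /=.
by apply: cvgD; [apply: IH => i iN; apply: fa; exact: ltnW|exact: fa].
Qed.

Lemma ultra_nat : exists U : set_system nat, UltraFilter U /\ \oo `<=` U.
Proof. exact: ultraFilterLemma. Qed.

(** Quantile functions take values in the compact interval [0, T], so they
    converge pointwise along an ultrafilter. Riemann sums at i / N converge
    along with them, and differ from the integrals by at most L T / N uniformly
    in the density; the limit satisfies the same estimate because it is
    monotone. *)
Lemma helly_quantile (u : nat -> R -> R) T : 0 <= T ->
  (forall m, {in `[0, T], continuous (u m)}) ->
  (forall m x, 0 <= x <= T -> 0 <= u m x) ->
  (forall m, \int[mu]_(x in `[0, T]) u m x = 1) ->
  exists2 Q : R -> R, {homo Q : s t / s <= t} /\ (forall s, 0 <= Q s <= T) &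
  forall phi L l, (forall x y, `|phi x - phi y| <= L * `|x - y|) ->
    (fun m => \int[mu]_(x in `[0, T]) (phi x * u m x)) @ \oo --> l ->
    \int[mu]_(s in `[0, 1]) phi (Q s) = l.
Proof.
move=> T0 cu u0 u1.
have [U [UU ooU]] := ultra_nat.
have /choice[q hq] m := quantile_exists T0 (continuous_integrable (cu m)) (u1 m).
have qhomo m := quantile_homo (continuous_integrable (cu m)) (u0 m) (hq m).
(* clamping to [0, 1] makes the limit monotone on the whole line, hence measurable *)
pose c s : R := Num.max 0 (Num.min 1 s).
have c01 s : 0 <= c s <= 1.
  by rewrite /c le_max lexx /= ge_max ler01 ge_min lexx.
have cm s t : s <= t -> c s <= c t.
  move=> st; rewrite /c ge_max le_max lexx /= le_max; apply/orP; right.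
  by rewrite le_min !ge_min lexx st orbT.
have cid s : 0 <= s <= 1 -> c s = s.
  by move=> /andP[s0 s1]; rewrite /c; rewrite (min_idPr s1) (max_idPr s0).
have qT m s : 0 <= q m (c s) <= T by have [_ _ h _] := hq m; exact: h.
have /choice[Q hQ] s : exists l, 0 <= l <= T /\ (fun m => q m (c s)) @ U --> l.
  by apply: ultra_segment.
have Qhomo : {homo Q : s t / s <= t}.
  move=> s t st; apply: (ler_cvg_to (hQ s).2 (hQ t).2); apply: nearW => m.
  by apply: qhomo; [by case/andP: (c01 s)|exact: cm|by case/andP: (c01 t)].
exists Q; first by split=> // s; exact: (hQ s).1.
move=> phi L l hL hl.
have cphi := lipschitz_continuous hL.
have L0 : 0 <= L.
  have := le_trans (normr_ge0 _) (hL 1 0); by rewrite subr0 normr1 mulr1.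
have hlU : (fun m => \int[mu]_(x in `[0, T]) (phi x * u m x)) @ U --> l.
  by move=> A /hl /ooU.
pose RS N := N%:R^-1 * \sum_(i < N) phi (Q (i%:R / N%:R)).
have iN01 N i : (0 < N)%N -> (i <= N)%N -> 0 <= (i%:R / N%:R : R) <= 1.
  move=> N0 iN; apply/andP; split; first exact: divr_ge0.
  by rewrite ler_pdivrMr ?ltr0n// mul1r ler_nat.
have left N : (0 < N)%N -> `|l - RS N| <= N%:R^-1 * (L * T).
  move=> N0.
  have hRS : (fun m => N%:R^-1 * \sum_(i < N) phi (q m (i%:R / N%:R))) @ U --> RS N.
    apply: cvgM; first exact: cvg_cst.
    apply: (@cvg_sum_ord _ _ _ N (fun i m => phi (q m (i%:R / N%:R))) (fun i => phi (Q (i%:R / N%:R)))) => i iN.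
    have hi := (hQ (i%:R / N%:R)).2.
    rewrite (cid _ (iN01 N i N0 (ltnW iN))) in hi.
    exact: (cvg_comp _ phi hi (cphi _)).
  have hn : (fun m => `|\int[mu]_(x in `[0, T]) (phi x * u m x) -
       N%:R^-1 * \sum_(i < N) phi (q m (i%:R / N%:R))|) @ U --> `|l - RS N|.
    by apply: cvg_norm; exact: cvgB.
  apply: (ler_cvg_to hn (cvg_cst _)); apply: nearW => m.
  exact: quantile_riemann_lipschitz (cu m) (u0 m) hL (hq m).
have mQ : measurable_fun setT Q.
  by exact: nondecreasing_measurable.
have mphiQ : measurable_fun setT (phi \o Q).
  by apply: measurableT_comp => //; exact: continuous_measurable_fun.
have iphiQ : mu.-integrable `[0, 1] (EFin \o (phi \o Q)).
  apply: measurable_bounded_integrable => //.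
  - exact: lebesgue_itv_fin.
  - exact: measurable_funTS.
  exists (`|phi 0| + L * T); split; first exact: num_real.
  move=> M hM s _; apply: ltW; apply: le_lt_trans hM => /=.
  have -> : phi (Q s) = (phi (Q s) - phi 0) + phi 0 by rewrite subrK.
  apply: (le_trans (ler_normD _ _)); rewrite [leLHS]addrC lerD2l.
  apply: (le_trans (hL _ _)); rewrite subr0 ler_wpM2l//.
  by have /andP[? ?] := (hQ s).1; rewrite ger0_norm.
have right N : (0 < N)%N -> `|\int[mu]_(s in `[0, 1]) phi (Q s) - RS N| <= N%:R^-1 * (L * T).
  move=> N0; have NR : 0 < N%:R :> R by rewrite ltr0n.
  have := @quantile_riemann R (fun=> 1) (phi \o Q) (fun i => i%:R / N%:R)
     (fun i => L * (Q (i.+1%:R / N%:R) - Q (i%:R / N%:R))) N.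
  rewrite mul0r divff ?gt_eqF// => /(_ erefl).
  rewrite -mulr_sumr -(big_mkord xpredT (fun i => Q (i.+1%:R / N%:R) - Q (i%:R / N%:R))).
  rewrite telescope_sumr//; under eq_Rintegral => x _ do rewrite mulr1.
  move=> h; apply: (le_trans (h _ _ _ _ _ _)) => //.
  - by move=> i j ij; rewrite ler_pM2r ?invr_gt0// ler_nat.
  - by apply: continuous_integrable => x _; exact: cvg_cst.
  - by apply: eq_integrable_EFin iphiQ => // x _ /=; rewrite mulr1.
  - move=> i iN; rewrite Rintegral_cst// fine_lebesgue_itv.
      by rewrite mul1r -mulrBl -natrB// subSnn mul1r.
    by rewrite ler_pM2r ?invr_gt0// ler_nat.
  - move=> i x iN /andP[x1 x2]; apply: (le_trans (hL _ _)); rewrite ler_wpM2l//.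
    by rewrite ger0_norm ?subr_ge0 ?Qhomo// lerD2r Qhomo.
  apply: ler_wpM2l; first by rewrite invr_ge0 ltW.
  apply: ler_wpM2l => //; rewrite divff ?gt_eqF//.
  by have /andP[? ?] := (hQ 1).1; have /andP[? ?] := (hQ (0 / N%:R)).1; lra.
apply/eqP; rewrite -subr_eq0 -normr_eq0 eq_le normr_ge0 andbT.
rewrite leNgt; apply/negP => d0.
set dd := `|_| in d0.
have LT : 0 <= L * T by rewrite mulr_ge0.
have := archi_boundP (divr_ge0 (addr_ge0 LT LT) (ltW d0)).
set N := Num.bound _ => hN.
have N0 : (0 < N)%N.
  by rewrite -(ltr_nat R); apply: le_lt_trans hN; rewrite divr_ge0 ?addr_ge0// ltW.
have NR : 0 < N%:R :> R by rewrite ltr0n.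
have h1 := left N N0; have h2 := right N N0.
have : dd <= N%:R^-1 * (L * T) + N%:R^-1 * (L * T).
  rewrite /dd -[X in X - l](subrK (RS N)) -addrA; apply: (le_trans (ler_normD _ _)).
  by apply: lerD => //; rewrite distrC.
rewrite -mulrDr => h3.
have := ler_wpM2l (ltW NR) h3; rewrite mulVKf ?gt_eqF// leNgt => /negP; apply.
by rewrite -ltr_pdivrMr.
Qed.
End Helly.

(** * Herglotz measures on the circle *)

Section CircleMeasure.
Context {R : realType}.
Notation mu := (@lebesgue_measure R).
Implicit Types (s t : R) (x z : R[i]) (F : R[i] -> R[i]).

Lemma expi_in_circle t : (expi t : R[i]^o) \in [set x : R[i]^o | `|x| = 1].
Proof. by rewrite inE /= normr_normc normc_expi. Qed.

Definition circle_point t : borel_circle R := exist _ (expi t) (expi_in_circle t).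

Lemma normc_circle_val (x : borel_circle R) : normc (circle_val x) = 1.
Proof. by case: x => x h; apply: complexI; have := h; rewrite inE. Qed.

(** Parameters in [-pi, pi] are a compact interval, so that extreme and
    intermediate values on the circle reduce to one real variable. *)
Lemma expi_surj x : normc x = 1 -> exists2 t, - pi <= t <= pi & x = expi t.
Proof.
case: x => a b; rewrite normc_sqrt => h.
have h2 : a ^+ 2 + b ^+ 2 = 1.
  by rewrite -[LHS]sqr_sqrtr ?addr_ge0 ?sqr_ge0// h expr1n.
have a1 : -1 <= a <= 1.
  rewrite -ler_norml -(@ler_pXn2r _ 2) ?nnegrE ?ler01// expr1n real_normK ?num_real//.
  by rewrite -h2 lerDl sqr_ge0.
have t0 := acos_ge0 a1; have tpi := acos_lepi a1.
have ca : cos (acos a) = a by rewrite acosK// in_itv.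
have sa : sin (acos a) = `|b|.
  by rewrite sin_acos// -h2 addrC addKr sqrtr_sqr.
have [b0|b0] := leP 0 b.
  exists (acos a); first by apply/andP; split => //; lra.
  by rewrite /expi ca sa ger0_norm.
exists (- acos a); first by apply/andP; split; lra.
by rewrite /expi cosN sinN ca sa ltr0_norm// opprK.
Qed.

Lemma measurable_circle_point : measurable_fun setT circle_point.
Proof.
apply: (@measurability _ _ _ _ _ circle_point (open : set (set (circle R)))) => //.
move=> _ [_ [V oV <-] <-]; rewrite setTI.
apply: open_measurable; rewrite -comp_preimage.
apply: (@open_comp _ _ (@expi R : R -> R[i]^o)) => // t _; exact: expi_continuous.
Qed.

(** The circle carries the subspace topology, so the restriction of a continuous
    function is continuous on it and preimages of open sets are generators. *)
Lemma measurable_circle_fun (u : R[i] -> R) :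
  (forall x, normc x = 1 -> {for x, continuous (u : R[i]^o -> R)}) ->
  measurable_fun setT (fun x : borel_circle R => u (circle_val x)).
Proof.
move=> cu; apply: (measurability _ (RGenOpens.measurableE R)) => //.
move=> _ [_ [a [b ->] <-]]; rewrite setTI; apply: sub_sigma_algebra.
have : continuous (u \o (set_val : circle R -> R[i]^o)).
  move=> x; apply: (@continuous_comp (circle R) R[i]^o R set_val u x).
    exact: initial_continuous.
  by apply: cu; exact: (normc_circle_val x).
by move=> /continuousP; apply; exact: interval_open.
Qed.
End CircleMeasure.

Section Herglotz.
Context {R : realType}.
Notation lmu := (@lebesgue_measure R).
Implicit Types (s t : R) (z : R[i]) (F : R[i] -> R[i]).

Lemma circle_bounded F : (forall x, normc x = 1 -> {for x, continuous (F : R[i]^o -> R[i]^o)}) ->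
  exists M, forall x, normc x = 1 -> normc (F x) <= M.
Proof.
move=> cF; have pi0 := pi_ge0 R.
have [||c _ hc] := @EVT_max R (fun t => normc (F (expi t))) (- pi) pi.
- lra.
- apply: continuous_in_subspaceT => t _; apply: cvg_normc.
  apply: (@continuous_comp _ _ _ (@expi R : R -> R[i]^o)); first exact: expi_continuous.
  by apply: cF; exact: normc_expi.
exists (normc (F (expi c))) => x /expi_surj[t ht ->]; apply: hc.
by rewrite in_itv.
Qed.

Lemma circle_cintegrable (mu : probability (borel_circle R) R) F :
  (forall x, normc x = 1 -> {for x, continuous (F : R[i]^o -> R[i]^o)}) ->
  cintegrable mu setT (fun y => F (circle_val y)).
Proof.
move=> cF; have [M hM] := circle_bounded cF.
have bnd (u : R[i] -> R) : (forall z, `|u z| <= normc z) -> continuous (u : R[i]^o -> R) ->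
    mu.-integrable setT (EFin \o (fun y => u (F (circle_val y)))).
  move=> hu cu; apply: measurable_bounded_integrable => //.
  - by apply: le_lt_trans (ltry 1); exact: probability_le1.
  - apply: (@measurable_circle_fun R (u \o F)) => x x1.
    by apply: (@continuous_comp _ _ _ (F : R[i]^o -> R[i]^o)); [exact: cF|exact: cu].
  exists M; split; first exact: num_real.
  move=> K hK x _ /=; apply: ltW; apply: le_lt_trans hK; apply: (le_trans (hu _)).
  by apply: hM; exact: normc_circle_val.
split; apply: bnd; [exact: Re_le_normc|exact: Re_continuous|exact: Im_le_normc|exact: Im_continuous].
Qed.

Lemma Rintegral_uniform01 (f : R -> R) (M : R) : measurable_fun setT f ->
  (forall x, `|f x| <= M) ->
  \int[uniform_prob (@ltr01 R)]_x f x = \int[lmu]_(x in `[0, 1]) f x.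
Proof.
move=> mf hM; set P := uniform_prob _.
have M0 : 0 <= M by exact: le_trans (hM 0).
have bf : [bounded f x | x in setT].
  exists M; split; first exact: num_real.
  by move=> K hK x _ /=; apply: ltW; apply: le_lt_trans hK.
have iP (g : R -> R) : measurable_fun setT g -> [bounded g x | x in setT] ->
    P.-integrable setT (EFin \o g).
  by move=> mg bg; apply: measurable_bounded_integrable => //; apply: le_lt_trans (ltry 1); exact: probability_le1.
have iL : lmu.-integrable `[0, 1] (EFin \o f).
  apply: measurable_bounded_integrable => //.
  - exact: lebesgue_itv_fin.
  - exact: measurable_funTS.
  exists M; split; first exact: num_real.
  by move=> K hK x _ /=; apply: ltW; apply: le_lt_trans hK.
have iM : lmu.-integrable `[0, 1] (EFin \o (fun=> M)).
  by apply: continuous_integrable => x _; exact: cvg_cst.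
have iPM : P.-integrable setT (EFin \o (fun=> M)).
  by apply: iP => //; exact: bounded_cst.
have := @integral_uniform R 0 1 ltr01 (fun x => (f x + M)%:E).
move=> /(_ _ _) h.
have {}h : \int[P]_x (f x + M) = \int[lmu]_(x in `[0, 1]) (f x + M).
  rewrite /Rintegral h.
  - by rewrite subr0 invr1 mul1e.
  - by apply/measurable_EFinP; apply: measurable_funD.
  - by move=> x; rewrite lee_fin; have := hM x; rewrite ler_norml => /andP[]; lra.
move: h; rewrite !RintegralD//; last exact: iP.
rewrite !Rintegral_cst// fine_lebesgue_itv ?ler01// subr0.
set p := fine _; have -> : p = 1 by exact: (congr1 fine (probability_setT P)).
by move=> /addIr.
Qed.

Lemma expi_lipschitz s t : normc (expi s - expi t) <= 2 * `|s - t|.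
Proof.
have lip (f f' : R -> R) : (forall x : R, is_derive x 1 f (f' x)) -> (forall x, `|f' x| <= 1) ->
    `|f s - f t| <= `|s - t|.
  move=> df f1; wlog st : s t / t <= s.
    by move=> h; have [/h//|/ltW/h] := leP t s; rewrite distrC (distrC t).
  have cf : {within `[t, s], continuous f}.
    apply: continuous_subspaceT => x; apply: differentiable_continuous.
    by apply/derivable1_diffP; have [] := df x.
  have [c _ ->] := MVT_segment st (fun x _ => df x) cf.
  by rewrite normrM ler_piMl.
apply: (le_trans (normc_le_ReIm _)); rewrite mulrDl mul1r; apply: lerD => /=.
  by apply: (lip _ (fun x => - sin x)) => x; rewrite normrN ler_norml sin_geN1 sin_le1.
by apply: (lip _ cos) => x; rewrite ler_norml cos_geN1 cos_le1.
Qed.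

Lemma normc_one_sub_ge x z : normc x = 1 -> 1 - normc z <= normc (1 - x * z).
Proof.
move=> x1; have := ler_normcD (1 - x * z) (x * z).
by rewrite subrK normc1 normcM x1 mul1r; lra.
Qed.

Lemma one_sub_mul_neq0 x z : normc x = 1 -> normc z < 1 -> 1 - x * z != 0.
Proof.
by move=> x1 z1; rewrite -normc_gt0; apply: lt_le_trans (normc_one_sub_ge z x1); rewrite subr_gt0.
Qed.

Definition herglotz_kernel z x : R[i] := (1 + x * z) / (1 - x * z).

Lemma cderivable_herglotz_kernel x z : normc x = 1 -> normc z < 1 -> cderivable (herglotz_kernel z) x.
Proof.
move=> x1 z1; apply: (@cderivable_div _ (fun x => 1 + x * z) (fun x => 1 - x * z)).
- exact: one_sub_mul_neq0 z1.
- exact: (cderivableD (cderivable_cst 1 _) (cderivableM (cderivable_id _) (cderivable_cst z _))).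
- exact: (cderivableB (cderivable_cst 1 _) (cderivableM (cderivable_id _) (cderivable_cst z _))).
Qed.

(** The denominators are bounded below by 1 - |z|. *)
Lemma herglotz_kernel_lipschitz z s t : normc z < 1 ->
  normc (herglotz_kernel z (expi (- s)) - herglotz_kernel z (expi (- t))) <=
  4 / (1 - normc z) ^+ 2 * `|s - t|.
Proof.
move=> z1; have ds := one_sub_mul_neq0 (normc_expi (- s)) z1; have dt := one_sub_mul_neq0 (normc_expi (- t)) z1.
have -> : herglotz_kernel z (expi (- s)) - herglotz_kernel z (expi (- t)) =
    2 * z * (expi (- s) - expi (- t)) * ((1 - expi (- s) * z)^-1 * (1 - expi (- t) * z)^-1).
  by rewrite /herglotz_kernel; field; rewrite ds dt.
have d0 : 0 < 1 - normc z by rewrite subr_gt0.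
have dle u : (normc (1 - expi (- u) * z))^-1 <= (1 - normc z)^-1.
  by rewrite lef_pV2 ?posrE// ?normc_one_sub_ge ?normc_expi// (lt_le_trans d0)// normc_one_sub_ge ?normc_expi.
rewrite !normcM !normcV.
have n2 : normc (2 : R[i]) = 2 by rewrite -[2 in LHS](rmorph_nat (real_complex R)) normc_real ger0_norm.
rewrite n2.
have hE : normc (expi (- s) - expi (- t)) <= 2 * `|s - t|.
  by have := expi_lipschitz (- s) (- t); rewrite -opprD normrN.
have -> : 4 / (1 - normc z) ^+ 2 * `|s - t| =
    2 * 1 * (2 * `|s - t|) * ((1 - normc z)^-1 * (1 - normc z)^-1).
  by field; rewrite gt_eqF.
have v0 (w : R[i]) : 0 <= (normc w)^-1 by rewrite invr_ge0 normc_ge0.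
apply: ler_pM; rewrite ?mulr_ge0 ?normc_ge0 ?v0//.
  by apply: ler_pM; rewrite ?mulr_ge0 ?normc_ge0// ler_wpM2l// ltW.
by apply: ler_pM; rewrite ?v0 ?dle.
Qed.

Lemma cvg_radii : (fun m => 1 - m.+2%:R^-1 : R) @ \oo --> (1 : R).
Proof.
rewrite -[X in _ --> X]subr0; apply: cvgB; first exact: cvg_cst.
by rewrite (cvg_shiftS (@harmonic R)); exact: cvg_harmonic.
Qed.

(** The Schwarz formula at radius 1 - 1 / (m + 2) represents q(r z) by a
    probability density on [0, 2 pi]. Its quantile functions are passed to the
    limit against the real and imaginary parts of the kernel, which are
    Lipschitz in the angle. *)
Theorem herglotz (q : R[i] -> R[i]) : (forall z, normc z < 1 -> cderivable q z) -> q 0 = 1 ->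
  (forall z, normc z < 1 -> 0 < Re (q z)) ->
  exists mu : probability (borel_circle R) R, forall z, normc z < 1 ->
    q z = cintegral mu setT (fun y => herglotz_kernel z (circle_val y)).
Proof.
move=> hq q0 qpos; have pi0 := pi_gt0 R.
have T0 : 0 <= 2 * pi :> R := twopi_ge0.
pose r m : R := 1 - m.+2%:R^-1.
have r01 m : 0 < r m < 1.
  rewrite subr_gt0 gtrBl invr_gt0 ltr0n andbT /=.
  by rewrite invf_lt1 ?ltr0n// ltr1n.
pose u m t := Re (q ((r m)%:C * expi t)) / (2 * pi).
have nr m t : normc ((r m)%:C * expi t) < 1.
  by rewrite normc_polar; have /andP[h1 h2] := r01 m; rewrite gtr0_norm.
have cu m : {in `[0, 2 * pi], continuous (u m)}.
  move=> t _; apply: cvgM; last exact: cvg_cst.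
  apply: (@continuous_comp _ _ _ (fun t => q ((r m)%:C * expi t) : R[i]^o)); last exact: Re_continuous.
  apply: (@continuous_comp _ _ _ (fun t => (r m)%:C * expi t : R[i]^o)).
    exact: polar_continuous.
  by apply: derivable_continuous_at; exact: hq.
have u0 m t : 0 <= t <= 2 * pi -> 0 <= u m t.
  by move=> _; rewrite divr_ge0// ltW// qpos.
have kernel_int m z : normc z < 1 ->
    cint 0 (2 * pi) (fun t => (u m t)%:C * herglotz_kernel z (expi (- t))) = q ((r m)%:C * z).
  move=> z1; have pi2 : (2 * pi : R)%:C != 0.
    by rewrite eq_complex /= eqxx andbT mulf_neq0// gt_eqF.
  apply: (mulIf pi2); rewrite -(schwarz hq q0 (r01 m) z1) mulrC /cint -cintegralZ//.
    apply: eq_cintegral => t _; rewrite /u /herglotz_kernel mulrA -rmorphM /=.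
    by rewrite [X in X%:C]mulrC divfK// mulf_neq0// gt_eqF.
  apply: ccontinuous_on_integrable => t ht.
  apply: (@cvgM R[i]^o _ _ _ (fun t => (u m t)%:C : R[i]^o)).
    apply: (@continuous_comp _ _ _ (u m) ((fun x => x%:C) : R -> R[i]^o)); first exact: cu.
    exact: real_complex_continuous.
  apply: (@continuous_comp _ _ _ (fun t => expi (- t) : R[i]^o)).
    apply: (@continuous_comp _ _ _ (fun t : R => - t)); first exact: opp_continuous.
    exact: expi_continuous.
  by apply/derivable_continuous_at/cderivable_herglotz_kernel => //; exact: normc_expi.
have u1 m : \int[lmu]_(x in `[0, 2 * pi]) u m x = 1.
  have := kernel_int m 0; rewrite normc0 => /(_ ltr01) /(congr1 Re).
  rewrite mulr0 q0 => h; transitivity (Re (1 : R[i])) => //; rewrite -h.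
  apply: eq_Rintegral => t _.
  by rewrite /herglotz_kernel mulr0 addr0 subr0 divr1 mulr1.
have [Q [Qhomo QT] hQ] := helly_quantile T0 cu u0 u1.
pose X (s : measurableTypeR R) : borel_circle R := circle_point (- Q s).
have mX : @measurable_fun _ _ (measurableTypeR R) (borel_circle R) setT X.
  apply: (measurableT_comp (@measurable_circle_point R)).
  by apply: measurableT_comp => //; exact: nondecreasing_measurable.
exists (distribution (uniform_prob (@ltr01 R)) (mfun_Sub (mem_set mX : X \in mfun))) => z z1.
have key (P : R[i] -> R) : (forall z w, P z - P w = P (z - w)) ->
    (forall z, `|P z| <= normc z) -> continuous (P : R[i]^o -> R) ->
    (forall (a : R) w, P (a%:C * w) = a * P w) ->
    (forall f, P (cint 0 (2 * pi) f) = \int[lmu]_(t in `[0, 2 * pi]) P (f t)) ->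
    \int[distribution (uniform_prob (@ltr01 R)) (mfun_Sub (mem_set mX : X \in mfun))]_y
      P (herglotz_kernel z (circle_val y)) = P (q z).
  move=> PB Ple Pc PZ Pint.
  pose phi t := P (herglotz_kernel z (expi (- t))).
  rewrite -(hQ phi (4 / (1 - normc z) ^+ 2) (P (q z))).
  - have cK x : normc x = 1 -> {for x, continuous ((P \o herglotz_kernel z) : R[i]^o -> R)}.
      move=> x1; apply: (@continuous_comp _ _ _ (herglotz_kernel z : R[i]^o -> R[i]^o)); last exact: Pc.
      exact/derivable_continuous_at/cderivable_herglotz_kernel.
    have [M hM] : exists M, forall x, normc x = 1 -> normc (herglotz_kernel z x) <= M.
      by apply: circle_bounded => x x1; exact/derivable_continuous_at/cderivable_herglotz_kernel.
    have phiM s : `|phi (Q s)| <= M.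
      by apply: (le_trans (Ple _)); apply: hM; exact: normc_expi.
    have mP := measurable_circle_fun cK.
    have mphi : @measurable_fun _ _ (measurableTypeR R) _ setT (phi \o Q).
      exact: (measurableT_comp mP mX).
    rewrite -(Rintegral_uniform01 mphi phiM) /Rintegral integral_distribution//.
      by apply/measurable_EFinP.
    apply: measurable_bounded_integrable => //.
      by apply: le_lt_trans (ltry 1); exact: probability_le1.
    exists M; split; first exact: num_real.
    by move=> K hK s _ /=; apply: ltW; apply: le_lt_trans hK; exact: phiM.
  - move=> s t; rewrite /phi PB; apply: (le_trans (Ple _)).
    exact: herglotz_kernel_lipschitz.
  - have -> : (fun m => \int[lmu]_(x in `[0, 2 * pi]) (phi x * u m x)) = (fun m => P (q ((r m)%:C * z))).
      apply/funext => m; rewrite -kernel_int// Pint; apply: eq_Rintegral => t _.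
      by rewrite PZ mulrC.
    have rz : (fun m => (r m)%:C * z : R[i]^o) @ \oo --> (z : R[i]^o).
      rewrite -[X in _ --> X]mul1r; apply: (@cvgM R[i]); last exact: cvg_cst.
      exact: (cvg_comp _ _ cvg_radii (@real_complex_continuous R 1)).
    have qz := cvg_comp _ _ rz (derivable_continuous_at (hq z z1)).
    exact: (cvg_comp _ _ qz (Pc (q z))).
apply/eqP; rewrite eq_complex; apply/andP; split; apply/eqP; symmetry.
  apply: key => //; first by move=> ? ?; rewrite raddfB.
  - exact: Re_le_normc.
  - exact: Re_continuous.
  - by move=> a w; rewrite ReM /= oppr0 mul0r addr0.
apply: key => //; first by move=> ? ?; rewrite raddfB.
- exact: Im_le_normc.
- exact: Im_continuous.
- by move=> a w; rewrite ImM /= mul0r add0r.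
Qed.
End Herglotz.

(** * Power series and convolution *)

Section PowerSeries.
Context {R : realType}.
Implicit Types (z w x : R[i]) (f g : R[i] -> R[i]) (a b : nat -> R[i]).

Definition partial_sum a z n : R[i] := \sum_(k < n) a k * z ^+ k.

Lemma series_partial_sum a z : series (fun n => a n * z ^+ n) = partial_sum a z.
Proof. by apply/funext => n; rewrite /series /partial_sum /= big_mkord. Qed.

Lemma partial_sumS a z n : partial_sum a z n.+1 = partial_sum a z n + a n * z ^+ n.
Proof. by rewrite /partial_sum big_ord_recr. Qed.

Lemma cvgcnP (u : nat -> R[i]) (l : R[i]) :
  (u : nat -> R[i]^o) @ \oo --> (l : R[i]^o) <->
  (forall e : R, 0 < e -> exists N, forall n, (N <= n)%N -> normc (l - u n) < e).
Proof.
split=> [/cvgcP h e /h [N _ hN]|h]; first by exists N => n Nn; exact: hN.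
by apply/cvgcP => e /h[N hN]; exists N.
Qed.

Lemma has_power_seriesP f a : has_power_series f a <-> forall z, normc z < 1 -> forall e : R, 0 < e ->
  exists N, forall n, (N <= n)%N -> normc (f z - partial_sum a z n) < e.
Proof.
split=> h z; first by rewrite -discE => /h; rewrite series_partial_sum => /cvgcnP.
by rewrite discE series_partial_sum => z1; apply/cvgcnP; exact: h.
Qed.

Lemma has_power_series_ext f g a : (forall z, normc z < 1 -> f z = g z) ->
  has_power_series f a -> has_power_series g a.
Proof. by move=> fg /has_power_seriesP h; apply/has_power_seriesP => z z1; rewrite -fg//; exact: h. Qed.

Lemma power_series_coef0 f a : has_power_series f a -> a 0%N = f 0.
Proof.
move=> /has_power_seriesP/(_ 0); rewrite normc0 => /(_ ltr01) h.
apply/eqP; rewrite eq_sym -subr_eq0 -normc_eq0 eq_le normc_ge0 andbT leNgt; apply/negP => /h[N hN].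
have := hN N.+1 (leqnSn _); rewrite /partial_sum big_ord_recl expr0 mulr1 big1 ?addr0 ?ltxx// => i _.
by rewrite expr0n mulr0.
Qed.

Lemma power_series_coef_bound f a (rho : R) : has_power_series f a -> 0 <= rho < 1 ->
  exists2 M, 0 <= M & forall n, normc (a n) * rho ^+ n <= M.
Proof.
move=> /has_power_seriesP h /andP[r0 r1]; have nr : normc rho%:C = rho by rewrite normc_real ger0_norm.
have [|N hN] := h rho%:C _ 1 ltr01; first by rewrite nr.
have s0 k : 0 <= normc (a k) * rho ^+ k by rewrite mulr_ge0 ?normc_ge0 ?exprn_ge0.
(* late terms are differences of two remainders of modulus less than 1; the sum covers the early ones *)
exists (2 + \sum_(k < N) normc (a k) * rho ^+ k).
  by rewrite addr_ge0// sumr_ge0.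
move=> n; have [Nn|nN] := leqP N n.
  apply: (@le_trans _ _ 2); last by rewrite lerDl sumr_ge0.
  rewrite -{1}nr -normcX -normcM.
  have -> : a n * rho%:C ^+ n = (f rho%:C - partial_sum a rho%:C n) - (f rho%:C - partial_sum a rho%:C n.+1).
    by rewrite partial_sumS; ring.
  apply: (le_trans (ler_normcD _ _)); rewrite normcN.
  by have := hN n Nn; have := hN n.+1 (leqW Nn); lra.
rewrite (bigD1 (Ordinal nN)) //= addrCA lerDl addr_ge0// sumr_ge0//.
Qed.

(** The geometric tail, with the ratio kept explicit: the powers of |w| are
    needed for uniqueness, the ratio for uniform convergence. *)
Lemma power_series_tail f a (rho M : R) w n : has_power_series f a -> 0 < rho ->
  (forall n, normc (a n) * rho ^+ n <= M) -> normc w < rho -> normc w < 1 ->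
  normc (f w - partial_sum a w n) <= M * ((normc w / rho) ^+ n / (1 - normc w / rho)).
Proof.
move=> /has_power_seriesP h r0 hM wr w1; set q := normc w / rho.
have q0 : 0 <= q by rewrite divr_ge0 ?normc_ge0// ltW.
have q1 : q < 1 by rewrite ltr_pdivrMr// mul1r.
have d0 : 0 < 1 - q by rewrite subr_gt0.
have M0 : 0 <= M by apply: le_trans (hM 0%N); rewrite mulr_ge0 ?normc_ge0 ?exprn_ge0// ltW.
have diff m : normc (partial_sum a w (m + n)%N - partial_sum a w n) <= M * ((q ^+ n - q ^+ (m + n)%N) / (1 - q)).
  elim: m => [|m IH]; first by rewrite add0n !subrr mul0r mulr0 normc0.
  have -> : partial_sum a w (m.+1 + n)%N - partial_sum a w n =
     (partial_sum a w (m + n)%N - partial_sum a w n) + a (m + n)%N * w ^+ (m + n)%N.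
    by rewrite addSn partial_sumS; ring.
  apply: (le_trans (ler_normcD _ _)).
  have t : normc (a (m + n)%N * w ^+ (m + n)%N) <= M * q ^+ (m + n)%N.
    rewrite normcM normcX; have -> : normc w = rho * q by rewrite /q mulrC divfK// gt_eqF.
    by rewrite exprMn mulrA ler_wpM2r ?exprn_ge0.
  apply: (le_trans (lerD IH t)); rewrite addSn exprSr -mulrDr ler_wpM2l//.
  by rewrite le_eqVlt; apply/orP; left; apply/eqP; field; rewrite gt_eqF.
apply/ler_addgt0Pl => e e0; have [N hN] := h w w1 e e0.
have -> : f w - partial_sum a w n = (f w - partial_sum a w (N + n)%N) + (partial_sum a w (N + n)%N - partial_sum a w n) by ring.
apply: (le_trans (ler_normcD _ _)); apply: lerD; first by apply/ltW/hN; exact: leq_addr.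
apply: (le_trans (diff N)); rewrite ler_wpM2l// ler_pM2r ?invr_gt0// lerBlDr lerDl.
by rewrite exprn_ge0.
Qed.

Lemma power_series_uniform f a (rho : R) : has_power_series f a -> 0 <= rho < 1 ->
  exists C q : R, [/\ 0 <= C, 0 <= q < 1 &
    forall w n, normc w = rho -> normc (f w - partial_sum a w n) <= C * q ^+ n].
Proof.
move=> h /andP[r0 r1]; pose s := (1 + rho) / 2.
have s0 : 0 < s by rewrite /s; lra.
have s1 : s < 1 by rewrite /s; lra.
have rs : rho < s by rewrite /s; lra.
have [|M M0 hM] := @power_series_coef_bound f a s h; first by rewrite s1 ltW.
have q1 : rho / s < 1 by rewrite ltr_pdivrMr// mul1r.
(* the coefficient bound is taken on the larger circle of radius s *)
exists (M / (1 - rho / s)), (rho / s); split.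
- by rewrite divr_ge0// subr_ge0 ltW.
- by rewrite q1 divr_ge0// ltW.
move=> w n wr; have := @power_series_tail f a s M w n h s0 hM; rewrite wr => /(_ rs r1) /le_trans; apply.
by rewrite mulrA mulrAC.
Qed.

Lemma partial_sumB a b z n : partial_sum (fun k => a k - b k) z n = partial_sum a z n - partial_sum b z n.
Proof. by rewrite /partial_sum -sumrB; apply: eq_bigr => i _; rewrite mulrBl. Qed.

(** If the first n coefficients of a null series vanish, the tail estimate after
    n + 1 terms bounds the n-th coefficient by a multiple of |w|, for every
    small w. *)
Lemma power_series_uniq f a b : has_power_series f a -> has_power_series f b -> a = b.
Proof.
move=> ha hb; pose d k := a k - b k.
have hd : has_power_series (fun=> 0) d.
  apply/has_power_seriesP => z z1 e e0; have e2 : 0 < e / 2 by rewrite divr_gt0.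
  have [N1 h1] := (has_power_seriesP f a).1 ha z z1 _ e2; have [N2 h2] := (has_power_seriesP f b).1 hb z z1 _ e2.
  exists (maxn N1 N2) => n; rewrite geq_max => /andP[n1 n2].
  rewrite partial_sumB; have -> : 0 - (partial_sum a z n - partial_sum b z n) = (f z - partial_sum a z n) + - (f z - partial_sum b z n) by ring.
  apply: (le_lt_trans (ler_normcD _ _)); rewrite normcN [ltRHS]splitr.
  by rewrite ltrD ?h1 ?h2.
suff d0 n : d n = 0 by apply/funext => n; apply/eqP; rewrite -subr_eq0; apply/eqP; exact: d0.
have h12 : 0 <= (2^-1 : R) < 1 by apply/andP; split; lra.
have [M M0 hM] := power_series_coef_bound hd h12.
elim/ltn_ind: n => n IH; apply/eqP; rewrite -normc_eq0 eq_le normc_ge0 andbT.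
rewrite leNgt; apply/negP => dn0.
have K0 : 0 < 4 * (M * 2 ^+ n + 1) by rewrite mulr_gt0// ltr_wpDl// mulr_ge0// exprn_ge0.
pose r := Num.min (4^-1) (normc (d n) / (2 * (4 * (M * 2 ^+ n + 1)))).
have r0 : 0 < r by rewrite lt_min invr_gt0 ltr0n /= divr_gt0// mulr_gt0.
have r4 : r <= 4^-1 by rewrite ge_min lexx.
have rd : r <= normc (d n) / (2 * (4 * (M * 2 ^+ n + 1))) by rewrite ge_min lexx orbT.
have nr : normc r%:C = r by rewrite normc_real gtr0_norm.
have ps : partial_sum d r%:C n.+1 = d n * r%:C ^+ n.
  by rewrite partial_sumS /partial_sum big1 ?add0r// => i _; rewrite (IH i) ?mul0r.
have := @power_series_tail _ d 2^-1 M r%:C n.+1 hd _ hM; rewrite nr ps sub0r normcN normcM normcX nr invrK.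
have h2 : (0 : R) < 2^-1 by rewrite invr_gt0.
have rl2 : r < 2^-1 by lra.
have rl1 : r < 1 by lra.
move=> /(_ h2 rl2 rl1) key.
have rn0 : 0 < r ^+ n by rewrite exprn_gt0.
have p0 : 0 <= M * 2 ^+ n by rewrite mulr_ge0// exprn_ge0.
have {}key : normc (d n) * r ^+ n <= (4 * (M * 2 ^+ n) * r) * r ^+ n.
  apply: (le_trans key); rewrite exprMn !exprS.
  have -> : 4 * (M * 2 ^+ n) * r * r ^+ n = M * (r * r ^+ n * (2 * 2 ^+ n) * 2) by ring.
  rewrite ler_wpM2l//; apply: ler_wpM2l.
    by rewrite !mulr_ge0 ?exprn_ge0// ltW.
  by rewrite -[leRHS]invrK lef_pV2 ?posrE ?invr_gt0//; lra.
rewrite ler_pM2r// in key.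
have := ler_wpM2l (ltW K0) rd.
have -> : 4 * (M * 2 ^+ n + 1) * (normc (d n) / (2 * (4 * (M * 2 ^+ n + 1)))) = normc (d n) / 2.
  by field; rewrite gt_eqF// ltr_wpDl.
by nra.
Qed.

Lemma coefsE f a : has_power_series f a -> coefs f = a.
Proof.
move=> ha; apply: power_series_uniq (ha); rewrite /coefs.
by case: xgetP => [_ -> //|/(_ a)].
Qed.

Lemma coefs0 f : ~ (exists a, has_power_series f a) -> coefs f = fun=> 0.
Proof. by move=> h; rewrite /coefs; case: xgetP => // a _ ha; case: h; exists a. Qed.

(** A convolution is evaluated by exhibiting a function with the product
    coefficients. *)
Lemma convolutionE f g h a b z : has_power_series f a -> has_power_series g b ->
  has_power_series h (fun n => a n * b n) -> normc z < 1 -> convolution f g z = h z.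
Proof.
move=> ha hb hh z1; rewrite /convolution (coefsE ha) (coefsE hb).
by apply: (cvg_lim (T := R[i]^o)); [exact: norm_hausdorff|apply: hh; rewrite discE].
Qed.

(** Here all coefficients take their default value 0. Hence a function in the
    dual of a nonempty set has a power series. *)
Lemma convolution_no_series f g z : ~ (exists b, has_power_series g b) ->
  convolution f g z = 0.
Proof.
move=> /coefs0 g0; rewrite /convolution g0.
apply: (cvg_lim (T := R[i]^o)); first exact: norm_hausdorff.
rewrite (_ : series _ = fun=> 0); first exact: cvg_cst.
by apply/funext => n; rewrite /series /= big1// => i _; rewrite mulr0 mul0r.
Qed.

Lemma has_power_series_geometric : has_power_series (fun z => (1 - z)^-1) (fun=> 1).
Proof.
apply/has_power_seriesP => z z1 e e0.
have dz : 1 - z != 0.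
  by rewrite subr_eq0; apply/eqP => h; move: z1; rewrite -h normc1 ltxx.
have p n : partial_sum (fun=> 1) z n = (1 - z ^+ n) / (1 - z).
  elim: n => [|n IH]; first by rewrite /partial_sum big_ord0 expr0 subrr mul0r.
  by rewrite partial_sumS IH exprS; field; rewrite dz.
have nd : 0 < normc (1 - z) by rewrite normc_gt0.
have : (fun n => normc z ^+ n) @ \oo --> (0 : R).
  by apply: cvg_expr; rewrite ger0_norm ?normc_ge0.
move=> /cvgrPdist_lt /(_ (e * normc (1 - z)) (mulr_gt0 e0 nd)) [N _ hN].
exists N => n Nn; have := hN n Nn; rewrite sub0r normrN ger0_norm ?exprn_ge0 ?normc_ge0// => h.
have -> : (1 - z)^-1 - partial_sum (fun=> 1) z n = z ^+ n / (1 - z) by rewrite p; field; rewrite dz.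
by rewrite normcM normcV normcX ltr_pdivrMr.
Qed.

Lemma has_power_seriesD f g a b : has_power_series f a -> has_power_series g b ->
  has_power_series (fun z => f z + g z) (fun n => a n + b n).
Proof.
move=> /has_power_seriesP ha /has_power_seriesP hb; apply/has_power_seriesP => z z1 e e0; have e2 : 0 < e / 2 by rewrite divr_gt0.
have [N1 h1] := ha z z1 _ e2; have [N2 h2] := hb z z1 _ e2.
exists (maxn N1 N2) => n; rewrite geq_max => /andP[n1 n2].
have -> : partial_sum (fun n => a n + b n) z n = partial_sum a z n + partial_sum b z n.
  by rewrite /partial_sum -big_split; apply: eq_bigr => i _; rewrite mulrDl.
have -> : f z + g z - (partial_sum a z n + partial_sum b z n) = (f z - partial_sum a z n) + (g z - partial_sum b z n) by ring.
apply: (le_lt_trans (ler_normcD _ _)); rewrite [ltRHS]splitr.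
by rewrite ltrD ?h1 ?h2.
Qed.

Lemma has_power_seriesZ f a c : has_power_series f a ->
  has_power_series (fun z => c * f z) (fun n => c * a n).
Proof.
move=> /has_power_seriesP ha; apply/has_power_seriesP => z z1 e e0; have K0 : 0 < normc c + 1 by rewrite ltr_wpDl ?normc_ge0.
have [N hN] := ha z z1 (e / (normc c + 1)) (divr_gt0 e0 K0).
exists N => n /hN; rewrite ltr_pdivlMr// => h.
have -> : partial_sum (fun n => c * a n) z n = c * partial_sum a z n.
  by rewrite /partial_sum big_distrr; apply: eq_bigr => i _; rewrite /= mulrA.
rewrite -mulrBr normcM; apply: le_lt_trans h; rewrite mulrC ler_wpM2l ?normc_ge0//.
by rewrite lerDl.
Qed.

Lemma has_power_series_cst c : has_power_series (fun _ : R[i] => c) (fun n : nat => if n == 0%N then c else 0).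
Proof.
apply/has_power_seriesP => z z1 e e0; exists 1%N => -[//|n] _.
rewrite /partial_sum big_ord_recl /= expr0 mulr1 big1 ?addr0 ?subrr ?normc0// => i _.
by rewrite mul0r.
Qed.

Lemma has_power_series_rotate f a x : normc x = 1 -> has_power_series f a ->
  has_power_series (fun z => f (x * z)) (fun n => a n * x ^+ n).
Proof.
move=> x1 /has_power_seriesP ha; apply/has_power_seriesP => z z1 e e0.
have [|N hN] := ha (x * z) _ e e0; first by rewrite normcM x1 mul1r.
exists N => n /hN; congr (normc (_ - _) < _).
by rewrite /partial_sum; apply: eq_bigr => i _; rewrite exprMn mulrA.
Qed.

(** For f(z) = 1 / (1 - z) this gives both p_lam and the members of V_lam. *)
Definition tilt (k : R[i]) f z : R[i] := 1 + k * (f z - f 0).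
Definition tilt_coef (k : R[i]) n : R[i] := if n == 0%N then 1 else k.

(** The coefficients are multiplied by those of tilt k (1 / (1 - z)), so this is
    convolution with that function. *)
Lemma has_power_series_tilt k f a : has_power_series f a -> f 0 = 1 ->
  has_power_series (tilt k f) (fun n => tilt_coef k n * a n).
Proof.
move=> ha f0; have := has_power_seriesD (@has_power_series_cst (1 - k * f 0)) (@has_power_seriesZ f a k ha).
rewrite (_ : (fun n => _) = (fun n => tilt_coef k n * a n)); last first.
  apply/funext => -[|n] /=; rewrite /tilt_coef /= ?add0r//.
  by rewrite (power_series_coef0 ha) f0; ring.
by apply: has_power_series_ext => z _; rewrite /tilt; ring.
Qed.
End PowerSeries.

(** * Arcs without chords through the origin *)

Section HalfPlane.
Context {R : realType}.
Implicit Types (s t : R) (z w : R[i]).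

(** The real scalar product of the plane. *)
Definition dotc z w : R := Re (z * w^*%C).

Lemma dotcE (a b c d : R) : dotc (a +i* b) (c +i* d) = a * c + b * d.
Proof. by rewrite /dotc /=; ring. Qed.
Lemma dotcC z w : dotc z w = dotc w z.
Proof. by case: z w => a b [c d]; rewrite !dotcE; ring. Qed.
Lemma dotcDr z w w' : dotc z (w + w') = dotc z w + dotc z w'.
Proof. by case: z w w' => a b [c d] [e f]; rewrite !dotcE; ring. Qed.
Lemma dotcZl (a : R) z w : dotc (a%:C * z) w = a * dotc z w.
Proof. by case: z w => b c [d e]; rewrite /dotc /=; ring. Qed.
Lemma dotcc z : dotc z z = normc z ^+ 2.
Proof. by case: z => a b; rewrite dotcE normc_sqrt sqr_sqrtr ?addr_ge0 ?sqr_ge0// !expr2. Qed.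

(** If A and B are at the widest angle 2 phi < pi, a unit vector u orthogonal to
    the bisector makes the angle pi / 2 + phi with one of them, which is wider.
    *)
Lemma unit_minimal_not_orthogonal (A B u : R[i]) : normc A = 1 -> normc B = 1 -> normc u = 1 ->
  A + B != 0 -> dotc A B <= dotc u A -> dotc A B <= dotc u B -> dotc u (A + B) = 0 -> False.
Proof.
move=> nA nB nu AB0; set m := dotc A B => hA hB hu.
have hAA : dotc A A = 1 by rewrite dotcc nA expr1n.
have hBB : dotc B B = 1 by rewrite dotcc nB expr1n.
have huu : dotc u u = 1 by rewrite dotcc nu expr1n.
have m1 : 0 < 1 + m.
  have : 0 < dotc (A + B) (A + B) by rewrite dotcc exprn_gt0// normc_gt0.
  rewrite dotcDr dotcC dotcDr hAA (dotcC (A + B) B) dotcDr hBB (dotcC B A) -/m; lra.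
pose d := dotc u A.
have hd : dotc u B = - d by move: hu; rewrite dotcDr -/d; lra.
have id4 : 4 * d ^+ 2 = 2 - 2 * m.
  move: hAA hBB huu hu m1; rewrite /d /m dotcDr.
  case: (A) (B) (u) => a1 a2 [b1 b2] [u1 u2]; rewrite !dotcE => hAA hBB huu hu m1.
  (* u and A - B are both orthogonal to A + B, hence parallel *)
  have cross : u1 * (a2 - b2) - u2 * (a1 - b1) = 0.
    have nz : 2 * (1 + (a1 * b1 + a2 * b2)) != 0 by rewrite mulf_neq0// gt_eqF.
    apply: (mulIf nz); rewrite mul0r.
    have -> : (u1 * (a2 - b2) - u2 * (a1 - b1)) * (2 * (1 + (a1 * b1 + a2 * b2))) =
       (u1 * a1 + u2 * a2 + (u1 * b1 + u2 * b2)) * ((a1 + b1) * (a2 - b2) - (a2 + b2) * (a1 - b1)) +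
       (u1 * (a2 + b2) - u2 * (a1 + b1)) * ((a1 * a1 + a2 * a2) - (b1 * b1 + b2 * b2)) +
       (u1 * (a2 - b2) - u2 * (a1 - b1)) *
        ((1 - (a1 * a1 + a2 * a2)) + (1 - (b1 * b1 + b2 * b2))) by ring.
    by rewrite hu hAA hBB; ring.
  have -> : 4 * (u1 * a1 + u2 * a2) ^+ 2 =
    (u1 * u1 + u2 * u2) * ((a1 * a1 + a2 * a2) + (b1 * b1 + b2 * b2) - 2 * (a1 * b1 + a2 * b2))
    - (u1 * (a2 - b2) - u2 * (a1 - b1)) ^+ 2
    + (u1 * a1 + u2 * a2 + (u1 * b1 + u2 * b2)) *
      (3 * (u1 * a1 + u2 * a2) - (u1 * b1 + u2 * b2)) by ring.
  by rewrite huu hAA hBB cross hu; ring.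
have md : m <= d by []; have md' : m <= - d by rewrite -hd.
nra.
Qed.

(** That chords avoid 0 means that no two directions are antipodal. Take the
    pair of directions at the widest angle; a value outside the open half-plane
    around their bisector would, by connectedness, give a direction orthogonal
    to the bisector, hence a wider pair. *)
Lemma half_plane (g : R -> R[i]) (a b : R) : a <= b ->
  {in `[a, b], continuous (g : R -> R[i]^o)} ->
  (forall s t tau, a <= s <= b -> a <= t <= b -> 0 <= tau <= 1 ->
     tau%:C * g s + (1 - tau)%:C * g t != 0) ->
  exists c, forall t, a <= t <= b -> 0 < Re (g t * c).
Proof.
move=> ab cg hg.
have g0 t : a <= t <= b -> g t != 0.
  move=> ht; have := hg t t 1 ht ht; rewrite subrr ler01 lexx mul1r mul0r addr0; exact.
pose u t := ((normc (g t))^-1)%:C * g t.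
have nu t : a <= t <= b -> normc (u t) = 1.
  move=> /g0; rewrite -normc_gt0 => gt0; rewrite normcM normc_real ger0_norm ?invr_ge0 ?normc_ge0//.
  by rewrite mulVf// gt_eqF.
have antipodal s t : a <= s <= b -> a <= t <= b -> u s + u t != 0.
  move=> hs ht; have := g0 s hs; have := g0 t ht; rewrite -!normc_gt0 => pt ps.
  (* for antipodal directions this convex combination is 0 *)
  pose tau := normc (g t) / (normc (g s) + normc (g t)).
  have p : 0 < normc (g s) + normc (g t) by rewrite addr_gt0.
  have := hg s t tau hs ht; rewrite /tau ler_pdivrMr// mul1r lerDr normc_ge0 divr_ge0 ?normc_ge0 ?(ltW p)// => /(_ isT).
  rewrite normc_gt0; apply: contra_neq => uu.
  have k0 : (normc (g s) * normc (g t) / (normc (g s) + normc (g t)))%:C * (u s + u t) = 0.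
    by rewrite uu mulr0.
  rewrite -[RHS]k0 /u mulrDr !mulrA -!rmorphM /=.
  congr (_%:C * _ + _%:C * _); field; rewrite !gt_eqF//.
have cu t : a <= t <= b -> {for t, continuous (u : R -> R[i]^o)}.
  move=> ht; have cgt : {for t, continuous (g : R -> R[i]^o)} by apply: cg; rewrite in_itv.
  apply: (@cvgM R[i] _ _ _ (fun t => ((normc (g t))^-1)%:C)); last exact: cgt.
  apply: (@continuous_comp _ _ _ (fun t => (normc (g t))^-1) ((fun x => x%:C) : R -> R[i]^o)).
    by apply: cvgV; [rewrite gt_eqF// normc_gt0 g0|exact: cvg_normc].
  exact: real_complex_continuous.
pose F (p : R * R) := dotc (u p.1) (u p.2).
have cA : compact (`[a, b]%classic `*` `[a, b]%classic : set (R * R)).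
  by apply: compact_setX; exact: segment_compact.
have cF : {within `[a, b]%classic `*` `[a, b]%classic, continuous F}.
  apply: continuous_in_subspaceT => -[s t]; rewrite inE => -[/= + +].
  rewrite !in_itv /= => hs ht.
  apply: (@continuous_comp _ _ _ (fun p : R * R => u p.1 * (u p.2)^*%C : R[i]^o)); last exact: Re_continuous.
  apply: (@cvgM R[i]).
    by apply: (@continuous_comp _ _ _ fst (u : R -> R[i]^o)); [exact: cvg_fst|exact: cu].
  apply: (@continuous_comp _ _ _ (fun p : R * R => u p.2 : R[i]^o) (@conjc R : R[i]^o -> R[i]^o)).
    by apply: (@continuous_comp _ _ _ snd (u : R -> R[i]^o)); [exact: cvg_snd|exact: cu].
  apply/ccontinuousP => e e0; exists e => // w.
  by rewrite -conjcB normcJ.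
have [|[s0 t0]] := @compact_EVT_min _ _ F _ _ cA cF.
  by exists (a, a); split; rewrite /= in_itv /= lexx ab.
rewrite inE => -[/= + +]; rewrite !in_itv /= => hs0 ht0 hmin.
have {}hmin s t : a <= s <= b -> a <= t <= b -> dotc (u s0) (u t0) <= dotc (u s) (u t).
  by move=> hs ht; apply: (hmin (s, t)); rewrite inE; split; rewrite /= in_itv.
pose c := u s0 + u t0.
have c0 : c != 0 by exact: antipodal.
pose h t := dotc (u t) c.
have ch : {in `[a, b], continuous h}.
  move=> t; rewrite in_itv => ht.
  apply: (@continuous_comp _ _ _ (fun t => u t * c^*%C : R[i]^o)); last exact: Re_continuous.
  by apply: (@cvgM R[i]); [exact: cu|exact: cvg_cst].
have hneq t : a <= t <= b -> h t != 0.
  move=> ht; apply/eqP; apply: (unit_minimal_not_orthogonal (nu _ hs0) (nu _ ht0) (nu _ ht) c0).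
    by rewrite hmin.
  by rewrite hmin.
have hs0_gt0 : 0 < h s0.
  have cc : dotc c c = 2 * h s0.
    rewrite /h {1}/c dotcC dotcDr (dotcC c) (dotcC c) /c !dotcDr !dotcc !nu// (dotcC (u t0)); ring.
  have : 0 < dotc c c by rewrite dotcc exprn_gt0// normc_gt0.
  by rewrite cc pmulr_rgt0.
have hpos t : a <= t <= b -> 0 < h t.
  move=> ht; rewrite ltNge; apply/negP => hle.
  have seg x y : a <= x <= b -> a <= y <= b -> x <= y ->
      {within `[x, y], continuous h}.
    move=> /andP[x1 x2] /andP[y1 y2] xy; apply: continuous_in_subspaceT => r; rewrite inE /= in_itv /= => /andP[r1 r2].
    by apply: ch; rewrite in_itv /= (le_trans x1 r1) (le_trans r2 y2).
  have absurd x y : a <= x <= b -> a <= y <= b -> x <= y ->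
      Num.min (h x) (h y) <= 0 <= Num.max (h x) (h y) -> False.
    move=> hx hy xy hv; have [r] := IVT xy (seg x y hx hy xy) hv.
    rewrite in_itv /= => /andP[r1 r2] hr; move/eqP: hr; apply/negP/hneq.
    by case/andP: hx => hx _; case/andP: hy => _ hy; rewrite (le_trans hx r1) (le_trans r2 hy).
  have [tl|/ltW tl] := leP t s0.
    by apply: (absurd t s0) => //; rewrite ge_min hle le_max (ltW hs0_gt0) orbT.
  by apply: (absurd s0 t) => //; rewrite ge_min hle le_max (ltW hs0_gt0) orbT.
exists c^*%C => t ht; have gt0 : 0 < normc (g t) by rewrite normc_gt0 g0.
have -> : Re (g t * c^*%C) = normc (g t) * h t.
  rewrite -[LHS]/(dotc (g t) c) /h /u dotcZl mulrA divff ?mul1r//; by rewrite gt_eqF.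
by rewrite mulr_gt0// hpos.
Qed.
End HalfPlane.

(** * Moments of a measure on the circle *)

Section Moments.
Context {R : realType} (mu : probability (borel_circle R) R).
Implicit Types (z w : R[i]) (f : R[i] -> R[i]) (a : nat -> R[i]).

Definition moment n : R[i] := cintegral mu setT (fun y => circle_val y ^+ n).

Lemma fine_probability : fine (mu setT) = 1.
Proof. exact: (congr1 fine (probability_setT mu)). Qed.

Lemma circle_finite : (mu setT < +oo)%E.
Proof. by apply: le_lt_trans (ltry 1); exact: probability_le1. Qed.

Lemma cderivableX n z : cderivable (fun w => w ^+ n) z.
Proof.
elim: n => [|n IH]; first by exact: (cderivable_cst 1 z).
rewrite (_ : (fun w => w ^+ n.+1) = (fun w => w * w ^+ n)); last by apply/funext => w; rewrite exprS.
exact: (cderivableM (cderivable_id z) IH).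
Qed.

Lemma moment_integrable n : cintegrable mu setT (fun y => circle_val y ^+ n).
Proof.
by apply: (@circle_cintegrable _ mu (fun x => x ^+ n)) => x _; exact/derivable_continuous_at/cderivableX.
Qed.

Lemma partial_sum_moment a z n :
  cintegrable mu setT (fun y => partial_sum a (circle_val y * z) n) /\
  cintegral mu setT (fun y => partial_sum a (circle_val y * z) n) = partial_sum (fun k => a k * moment k) z n.
Proof.
have mT : measurable [set: borel_circle R] by exact: measurableT.
elim: n => [|n [IH1 IH2]].
  have e : (fun y : borel_circle R => partial_sum a (circle_val y * z) 0) = fun=> 0.
    by apply/funext => y; rewrite /partial_sum big_ord0.
  rewrite e; split; first exact: (cintegrable_cst 0 mT circle_finite).
  by rewrite cintegral_cst// mul0r /partial_sum big_ord0.
have e : (fun y : borel_circle R => partial_sum a (circle_val y * z) n.+1) =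
    (fun y => partial_sum a (circle_val y * z) n + (a n * z ^+ n) * circle_val y ^+ n).
  by apply/funext => y; rewrite partial_sumS exprMn; ring.
have i2 := cintegrableZ (a n * z ^+ n) mT (moment_integrable n).
rewrite e; split; first exact: cintegrableD.
rewrite cintegralD// IH2 cintegralZ//; last exact: moment_integrable.
by rewrite partial_sumS /moment; ring.
Qed.

(** The series converges uniformly on |w| = |z|, so it may be integrated term by
    term. For f = p_lam this gives the power series of p, and for f = tilt (1 +
    e) g the convolution of g with p. *)
Lemma has_power_series_moments f a : has_power_series f a ->
  (forall z, normc z < 1 -> {for z, continuous (f : R[i]^o -> R[i]^o)}) ->
  has_power_series (fun z => cintegral mu setT (fun y => f (circle_val y * z)))
    (fun n => a n * moment n).
Proof.
move=> hf cf; apply/has_power_seriesP => z z1 e e0.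
have mT : measurable [set: borel_circle R] by exact: measurableT.
have ifz : cintegrable mu setT (fun y => f (circle_val y * z)).
  apply: (@circle_cintegrable _ mu (fun x => f (x * z))) => x x1.
  apply: (@continuous_comp _ _ _ (fun x : R[i]^o => x * z : R[i]^o) (f : R[i]^o -> R[i]^o)).
    exact: derivable_continuous_at (cderivableM (cderivable_id x) (cderivable_cst z x)).
  by apply: cf; rewrite normcM x1 mul1r.
have [|C [q [C0 /andP[q0 q1] hC]]] := @power_series_uniform _ f a (normc z) hf.
  by rewrite normc_ge0.
have : (fun n => 2 * C * q ^+ n) @ \oo --> (2 * C * 0 : R).
  by apply: cvgM; [exact: cvg_cst|apply: cvg_expr; rewrite ger0_norm].
rewrite mulr0 => /cvgrPdist_lt /(_ e e0) [N _ hN]; exists N => n Nn.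
have [ip <-] := partial_sum_moment a z n.
rewrite -cintegralB//.
apply: (@le_lt_trans _ _ (2 * (C * q ^+ n * fine (mu setT)))).
  apply: normc_cintegral_le => //; first exact: circle_finite.
    exact: cintegrableB.
  by move=> y _; apply: hC; rewrite normcM normc_circle_val mul1r.
rewrite fine_probability mulr1 mulrA.
have := hN n Nn; rewrite sub0r normrN ger0_norm// mulr_ge0 ?exprn_ge0// mulr_ge0//.
Qed.

Lemma circle_integral_Re_ge f (d : R) :
  (forall x, normc x = 1 -> {for x, continuous (f : R[i]^o -> R[i]^o)}) ->
  (forall x, normc x = 1 -> d <= Re (f x)) ->
  d <= Re (cintegral mu setT (fun y => f (circle_val y))).
Proof.
move=> cf hd; rewrite -[d]mulr1 -fine_probability -(Rintegral_cst mu measurableT).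
have [i1 _] := circle_cintegrable mu cf.
apply: le_Rintegral => //.
  by have [] := @cintegrable_cst _ _ _ mu setT (d%:C) measurableT circle_finite.
by move=> y _; apply: hd; exact: normc_circle_val.
Qed.

(** By compactness Re (f c) has a positive minimum on the circle, which bounds
    the real part of c times the integral from below. *)
Lemma circle_integral_half_plane f c :
  (forall x, normc x = 1 -> {for x, continuous (f : R[i]^o -> R[i]^o)}) ->
  (forall x, normc x = 1 -> 0 < Re (f x * c)) ->
  cintegral mu setT (fun y => f (circle_val y)) != 0.
Proof.
move=> cf hf; have pi0 := pi_ge0 R.
have cfc x : normc x = 1 -> {for x, continuous ((fun x => c * f x) : R[i]^o -> R[i]^o)}.
  by move=> x1; exact: (@cvgM R[i] R[i]^o (nbhs (x : R[i]^o)) _ (fun=> c) f c (f x) (cvg_cst _) (cf x x1)).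
have [||t _ ht] := @EVT_min R (fun t => Re (c * f (expi t))) (- pi) pi.
- lra.
- apply: continuous_in_subspaceT => t _.
  apply: (@continuous_comp _ _ _ (fun t => c * f (expi t) : R[i]^o)); last exact: Re_continuous.
  apply: (@continuous_comp _ _ _ (@expi R : R -> R[i]^o) ((fun x => c * f x) : R[i]^o -> R[i]^o)); first exact: expi_continuous.
  by apply: cfc; exact: normc_expi.
have d0 : 0 < Re (c * f (expi t)) by rewrite mulrC; apply: hf; exact: normc_expi.
have : 0 < Re (cintegral mu setT (fun y => c * f (circle_val y))).
  apply: (lt_le_trans d0); apply: (circle_integral_Re_ge cfc) => x /expi_surj[s hs ->].
  by apply: ht; rewrite in_itv.
rewrite cintegralZ//; last exact: circle_cintegrable.
by apply: contraTneq => ->; rewrite mulr0 ltxx.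
Qed.
End Moments.

(** * The half-plane map and integral representations *)

Section Tilted.
Context {R : realType} (lam : R) (hlam : - (pi / 2) < lam < pi / 2).
Implicit Types (z w x : R[i]) (f g p : R[i] -> R[i]).
Notation E := (expi lam).
Notation e := (expi (- 2 * lam)).

Lemma cos_lam_gt0 : 0 < cos lam.
Proof. exact: cos_gt0_pihalf. Qed.

Lemma expi_tilt : E * e = E^*%C.
Proof. by rewrite -expiD -expiN; congr expi; ring. Qed.

Lemma expiE : E = (cos lam)%:C + 'i * (sin lam)%:C.
Proof. by rewrite [LHS]complexE. Qed.

Lemma conj_expiE : E^*%C = (cos lam)%:C - 'i * (sin lam)%:C.
Proof. by rewrite -expiN /expi cosN sinN; apply/eqP; rewrite eq_complex /=; apply/andP; split; apply/eqP; ring. Qed.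

Lemma cos_lam_neq0 : (cos lam)%:C != 0.
Proof. by rewrite eq_complex /= eqxx andbT gt_eqF// cos_lam_gt0. Qed.

Lemma tilt_factor : E * (1 + e) = 2 * (cos lam)%:C.
Proof. by rewrite mulrDr mulr1 expi_tilt conj_expiE expiE; ring. Qed.

Lemma tilt_factor_neq0 : 1 + e != 0.
Proof.
apply/eqP => h; have := tilt_factor; rewrite h mulr0 => /esym/eqP; rewrite mulf_eq0 pnatr_eq0 /=.
by apply/negP/cos_lam_neq0.
Qed.

(** p_lam is, up to the rotation E, an affine image with real positive slope of
    the half-plane map. *)
Lemma expi_p_lambda w : 1 - w != 0 ->
  E * p_lambda lam w = (cos lam)%:C * ((1 + w) / (1 - w)) + 'i * (sin lam)%:C.
Proof.
move=> w1; rewrite /p_lambda mulrA mulrDr mulr1 mulrA expi_tilt conj_expiE expiE.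
by field; rewrite w1.
Qed.

Lemma ReD z w : Re (z + w) = Re z + Re w.
Proof. by case: z w => ? ? []. Qed.
Lemma ReB z w : Re (z - w) = Re z - Re w.
Proof. by case: z w => ? ? []. Qed.
Lemma Re_i_real (a : R) : Re ('i%C * a%:C) = 0.
Proof. by rewrite /=; ring. Qed.

(** The real part is (1 - |w|^2) / |1 - w|^2, and |1 - w| is at most 1 + |w|.
    The bound depends on |w| only, hence survives averaging over rotations of w.
    *)
Lemma Re_half_plane_map w : normc w < 1 ->
  (1 - normc w) / (1 + normc w) <= Re ((1 + w) / (1 - w)).
Proof.
move=> w1; have n0 := normc_ge0 w.
have d0 : 1 - w != 0.
  by rewrite subr_eq0; apply/eqP => h; move: w1; rewrite -h normc1 ltxx.
have nd : 0 < normc (1 - w) by rewrite normc_gt0.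
have -> : Re ((1 + w) / (1 - w)) = (1 - normc w ^+ 2) / normc (1 - w) ^+ 2.
  have dM (u v : R[i]) : dotc (u * v) v = Re u * normc v ^+ 2.
    by rewrite -dotcc; case: u v => a b [c d]; rewrite !dotcE /dotc /=; ring.
  have := dM ((1 + w) / (1 - w)) (1 - w); rewrite divfK// => h.
  apply: (@mulIf _ (normc (1 - w) ^+ 2)); first by rewrite expf_neq0// gt_eqF.
  rewrite -h divfK; last by rewrite expf_neq0// gt_eqF.
  by rewrite -dotcc; case: (w) => a b; rewrite /dotc /=; ring.
have n1 : 0 < 1 + normc w by lra.
have hle : normc (1 - w) <= 1 + normc w.
  by apply: (le_trans (ler_normcD _ _)); rewrite normc1 normcN.
have hle2 : normc (1 - w) ^+ 2 <= (1 + normc w) ^+ 2 by rewrite ler_pXn2r ?nnegrE// ltW.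
rewrite ler_pdivlMr ?exprn_gt0// mulrAC ler_pdivrMr//.
have -> : (1 - normc w ^+ 2) * (1 + normc w) = (1 - normc w) * (1 + normc w) ^+ 2 by ring.
by rewrite ler_wpM2l// subr_ge0 ltW.
Qed.

Lemma Re_expi_p_lambda w : normc w < 1 ->
  cos lam * ((1 - normc w) / (1 + normc w)) <= Re (E * p_lambda lam w).
Proof.
move=> w1; have d0 : 1 - w != 0.
  by rewrite subr_eq0; apply/eqP => h; move: w1; rewrite -h normc1 ltxx.
rewrite expi_p_lambda// ReD Re_i_real addr0 ReM oppr0 mul0r addr0.
by rewrite ler_wpM2l ?(ltW cos_lam_gt0)// Re_half_plane_map.
Qed.

Lemma Re_expi_p_lambda_gt0 w : normc w < 1 -> 0 < Re (E * p_lambda lam w).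
Proof.
move=> w1; apply: lt_le_trans (Re_expi_p_lambda w1); rewrite mulr_gt0 ?cos_lam_gt0//.
by rewrite divr_gt0 ?subr_gt0// ltr_wpDr ?normc_ge0.
Qed.

(** With u = E w and e E the conjugate of E, this compares the distances of u to
    E and to its reflection in the imaginary axis. *)
Lemma norm_tilt w : normc (w + e) ^+ 2 - normc (w - 1) ^+ 2 = 4 * cos lam * Re (E * w).
Proof.
have -> : normc (w + e) = normc (E * w + E^*%C).
  by rewrite -expi_tilt -mulrDr normcM normc_expi mul1r.
have -> : normc (w - 1) = normc (E * w - E).
  by rewrite -{2}[E]mulr1 -mulrBr normcM normc_expi mul1r.
set u := E * w; rewrite conj_expiE expiE; case: u => a b.
rewrite -!dotcc.
have -> : (a +i* b) + ((cos lam)%:C - 'i * (sin lam)%:C) = (a + cos lam) +i* (b - sin lam).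
  by apply/eqP; rewrite eq_complex /=; apply/andP; split; apply/eqP; ring.
have -> : (a +i* b) - ((cos lam)%:C + 'i * (sin lam)%:C) = (a - cos lam) +i* (b - sin lam).
  by apply/eqP; rewrite eq_complex /=; apply/andP; split; apply/eqP; ring.
by rewrite !dotcE /=; ring.
Qed.

Lemma analyticP f : analytic f <-> forall z, normc z < 1 -> cderivable f z.
Proof. by split=> h z; have := h z; rewrite discE. Qed.

Lemma tilted_caratheodoryP f : tilted_caratheodory lam f <->
  analytic0 f /\ forall z, normc z < 1 -> 0 < Re (E * f z).
Proof. by split=> -[h1 h2]; split=> // z; have := h2 z; rewrite discE. Qed.

Lemma one_sub_neq0 w : normc w < 1 -> 1 - w != 0.
Proof. by move=> w1; rewrite subr_eq0; apply/eqP => h; move: w1; rewrite -h normc1 ltxx. Qed.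

Definition untilt p z : R[i] := (E * p z - 'i%C * (sin lam)%:C) / (cos lam)%:C.

Lemma Re_divr (u : R[i]) (a : R) : Re (u / a%:C) = Re u / a.
Proof. by rewrite -fmorphV mulrC ReM /= oppr0 mul0r addr0 mulrC. Qed.

Lemma tilted_untilt p : tilted_caratheodory lam p -> tilted_caratheodory 0 (untilt p).
Proof.
move=> /tilted_caratheodoryP[[/analyticP hp p0] pos]; split; first split.
- apply/analyticP => z z1; apply: (@cderivable_div _ (fun z => E * p z - 'i%C * (sin lam)%:C) (fun=> (cos lam)%:C)).
  + exact: cos_lam_neq0.
  + exact: (cderivableB (cderivableM (cderivable_cst E z) (hp z z1)) (cderivable_cst _ z)).
  + exact: cderivable_cst.
- by rewrite /untilt p0 mulr1 expiE addrK divff// cos_lam_neq0.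
move=> z; rewrite discE => z1; rewrite expi0 mul1r /untilt Re_divr ReB Re_i_real subr0.
by rewrite divr_gt0 ?pos ?cos_lam_gt0.
Qed.

(** Solve for p in the representation of the untilted function, with i sin(lam)
    absorbed in the integral since the total mass is 1. *)
Lemma untilt_herglotz p : tilted_caratheodory 0 (untilt p) ->
  exists mu : probability (borel_circle R) R, forall z, disc z ->
    p z = complex_integral mu (fun y =>
      (1 + e * circle_val y * z) / (1 - circle_val y * z)).
Proof.
move=> [[/analyticP hq q0] pos].
have [|mu hmu] := herglotz hq q0.
  by move=> z z1; have := pos z; rewrite discE expi0 mul1r; exact.
exists mu => z; rewrite discE => z1; apply: (mulfI (expi_neq0 lam)).
rewrite -[complex_integral _ _]/(cintegral mu setT _) -cintegralZ//; last first.
  apply: (@circle_cintegrable _ mu (fun x => (1 + e * x * z) / (1 - x * z))) => x x1.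
  apply: derivable_continuous_at.
  apply: (@cderivable_div _ (fun x => 1 + e * x * z) (fun x => 1 - x * z)).
  - exact: one_sub_mul_neq0 z1.
  - exact: (cderivableD (cderivable_cst 1 x) (cderivableM (cderivableM (cderivable_cst e x) (cderivable_id x)) (cderivable_cst z x))).
  - exact: (cderivableB (cderivable_cst 1 x) (cderivableM (cderivable_id x) (cderivable_cst z x))).
have mT : measurable [set: borel_circle R] by exact: measurableT.
have ik : cintegrable mu setT (fun y => herglotz_kernel z (circle_val y)).
  by apply: circle_cintegrable => x x1; exact/derivable_continuous_at/cderivable_herglotz_kernel.
have i1 := cintegrable_cst ('i%C * (sin lam)%:C) mT (circle_finite mu).
transitivity (cintegral mu setT (fun y => (cos lam)%:C * herglotz_kernel z (circle_val y) + 'i%C * (sin lam)%:C)).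
  rewrite cintegralD//; last exact: cintegrableZ.
  rewrite cintegralZ// -hmu// cintegral_cst// fine_probability mulr1 /untilt.
  by field; rewrite cos_lam_neq0.
apply: eq_cintegral => y _; rewrite /herglotz_kernel.
rewrite -expi_p_lambda /p_lambda; last by apply: one_sub_neq0; rewrite normcM normc_circle_val mul1r.
by rewrite (mulrA e).
Qed.

Section Representation.
Context (p : R[i] -> R[i]) (mu : probability (borel_circle R) R)
  (hmu : forall z, disc z ->
    p z = complex_integral mu (fun y =>
      (1 + e * circle_val y * z) / (1 - circle_val y * z))).

Lemma cderivable_p_lambda w : normc w < 1 -> cderivable (p_lambda lam) w.
Proof.
move=> w1; apply: (@cderivable_div _ (fun w => 1 + e * w) (fun w => 1 - w)).
- exact: one_sub_neq0.
- exact: (cderivableD (cderivable_cst 1 w) (cderivableM (cderivable_cst e w) (cderivable_id w))).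
- exact: (cderivableB (cderivable_cst 1 w) (cderivable_id w)).
Qed.

Lemma representationE z : normc z < 1 ->
  p z = cintegral mu setT (fun y => p_lambda lam (circle_val y * z)).
Proof.
move=> z1; rewrite hmu ?discE//; apply: eq_cintegral => y _.
by rewrite /p_lambda mulrA.
Qed.

Lemma rotated_continuous f z : (forall w, normc w < 1 -> cderivable f w) -> normc z < 1 ->
  forall x, normc x = 1 -> {for x, continuous ((fun x => f (x * z)) : R[i]^o -> R[i]^o)}.
Proof.
move=> hf z1 x x1.
apply: (@continuous_comp _ _ _ (fun x : R[i]^o => x * z : R[i]^o) (f : R[i]^o -> R[i]^o)).
  exact: derivable_continuous_at (cderivableM (cderivable_id x) (cderivable_cst z x)).
by apply: derivable_continuous_at; apply: hf; rewrite normcM x1 mul1r.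
Qed.

Lemma representation_tilted : analytic0 p -> tilted_caratheodory lam p.
Proof.
move=> hp; apply/tilted_caratheodoryP; split=> // z z1.
have cp x : normc x = 1 -> {for x, continuous ((fun x => E * p_lambda lam (x * z)) : R[i]^o -> R[i]^o)}.
  move=> x1; have := rotated_continuous cderivable_p_lambda z1 x1.
  exact: (@cvgM R[i] R[i]^o (nbhs (x : R[i]^o)) _ (fun=> E) _ E _ (cvg_cst _)).
rewrite representationE// -cintegralZ//; last first.
  by apply: (@circle_cintegrable _ mu (fun x => p_lambda lam (x * z))); exact: rotated_continuous cderivable_p_lambda z1.
apply: (@lt_le_trans _ _ (cos lam * ((1 - normc z) / (1 + normc z)))).
  by rewrite mulr_gt0 ?cos_lam_gt0// divr_gt0 ?subr_gt0// ltr_wpDr ?normc_ge0.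
apply: (circle_integral_Re_ge mu cp) => x x1.
have nx : normc (x * z) = normc z by rewrite normcM x1 mul1r.
by rewrite -nx; apply: Re_expi_p_lambda; rewrite nx.
Qed.

Lemma has_power_series_p_lambda : has_power_series (p_lambda lam) (tilt_coef (1 + e)).
Proof.
have := @has_power_series_tilt _ (1 + e) _ _ has_power_series_geometric; rewrite subr0 invr1 => /(_ erefl).
rewrite (_ : (fun n => _) = tilt_coef (1 + e)); last by apply/funext => n; rewrite mulr1.
apply: has_power_series_ext => z z1; rewrite /tilt /p_lambda subr0 invr1.
by field; rewrite one_sub_neq0.
Qed.

Lemma representation_power_series :
  has_power_series p (fun n => tilt_coef (1 + e) n * moment mu n).
Proof.
have := has_power_series_moments (mu := mu) has_power_series_p_lambda; move=> h; apply: (has_power_series_ext _ (h _)) => [z|z z1].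
  by move=> /representationE.
by apply: derivable_continuous_at; exact: cderivable_p_lambda.
Qed.
End Representation.
End Tilted.

(** * Subordination and dual sets *)

Section Subordination.
Context {R : realType} (lam : R) (hlam : - (pi / 2) < lam < pi / 2).
Implicit Types (z w x : R[i]) (f g p : R[i] -> R[i]).
Notation E := (expi lam).
Notation e := (expi (- 2 * lam)).

Lemma tilted_norm_lt w : 0 < Re (E * w) -> normc (w - 1) < normc (w + e).
Proof.
move=> h; rewrite -(@ltr_pXn2r _ 2) ?nnegrE ?normc_ge0// -subr_gt0 norm_tilt//.
by rewrite !mulr_gt0// cos_lam_gt0.
Qed.

(** The required function is the composition of p with the inverse (w - 1) / (w
    + e) of p_lam. *)
Lemma tilted_subordinate p : tilted_caratheodory lam p -> subordinate p (p_lambda lam).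
Proof.
move=> /tilted_caratheodoryP[[/analyticP hp p0] pos].
have nz z : normc z < 1 -> p z + e != 0.
  move=> /pos /tilted_norm_lt; rewrite -normc_gt0; apply: le_lt_trans; exact: normc_ge0.
exists (fun z => (p z - 1) / (p z + e)); split.
- apply/analyticP => z z1; apply: (@cderivable_div _ (fun z => p z - 1) (fun z => p z + e)).
  + exact: nz.
  + exact: (cderivableB (hp z z1) (cderivable_cst 1 z)).
  + exact: (cderivableD (hp z z1) (cderivable_cst e z)).
- by rewrite p0 subrr mul0r.
- move=> z; rewrite discE => z1; rewrite normr_normc -(ltcR _ 1) in z1 *.
  rewrite ltcR normcM normcV ltr_pdivrMr ?mul1r ?normc_gt0 ?nz -?(ltcR _ 1)//.
  by apply: tilted_norm_lt; apply: pos; rewrite -(ltcR _ 1).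
- move=> z; rewrite discE => z1; rewrite /p_lambda.
  have k0 := tilt_factor_neq0 hlam; have n0 := nz z z1.
  have d0 : p z + e - (p z - 1) != 0 by rewrite (_ : _ - _ = 1 + e)//; ring.
  by field; rewrite n0.
Qed.

Lemma subordinate_tilted p : analytic0 p -> subordinate p (p_lambda lam) ->
  tilted_caratheodory lam p.
Proof.
move=> hp [om [_ _ om1 pE]]; apply/tilted_caratheodoryP; split=> // z z1.
rewrite pE ?discE//; apply: Re_expi_p_lambda_gt0 => //.
by rewrite -ltcR -normr_normc; apply: om1; rewrite discE.
Qed.

Lemma tilted_representation p : tilted_caratheodory lam p ->
  exists mu : probability (borel_circle R) R, forall z, disc z ->
    p z = complex_integral mu (fun y => (1 + e * circle_val y * z) / (1 - circle_val y * z)).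
Proof. by move=> /(tilted_untilt hlam)/(untilt_herglotz hlam). Qed.

Definition v_function x z : R[i] := (1 + (1 - e * x) / ((1 + e) * x) * z) / (1 - z).
(** The factor k for which v_function x is tilt k (1 / (1 - z)). *)
Definition v_factor x : R[i] := (x + 1) / ((1 + e) * x).

Lemma normc1_neq0 x : normc x = 1 -> x != 0.
Proof. by move=> x1; rewrite -normc_gt0 x1 ltr01. Qed.

Lemma has_power_series_v_function x : normc x = 1 ->
  has_power_series (v_function x) (tilt_coef (v_factor x)).
Proof.
move=> /normc1_neq0 x0; have k0 := tilt_factor_neq0 hlam.
have := @has_power_series_tilt _ (v_factor x) _ _ has_power_series_geometric; rewrite subr0 invr1 => /(_ erefl).
rewrite (_ : (fun n => _) = tilt_coef (v_factor x)); last by apply/funext => n; rewrite mulr1.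
apply: has_power_series_ext => z z1; rewrite /tilt /v_function /v_factor subr0 invr1.
by field; rewrite one_sub_neq0// x0 k0.
Qed.

Lemma convolution_v_function x p a z : normc x = 1 -> has_power_series p a -> p 0 = 1 ->
  normc z < 1 -> convolution (v_function x) p z = 1 + v_factor x * (p z - 1).
Proof.
move=> x1 hp p0 z1; rewrite (convolutionE (has_power_series_v_function x1) hp (@has_power_series_tilt R (v_factor x) p a hp p0) z1).
by rewrite /tilt p0.
Qed.

Lemma tilted_dual p : tilted_caratheodory lam p -> dual (V_ lam) p.
Proof.
move=> hp; have [mu hmu] := tilted_representation hp.
have hs := representation_power_series hmu.
move: hp => /tilted_caratheodoryP[[ap p0] pos]; split=> // f [x [x1 ->]] z; rewrite discE => z1.
have {}x1 : normc x = 1 by apply: complexI.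
rewrite -[X in convolution X]/(v_function x) (convolution_v_function x1 hs p0 z1).
have x0 := normc1_neq0 x1; have k0 := tilt_factor_neq0 hlam.
apply/eqP => h; have : x * (p z + e) = - (p z - 1).
  have : (1 + e) * x * (1 + v_factor x * (p z - 1)) = 0 by rewrite h mulr0.
  rewrite /v_factor (_ : _ * (1 + _) = (1 + e) * x + (x + 1) * (p z - 1)).
    by move=> h2; apply/eqP; rewrite -subr_eq0 -h2; apply/eqP; ring.
  by field; rewrite x0 k0.
move=> /(congr1 normc); rewrite normcN normcM x1 mul1r => hn.
by have := tilted_norm_lt (pos z z1); rewrite hn ltxx.
Qed.

(** If E p is imaginary at w, the number x = (1 - p(w)) / (p(w) + e) has modulus
    1 and the corresponding convolution vanishes at w. So Re (E p) has no zero,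
    and it is cos(lam) > 0 at the origin. *)
Lemma dual_tilted p : dual (V_ lam) p -> tilted_caratheodory lam p.
Proof.
move=> [ap hV]; have [/analyticP hp p0] := ap.
have vV x : normc x = 1 -> V_ lam (v_function x).
  by move=> x1; exists x; split=> //; rewrite normr_normc x1.
have [a ha] : exists a, has_power_series p a.
  apply: contrapT => hn; have := hV _ (vV 1 normc1) 0.
  by rewrite convolution_no_series// eqxx discE normc0 => /(_ ltr01).
apply/tilted_caratheodoryP; split=> // z z1.
have noim w : normc w < 1 -> Re (E * p w) != 0.
  move=> w1; apply/eqP => re0.
  have nn : normc (p w + e) = normc (p w - 1).
    apply/eqP; rewrite -(@eqrXn2 _ 2) ?normc_ge0// -subr_eq0 norm_tilt// re0 mulr0 //.
  have pe : p w + e != 0.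
    apply/eqP => h; have := re0; rewrite (_ : p w = - e); last by apply/eqP; rewrite -addr_eq0 h.
    rewrite mulrN expi_tilt /= => /eqP; rewrite oppr_eq0; apply/negP.
    by rewrite gt_eqF// cos_lam_gt0.
  have p1 : p w - 1 != 0 by rewrite -normc_gt0 -nn normc_gt0.
  pose x := - (p w - 1) / (p w + e).
  have x1 : normc x = 1.
    by rewrite normcM normcV normcN nn divff// normc_eq0.
  have := hV _ (vV x x1) w; rewrite discE => /(_ w1).
  rewrite (convolution_v_function x1 ha p0 w1) /v_factor /x.
  have k0 := tilt_factor_neq0 hlam.
  by move=> /eqP; apply; field; rewrite k0 pe p1.
rewrite ltNge; apply/negP => hle.
pose phi (t : R) := Re (E * p (t%:C * z)).
have tz t : 0 <= t <= 1 -> normc (t%:C * z) < 1.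
  move=> /andP[t0 t1]; rewrite normcM normc_real ger0_norm//.
  by apply: le_lt_trans z1; rewrite ler_piMl ?normc_ge0.
have cphi : {within `[0, 1], continuous phi}.
  apply: continuous_in_subspaceT => t; rewrite inE /= in_itv /= => /tz t1.
  apply: (@continuous_comp _ _ _ (fun t : R => E * p (t%:C * z) : R[i]^o) (Re : R[i]^o -> R)); last exact: Re_continuous.
  apply: (@cvgM R[i]); first exact: cvg_cst.
  apply: (@continuous_comp _ _ _ (fun t : R => t%:C * z : R[i]^o) (p : R[i]^o -> R[i]^o)).
    by apply: (@cvgM R[i]); [exact: real_complex_continuous|exact: cvg_cst].
  by apply: derivable_continuous_at; exact: hp.
have phi0 : phi 0 = cos lam by rewrite /phi mul0r p0 mulr1.
have phi1 : phi 1 <= 0 by rewrite /phi mul1r.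
have [|t] := IVT ler01 cphi (v := 0).
  by rewrite ge_min phi1 orbT le_max phi0 (ltW (cos_lam_gt0 hlam)).
rewrite in_itv /= => /tz t1 /eqP; apply/negP; exact: noim.
Qed.

Definition w_function x y (t : R) z : R[i] :=
  t%:C * ((1 + x * e * z) / (1 - x * z)) + (1 - t)%:C * ((1 + y * e * z) / (1 - y * z)).

Lemma w_functionE x y (t : R) z :
  w_function x y t z = t%:C * p_lambda lam (x * z) + (1 - t)%:C * p_lambda lam (y * z).
Proof. by rewrite /w_function /p_lambda -!(mulrC e) !(mulrA e). Qed.

Lemma w_function_tilted x y (t : R) : normc x = 1 -> normc y = 1 -> 0 <= t <= 1 ->
  tilted_caratheodory lam (w_function x y t).
Proof.
move=> x1 y1 /andP[t0 t1].
have nx u z : normc u = 1 -> normc z < 1 -> normc (u * z) < 1 by move=> u1 z1; rewrite normcM u1 mul1r.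
have -> : w_function x y t = (fun z => t%:C * p_lambda lam (x * z) + (1 - t)%:C * p_lambda lam (y * z)).
  by apply/funext => z; exact: w_functionE.
have dk u z : normc u = 1 -> normc z < 1 -> cderivable (fun z => p_lambda lam (u * z)) z.
  move=> u1 z1; apply: (@cderivable_div _ (fun z => 1 + e * (u * z)) (fun z => 1 - u * z)).
  - by apply: one_sub_neq0; exact: nx.
  - exact: (cderivableD (cderivable_cst 1 z) (cderivableM (cderivable_cst e z) (cderivableM (cderivable_cst u z) (cderivable_id z)))).
  - exact: (cderivableB (cderivable_cst 1 z) (cderivableM (cderivable_cst u z) (cderivable_id z))).
apply/tilted_caratheodoryP; split; first split.
- apply/analyticP => z z1.
  exact: (cderivableD (cderivableM (cderivable_cst t%:C z) (dk x z x1 z1)) (cderivableM (cderivable_cst (1 - t)%:C z) (dk y z y1 z1))).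
- rewrite !mulr0 /p_lambda !mulr0 addr0 subr0 divr1 !mulr1 -rmorphD /=.
  by rewrite addrC subrK.
have ReZ (a : R) w : Re (a%:C * w) = a * Re w by rewrite ReM /= oppr0 mul0r addr0.
move=> z z1.
have px := Re_expi_p_lambda_gt0 hlam (nx x z x1 z1).
have py := Re_expi_p_lambda_gt0 hlam (nx y z y1 z1).
move: px py; set P := p_lambda lam (x * z); set Q := p_lambda lam (y * z) => px py.
have -> : E * (t%:C * P + (1 - t)%:C * Q) = t%:C * (E * P) + (1 - t)%:C * (E * Q) by ring.
rewrite ReD !ReZ; have [->|t_neq0] := eqVneq t 0; first by rewrite mul0r add0r subr0 mul1r.
have {t_neq0} t_gt0 : 0 < t by rewrite lt_def t_neq0.
apply: ltr_pwDl; first exact: mulr_gt0.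
by apply: mulr_ge0; [rewrite subr_ge0|exact: ltW].
Qed.

Lemma has_power_series_w_function x y (t : R) : normc x = 1 -> normc y = 1 ->
  has_power_series (w_function x y t)
    (fun n => t%:C * (tilt_coef (1 + e) n * x ^+ n) + (1 - t)%:C * (tilt_coef (1 + e) n * y ^+ n)).
Proof.
move=> x1 y1; have hk := @has_power_series_p_lambda R lam.
apply: has_power_series_ext (has_power_seriesD (@has_power_seriesZ _ _ _ t%:C (has_power_series_rotate x1 hk)) (@has_power_seriesZ _ _ _ (1 - t)%:C (has_power_series_rotate y1 hk))).
by move=> z _; rewrite w_functionE.
Qed.

Lemma W_w_function x y (t : R) : normc x = 1 -> normc y = 1 -> 0 <= t <= 1 ->
  W_ lam (w_function x y t).
Proof. by move=> x1 y1 t01; exists x, y, t; split; rewrite ?normr_normc ?x1 ?y1. Qed.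

(** The values of G = tilt (1 + e) g on |w| = |z| have no chord through 0, since
    such chords are the convolutions of g with W_lam. The convolution of g with
    p averages these values. *)
Lemma representation_bidual p (mu : probability (borel_circle R) R) : analytic0 p ->
  (forall z, disc z -> p z = complex_integral mu (fun y =>
      (1 + e * circle_val y * z) / (1 - circle_val y * z))) ->
  dual (dual (W_ lam)) p.
Proof.
move=> ap hmu; split=> // g [[/analyticP hg g0] hW] z; rewrite discE => z1.
have [b hb] : exists b, has_power_series g b.
  apply: contrapT => hn.
  have := hW _ (@W_w_function 1 1 0 normc1 normc1 _) 0; rewrite lexx ler01 => /(_ isT).
  by rewrite convolution_no_series// eqxx discE normc0 => /(_ ltr01).
pose G := tilt (1 + e) g.
have hG : has_power_series G _ := @has_power_series_tilt R (1 + e) g b hb g0.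
have dG w : normc w < 1 -> cderivable G w.
  move=> w1; exact: (cderivableD (cderivable_cst 1 w) (cderivableM (cderivable_cst (1 + e) w) (cderivableB (hg w w1) (cderivable_cst (g 0) w)))).
have cG w : normc w < 1 -> {for w, continuous (G : R[i]^o -> R[i]^o)}.
  by move=> /dG/derivable_continuous_at.
have chord x y (t : R) : normc x = 1 -> normc y = 1 -> 0 <= t <= 1 ->
    t%:C * G (x * z) + (1 - t)%:C * G (y * z) != 0.
  move=> x1 y1 t01.
  have hh : has_power_series (fun z => t%:C * G (x * z) + (1 - t)%:C * G (y * z))
      (fun n => (t%:C * (tilt_coef (1 + e) n * x ^+ n) +
        (1 - t)%:C * (tilt_coef (1 + e) n * y ^+ n)) * b n).
    rewrite [X in has_power_series _ X](_ : _ =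
        (fun n => t%:C * (tilt_coef (1 + e) n * b n * x ^+ n) +
          (1 - t)%:C * (tilt_coef (1 + e) n * b n * y ^+ n))).
      exact: has_power_seriesD (@has_power_seriesZ _ _ _ t%:C (has_power_series_rotate x1 hG)) (@has_power_seriesZ _ _ _ (1 - t)%:C (has_power_series_rotate y1 hG)).
    by apply/funext => n; ring.
  have := hW _ (W_w_function x1 y1 t01) z; rewrite discE => /(_ z1).
  by rewrite (convolutionE (@has_power_series_w_function x y t x1 y1) hb hh z1).
have pipi : - pi <= pi :> R by have := pi_ge0 R; lra.
have [||c hc] := @half_plane R (fun t => G (expi t * z)) (- pi) pi pipi.
- move=> t _.
  have := rotated_continuous dG z1 (normc_expi t) => h.
  apply: (@continuous_comp _ _ _ (@expi R : R -> R[i]^o) ((fun x => G (x * z)) : R[i]^o -> R[i]^o)).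
    exact: expi_continuous.
  exact: h.
- by move=> s t tau _ _ ht; apply: chord => //; exact: normc_expi.
have hm : has_power_series (fun z => cintegral mu setT (fun y => G (circle_val y * z)))
    (fun n => b n * (tilt_coef (1 + e) n * moment mu n)).
  rewrite [X in has_power_series _ X](_ : _ = (fun n => tilt_coef (1 + e) n * b n * moment mu n)).
    exact: has_power_series_moments hG cG.
  by apply/funext => n; ring.
rewrite (convolutionE hb (representation_power_series hmu) hm z1).
apply: (@circle_integral_half_plane _ mu (fun x => G (x * z)) c).
  exact: rotated_continuous dG z1.
by move=> x /expi_surj[t ht ->]; exact: hc.
Qed.

Lemma convolutionC f g z : convolution f g z = convolution g f z.
Proof.
have h : (fun n => coefs f n * coefs g n * z ^+ n) = (fun n => coefs g n * coefs f n * z ^+ n).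
  have swap (a b c : R[i]) : a * b * c = b * a * c by rewrite (mulrC a).
  by apply/funext => n; exact: swap.
exact: (congr1 (fun u : nat -> R[i] => limn (series u : nat -> R[i]^o)) h).
Qed.

Lemma v_function_dual x : normc x = 1 -> dual (W_ lam) (v_function x).
Proof.
move=> x1; split; first split.
- apply/analyticP => z z1.
  apply: (@cderivable_div _ (fun z => 1 + (1 - e * x) / ((1 + e) * x) * z) (fun z => 1 - z)).
  + exact: one_sub_neq0.
  + exact: (cderivableD (cderivable_cst 1 z) (cderivableM (cderivable_cst _ z) (cderivable_id z))).
  + exact: (cderivableB (cderivable_cst 1 z) (cderivable_id z)).
- by rewrite /v_function mulr0 addr0 subr0 divr1.
move=> f [u [v [t [u1 v1 t01 ->]]]] z z1.
have {}u1 : normc u = 1 by apply: complexI.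
have {}v1 : normc v = 1 by apply: complexI.
have [_ hd] := tilted_dual (w_function_tilted u1 v1 t01).
rewrite convolutionC; apply: hd => //.
by exists x; split=> //; rewrite normr_normc x1.
Qed.

Lemma bidual_dual p : dual (dual (W_ lam)) p -> dual (V_ lam) p.
Proof.
move=> [ap hp]; split=> // f [x [x1 ->]] z z1; apply: hp => //.
by apply: v_function_dual; apply: complexI.
Qed.
End Subordination.

Theorem theorem1 (R : realType) (lam : R) (hlam : - (pi / 2) < lam < pi / 2)
    (p : R[i] -> R[i]) (hp : analytic0 p) :
  [<-> tilted_caratheodory lam p;
       tilted_caratheodory 0
         (fun z => (expi lam * p z - 'i%C * (sin lam)%:C) / (cos lam)%:C);
       exists mu : probability (borel_circle R) R,
         forall z : R[i], disc z ->
           p z = complex_integral mu (fun x =>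
             (1 + expi (- 2 * lam) * circle_val x * z) / (1 - circle_val x * z));
       subordinate p (p_lambda lam);
       dual (V_ lam) p;
       dual (dual (W_ lam)) p].
Proof.
tfae.
- exact: tilted_untilt.
- exact: untilt_herglotz.
- move=> [mu hmu]; apply: tilted_subordinate => //; exact: representation_tilted hmu hp.
- by move=> /(subordinate_tilted hlam hp)/(tilted_dual hlam).
- move=> /(dual_tilted hlam)/(tilted_representation hlam)[mu hmu].
  exact: representation_bidual hmu.
- by move=> /(bidual_dual hlam)/(dual_tilted hlam).
Qed.
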